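(* Let $\Omega\subset\mathbb R^d$ be open and $\omega\in\mathcal W$. Let $T\in\mathcal D'^{\{\omega\}}(\Omega)$ be a Roumieu ultradistribution. If $T$ is strictly associated to a regular Roumieu generalized ultradifferentiable function $g=[(g_\varepsilon)]\in\mathcal G^{\{\omega\},\infty}(\Omega)$, then $T$ is a Roumieu ultradifferentiable function: $T\in\mathcal E^{\{\omega\}}(\Omega)$.
   Context: $\mathbb R^+=[0,\infty)$. $\mathcal W$ is the set of all nondecreasing continuous functions $\omega:\mathbb R^+\to\mathbb R^+$ such that $\omega(0)=0$; $\omega(x+y)\le\omega(x)+\omega(y)$ for all $x,y\ge 0$; $\int_1^\infty \frac{\omega(t)}{t^2}\,dt<\infty$; and $\lim_{t\to\infty}\frac{\omega(t)}{\log(1+t)}=\infty$. For a compactly supported continuous $f$ on $\mathbb R^d$ and $l>0$: $\|f\|_l^{\omega}=\int|\hat f(\xi)|e^{l\omega(|\xi|)}d\xi\in[0,\infty]$. $\mathcal D^{\{\omega\}}(\Omega)$ is the set of continuous $f$ with compact support in $\Omega$ and $\|f\|_l^\omega<\infty$ for some $l>0$. $\mathcal D'^{\{\omega\}}(\Omega)$ is the space of linear functionals on $\mathcal D^{\{\omega\}}(\Omega)$ whose restriction to each Banach space $\{f:\operatorname{supp}f\subset K,\ \|f\|_l^\omega<\infty\}$ ($K\subset\Omega$ compact, $l>0$) is continuous. $\mathcal E^{\{\omega\}}(\Omega)$ is the set of smooth $f:\Omega\to\mathbb C$ with $\psi f\in\mathcal D^{\{\omega\}}(\Omega)$ for all $\psi\in\mathcal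 D^{\{\omega\}}(\Omega)$, regarded as a subspace of $\mathcal D'^{\{\omega\}}(\Omega)$ via $\langle f,\phi\rangle=\int f\phi$. For compact $K\subset\Omega$, $\|f\|_{K,l}^{\omega}=\inf\{\|\psi f\|_l^{\omega}:\psi\in\mathcal D^{\{\omega\}}(\Omega),\ \psi=1\text{ on }K\}$. Nets in $\mathcal E^{\{\omega\}}(\Omega)$ are indexed by $\varepsilon\in(0,1)$, $o(\cdot)$ is as $\varepsilon\to0^+$, $K$ ranges over compact subsets of $\Omega$. Moderate: $\forall K\,\forall k>0\,\exists h>0$: $\|g_\varepsilon\|_{K,h}^\omega=o(e^{k\omega(1/\varepsilon)})$. Negligible: $\forall K\,\exists k>0\,\exists h>0$: $\|g_\varepsilon\|_{K,h}^\omega=o(e^{-k\omega(1/\varepsilon)})$. $\mathcal G^{\{\omega\}}(\Omega)$ is the quotient of moderate by negligible nets. $g\in\mathcal G^{\{\omega\},\infty}(\Omega)$ (regular) means $g$ has a moderate representative with $\forall K\ \exists h>0\ \forall k>0$: $\|g_\varepsilon\|_{K,h}^\omega=o(e^{k\omega(1/\varepsilon)})$. $T$ is strictly associated to $g=[(g_\varepsilon)]$ if for every $\phi\in\mathcal D^{\{\omega\}}(\Omega)$ there is $l>0$ such that $\langle g_\varepsilon-T,\phi\rangle=o(e^{-l\omega(1/\varepsilon)})$. *)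

(* Defs.v *)
From HB Require Import structures.
From mathcomp Require Import all_boot all_order all_algebra.
From mathcomp Require Import all_classical all_reals all_analysis.
From mathcomp.real_closed Require Import complex.

Set Implicit Arguments.
Unset Strict Implicit.
Unset Printing Implicit Defensive.
Import Order.TTheory GRing.Theory Num.Theory.
Import numFieldNormedType.Exports.
Local Open Scope classical_set_scope.
Local Open Scope ring_scope.

Section LebesgueMeasure.
Context {R : realType}.
Local Notation mR := (measurableTypeR R).

Definition cons_pair n (p : mR * n.-tuple mR) : n.+1.-tuple mR :=
  [the n.+1.-tuple mR of p.1 :: p.2].

Lemma measurable_cons_pair n : measurable_fun setT (@cons_pair n).
Proof. exact: measurable_cons. Qed.

Section cons_measure.
Context (n : nat) (mu : {sigma_finite_measure set (n.-tuple mR) -> \bar R}).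

Definition cons_measure : set (n.+1.-tuple mR) -> \bar R :=
  pushforward ((@lebesgue_measure R) \x mu)%E (@cons_pair n).

Let cons_measure0 : cons_measure set0 = 0%E.
Proof. by rewrite /cons_measure /pushforward preimage_set0 measure0. Qed.

Let cons_measure_ge0 A : (0 <= cons_measure A)%E.
Proof. by rewrite /cons_measure /pushforward measure_ge0. Qed.

Let cons_measure_sigma_additive : semi_sigma_additive cons_measure.
Proof.
move=> F mF tF mUF; rewrite /cons_measure /pushforward preimage_bigcup.
apply: measure_semi_sigma_additive.
- by move=> k; rewrite -[X in measurable X]setTI; exact: measurable_cons_pair.
- apply/trivIsetP => i j _ _ ij; rewrite -preimage_setI.
  by move/trivIsetP : tF => /(_ _ _ _ _ ij) ->//; rewrite preimage_set0.
- rewrite -preimage_bigcup -[X in measurable X]setTI.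
  exact: measurable_cons_pair.
Qed.

HB.instance Definition _ := isMeasure.Build _ _ _ cons_measure
  cons_measure0 cons_measure_ge0 cons_measure_sigma_additive.

Lemma cons_measure_sigma_finite : sigma_finite setT cons_measure.
Proof.
pose l : {sigma_finite_measure set mR -> \bar R} := @lebesgue_measure R.
have /sigma_finiteP[A [TA ndA Aoo]] := sigma_finiteT l.
have /sigma_finiteP[B [TB ndB Boo]] := sigma_finiteT mu.
pose u (t : n.+1.-tuple mR) : mR * n.-tuple mR := (thead t, [tuple of behead t]).
have mu_u : measurable_fun setT u.
  by apply/measurable_fun_pairP; split;
    [exact: measurable_tnth|exact: measurable_behead].
have uK : cancel (@cons_pair n) u.
  by case=> x t; congr pair; apply/val_inj.
exists (fun k => u @^-1` (A k `*` B k)).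
  rewrite -preimage_bigcup [X in _ @^-1` X](_ : _ = setT) ?preimage_setT//.
  rewrite -subTset => -[x t] _; rewrite /bigcup/=.
  have [i _ Aix] : (\bigcup_i A i) x by rewrite -TA.
  have [j _ Bjt] : (\bigcup_i B i) t by rewrite -TB.
  exists (maxn i j) => //; split => /=.
    by move: x Aix; exact/subsetPset/ndA/leq_maxl.
  by move: t Bjt; exact/subsetPset/ndB/leq_maxr.
move=> k; have [mA Ak] := Aoo k; have [mB Bk] := Boo k; split.
  by rewrite -[X in measurable X]setTI; apply: mu_u => //; exact: measurableX.
rewrite /cons_measure /pushforward -comp_preimage.
rewrite (_ : u \o _ = id) ?preimage_id; last by apply/funext => p; exact: uK.
by rewrite (product_measure1E l mu)// lte_mul_pinfty// ge0_fin_numE.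
Qed.

HB.instance Definition _ := @Measure_isSigmaFinite.Build _ _ _
  cons_measure cons_measure_sigma_finite.

End cons_measure.

Fixpoint lebesgue_nd (n : nat) :
    {sigma_finite_measure set (n.-tuple mR) -> \bar R} :=
  match n with
  | 0 => @dirac _ (0.-tuple mR) [tuple] R
  | m.+1 => cons_measure (lebesgue_nd m)
  end.

End LebesgueMeasure.

Section Ultradifferentiable.
Context {R : realType} {d : nat}.
Local Notation V := 'rV[R]_d.
Local Notation C := R[i].
Local Notation normc := (@ComplexField.Normc.normc R).
Local Notation Re := (@complex.Re R).
Local Notation Im := (@complex.Im R).

(* The measure lives on tuples, topology and derivatives on row vectors. *)
Definition row_of_tuple (t : d.-tuple R) : V := \row_i tnth t i.

Definition cintegral (F : V -> C) : C :=
  Complex (\int[@lebesgue_nd R d]_t Re (F (row_of_tuple t)))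
          (\int[@lebesgue_nd R d]_t Im (F (row_of_tuple t))).

Definition dotv (x y : V) : R := \sum_i x 0 i * y 0 i.

(* The library norm on V is the sup norm. *)
Definition enorm (x : V) : R := Num.sqrt (\sum_i x 0 i ^+ 2).

Definition expi (t : R) : C := Complex (cos t) (sin t).

Definition fourier (f : V -> C) (xi : V) : C :=
  cintegral (fun x => f x * expi (- dotv x xi)).

Definition ccontinuous (f : V -> C) : Prop :=
  continuous (fun x => Re (f x)) /\ continuous (fun x => Im (f x)).

Definition tsupport (f : V -> C) : set V := closure [set x | f x != 0].

Fixpoint iter_partial (s : seq 'I_d) (F : V -> R) : V -> R :=
  if s is i :: s' then fun x => 'D_(delta_mx 0 i) (iter_partial s' F) x else F.

Definition smooth_on (Omega : set V) (F : V -> R) : Prop :=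
  forall s x, Omega x ->
    {for x, continuous (iter_partial s F)} /\
    forall i, derivable (iter_partial s F) x (delta_mx 0 i).

Definition csmooth_on (Omega : set V) (f : V -> C) : Prop :=
  smooth_on Omega (fun x => Re (f x)) /\ smooth_on Omega (fun x => Im (f x)).

(* Weights are total functions on R; only their values on [0, +oo[ matter. *)
Record weight (w : R -> R) : Prop := {
  weight_ge0 : forall x, 0 <= x -> 0 <= w x;
  weight_homo : forall x y, 0 <= x -> x <= y -> w x <= w y;
  weight_continuous : {within `[0, +oo[, continuous w};
  weight0 : w 0 = 0;
  weightD : forall x y, 0 <= x -> 0 <= y -> w (x + y) <= w x + w y;
  weight_integral :
    (\int[@lebesgue_measure R]_(t in `[1%R, +oo[) (w t / t ^+ 2)%:E < +oo)%E;
  weight_lim : w t / ln (1 + t) @[t --> +oo] --> +oo }.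

Variables (w : R -> R) (Omega : set V).

Definition unorm (l : R) (f : V -> C) : \bar R :=
  (\int[@lebesgue_nd R d]_t
     (normc (fourier f (row_of_tuple t)) *
      expR (l * w (enorm (row_of_tuple t))))%:E)%E.

Definition test_functions : set (V -> C) :=
  [set f | [/\ ccontinuous f, compact (tsupport f), tsupport f `<=` Omega
             & exists2 l, 0 < l & (unorm l f < +oo)%E]].

Definition banach_space (K : set V) (l : R) : set (V -> C) :=
  [set f | [/\ ccontinuous f, tsupport f `<=` K & (unorm l f < +oo)%E]].

(* Functionals are total on V -> C; only their values on test functions
   matter. *)
Definition linear_on_test (T : (V -> C) -> C) : Prop :=
  forall (a : C) f g, test_functions f -> test_functions g ->
    T (fun x => a * f x + g x) = a * T f + T g.

Definition continuous_on_banach (K : set V) (l : R) (T : (V -> C) -> C) : Prop :=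
  forall f, banach_space K l f ->
  forall e : R, 0 < e -> exists2 delta : R, 0 < delta &
  forall g, banach_space K l g ->
    (unorm l (fun x => g x - f x)%R < delta%:E)%E -> normc (T g - T f) < e.

Definition ultradistribution (T : (V -> C) -> C) : Prop :=
  linear_on_test T /\
  forall K l, compact K -> K `<=` Omega -> 0 < l -> continuous_on_banach K l T.

(* A function on Omega is represented by any total extension. *)
Definition ultradiff : set (V -> C) :=
  [set f | csmooth_on Omega f /\
           forall psi, test_functions psi ->
             test_functions (fun x => psi x * f x)].

Definition pairing (f phi : V -> C) : C := cintegral (fun x => f x * phi x).

Definition is_ultradiff (T : (V -> C) -> C) : Prop :=
  exists2 f, ultradiff f & forall phi, test_functions phi -> T phi = pairing f phi.

Definition unormK (K : set V) (l : R) (f : V -> C) : \bar R :=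
  ereal_inf [set unorm l (fun x => psi x * f x) | psi in
    [set psi | test_functions psi /\ forall x, K x -> psi x = 1]].

Definition little_o_exp (N : R -> \bar R) (k : R) : Prop :=
  forall c : R, 0 < c ->
    \forall e \near 0^'+, (`|N e| <= (c * expR (k * w e^-1))%:E)%E.

Definition net := R -> V -> C.

Definition ultradiff_net (g : net) : Prop :=
  forall e, 0 < e < 1 -> ultradiff (g e).

Definition moderate : set net :=
  [set g | ultradiff_net g /\
    forall K, compact K -> K `<=` Omega -> forall k : R, 0 < k ->
    exists2 h : R, 0 < h & little_o_exp (fun e => unormK K h (g e)) k].

Definition negligible_net : set net :=
  [set g | ultradiff_net g /\
    forall K, compact K -> K `<=` Omega ->
    exists k h : R, [/\ 0 < k, 0 < h &
      little_o_exp (fun e => unormK K h (g e)) (- k)]].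

(* Elements of the quotient are equivalence classes of moderate nets. *)
Definition gen_class (g : net) : set net :=
  [set h | moderate h /\ negligible_net (fun e x => h e x - g e x)].

Definition gen_functions : set (set net) := [set gen_class g | g in moderate].

Definition regular_gen_functions : set (set net) :=
  [set X | gen_functions X /\
    exists2 g, X g &
    forall K, compact K -> K `<=` Omega ->
    exists2 h : R, 0 < h & forall k : R, 0 < k ->
      little_o_exp (fun e => unormK K h (g e)) k].

(* Negligible nets pair to O(exp (- l w(1/e))) with each test function, so the
   choice of representative is immaterial. *)
Definition strictly_associated (T : (V -> C) -> C) (X : set net) : Prop :=
  exists2 g, X g &
  forall phi, test_functions phi -> exists2 l : R, 0 < l &
    little_o_exp (fun e => (normc (pairing (g e) phi - T phi))%:E) (- l).

End Ultradifferentiable.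

(* Main.v *)
Require Import Defs.
From mathcomp Require Import all_boot all_order all_algebra.
From mathcomp Require Import all_classical all_reals all_analysis.
From mathcomp.real_closed Require Import complex.
From mathcomp Require Import measurable_realfun.
From mathcomp Require Import ring lra.

(** The theorem holds because the Fourier transforms of the localisations of [T]
    decay exponentially in the weight. Fix a test function [chi], write [om xi]
    for the weight of the length of [xi], and let [tau xi] be the value of [T] at
    [chi] times the character of frequency [- xi], that is, the transform of
    [chi T]. Two estimates on the net are played against each other.

    Regularity says that the transform of [chi g_e] at [xi] is at most
    [C exp (k w e^-1 - b om xi)], for small [e], with [k > 0] arbitrary and [b]
    independent of [k] ([regular_fourier_bound]). The seminorms of the net are
    infima over cutoffs, and a finite infimum supplies a cutoff equal to one on
    the support of [chi]; products are then estimated by convolving transforms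
    ([fourierM]).

    Strict association gives for each test function a rate
    [exp (- m w e^-1)]. Applied to the modulations of [chi] it gives a rate for
    each frequency, which has to be made uniform: a gliding hump argument
    ([gliding_hump]), run on series of modulations of [chi] that are again test
    functions ([series_un]), bounds the difference of the transforms of [chi g_e]
    and [chi T] by [K exp (l om xi - w e^-1 / K)] ([uniform_association]).

    As the weight is continuous and unbounded, for each [xi] there is a small [e]
    for which [w e^-1] is, up to a constant, a prescribed large multiple of
    [om xi]. For that [e] the second estimate is exponentially small in
    [om xi], and so is the first, because [k] may be taken small in comparison
    with that multiple; hence [|tau xi| <= C exp (- c om xi)]. Interpolating
    between the two estimates then shows that the transform of [chi g_e] tends to
    [tau] at the rate [exp (- q w e^-1)], with a factor [exp (- c om xi)]
    ([transform_limit]).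

    Since the weight dominates the logarithm, this factor decreases faster than
    any power. By Fourier inversion ([fourier_inversion], [cc_inversion]) the
    functions [chi g_e] converge uniformly to the inverse transform of [tau],
    which is smooth ([invF_smooth]). Letting [chi] vary, the net converges
    locally uniformly on the open set to a smooth function [f]; the transform of
    [chi f] is [tau], so [chi f] is a test function, and evaluating at frequency
    zero shows that [T] is integration against [f] ([limit_is_ultradiff]). *)

Set Implicit Arguments.
Unset Strict Implicit.
Unset Printing Implicit Defensive.
Import Order.TTheory GRing.Theory Num.Theory.
Import numFieldNormedType.Exports.
Local Open Scope classical_set_scope.
Local Open Scope ring_scope.
Local Notation normc := ComplexField.Normc.normc.

(** * Complex numbers through their real and imaginary parts *)

Section ComplexNumbers.
Context {R : realType}.
Implicit Types z x y : R[i].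

Lemma normcE z : normc z = Num.sqrt (complex.Re z ^+ 2 + complex.Im z ^+ 2).
Proof. by case: z. Qed.

Lemma normc_ge0 z : 0 <= normc z.
Proof. by rewrite normcE sqrtr_ge0. Qed.

Lemma normc_sqr z : normc z ^+ 2 = complex.Re z ^+ 2 + complex.Im z ^+ 2.
Proof. by rewrite normcE sqr_sqrtr// addr_ge0// sqr_ge0. Qed.

Lemma Re_le_normc z : `|complex.Re z| <= normc z.
Proof. by rewrite normcE -sqrtr_sqr ler_wsqrtr// lerDl sqr_ge0. Qed.

Lemma Im_le_normc z : `|complex.Im z| <= normc z.
Proof. by rewrite normcE -sqrtr_sqr ler_wsqrtr// lerDr sqr_ge0. Qed.

Lemma normc_leD z : normc z <= `|complex.Re z| + `|complex.Im z|.
Proof.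
rewrite -(@ler_pXn2r _ 2) ?nnegrE ?normc_ge0 ?addr_ge0//.
rewrite normc_sqr sqrrD !real_normK ?num_real// -addrA lerD2l lerDr.
by rewrite mulrn_wge0// mulr_ge0.
Qed.

Lemma normcD x y : normc (x + y) <= normc x + normc y.
Proof. exact: le_normcD. Qed.

Lemma normcB x y : normc (x - y) <= normc x + normc y.
Proof. by rewrite (le_trans (le_normcD _ _))// normcN. Qed.

Lemma normcBC x y : normc (x - y) = normc (y - x).
Proof. by rewrite -normcN opprB. Qed.

Lemma ler_normc_norm z : `|normc z| = normc z.
Proof. by rewrite ger0_norm// normc_ge0. Qed.

Lemma normc_real (r : R) : normc (r%:C)%C = `|r|.
Proof. by rewrite normcE /= expr0n /= addr0 sqrtr_sqr. Qed.

Lemma normc0_eq z : normc z = 0 -> z = 0.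
Proof. exact: ComplexField.Normc.eq0_normc. Qed.

Lemma ReD x y : complex.Re (x + y) = complex.Re x + complex.Re y.
Proof. by case: x; case: y. Qed.
Lemma ImD x y : complex.Im (x + y) = complex.Im x + complex.Im y.
Proof. by case: x; case: y. Qed.
Lemma ReN x : complex.Re (- x) = - complex.Re x. Proof. by case: x. Qed.
Lemma ImN x : complex.Im (- x) = - complex.Im x. Proof. by case: x. Qed.
Lemma ReM x y : complex.Re (x * y) =
  complex.Re x * complex.Re y - complex.Im x * complex.Im y.
Proof. by case: x; case: y. Qed.
Lemma ImM x y : complex.Im (x * y) =
  complex.Re x * complex.Im y + complex.Im x * complex.Re y.
Proof. by case: x; case: y => *. Qed.

Lemma complex_ext x y : complex.Re x = complex.Re y ->
  complex.Im x = complex.Im y -> x = y.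
Proof. by case: x; case: y => /= ? ? ? ? -> ->. Qed.

Lemma normc_expi (t : R) : normc (expi t) = 1.
Proof. by rewrite normcE /= cos2Dsin2 sqrtr1. Qed.

Lemma expiD (s t : R) : expi (s + t) = expi s * expi t.
Proof.
apply: complex_ext; rewrite ?ReM ?ImM /=; first exact: cosD.
by rewrite sinD addrC.
Qed.

Lemma expi0 : expi (0 : R) = 1.
Proof. by rewrite /expi cos0 sin0. Qed.

End ComplexNumbers.

(** * Integration of complex functions *)

Section ComplexIntegral.
Context {R : realType} {dT} {T : measurableType dT}.
Implicit Types (mu : {measure set T -> \bar R}) (F G : T -> R[i]).

Definition rinteg mu (f : T -> R) := mu.-integrable setT (EFin \o f).

Definition cmeas F := measurable_fun setT (fun t => complex.Re (F t)) /\
  measurable_fun setT (fun t => complex.Im (F t)).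

Definition cinteg mu F := rinteg mu (fun t => complex.Re (F t)) /\
  rinteg mu (fun t => complex.Im (F t)).

Definition cint mu F : R[i] :=
  Complex (\int[mu]_t complex.Re (F t)) (\int[mu]_t complex.Im (F t)).

Lemma cmeasD F G : cmeas F -> cmeas G -> cmeas (fun t => F t + G t).
Proof.
move=> [a b] [c e]; split.
  by under eq_fun do rewrite ReD; exact: measurable_funD.
by under eq_fun do rewrite ImD; exact: measurable_funD.
Qed.

Lemma cmeasM F G : cmeas F -> cmeas G -> cmeas (fun t => F t * G t).
Proof.
move=> [a b] [c e]; split.
  by under eq_fun do rewrite ReM; apply: measurable_funB; exact: measurable_funM.
by under eq_fun do rewrite ImM; apply: measurable_funD; exact: measurable_funM.
Qed.

Lemma cmeas_cst (c : R[i]) : cmeas (fun=> c).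
Proof. by split; exact: measurable_cst. Qed.

Lemma cmeas_real (f : T -> R) : measurable_fun setT f ->
  cmeas (fun t => (f t)%:C%C).
Proof. by move=> mf; split => //=; exact: measurable_cst. Qed.

Lemma cmeas_expi (f : T -> R) : measurable_fun setT f ->
  cmeas (fun t => expi (f t)).
Proof.
move=> mf; split => /=; apply: measurableT_comp mf;
  apply: continuous_measurable_fun; [exact: continuous_cos|exact: continuous_sin].
Qed.

Lemma measurable_normc F : cmeas F -> measurable_fun setT (fun t => normc (F t)).
Proof.
move=> [a b]; under eq_fun do rewrite normcE.
apply: measurableT_comp; first by apply: continuous_measurable_fun;
  exact: sqrt_continuous.
by apply: measurable_funD; exact: measurable_funX.
Qed.

Lemma le_rinteg mu (f g : T -> R) : measurable_fun setT f ->
  (forall t, `|f t| <= g t) -> rinteg mu g -> rinteg mu f.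
Proof.
move=> mf fg; apply: le_integrable => //; first exact/measurable_EFinP.
by move=> t _ /=; rewrite lee_fin (le_trans (fg t))// ler_norm.
Qed.

Lemma rinteg_measurable mu (f : T -> R) : rinteg mu f -> measurable_fun setT f.
Proof. by move/measurable_int/measurable_EFinP. Qed.

Lemma le_cinteg mu F (g : T -> R) : cmeas F ->
  (forall t, normc (F t) <= g t) -> rinteg mu g -> cinteg mu F.
Proof.
move=> [a b] Fg ig; split; (apply: le_rinteg ig => // t);
  by rewrite (le_trans _ (Fg t))// ?Re_le_normc ?Im_le_normc.
Qed.

Lemma cinteg_meas mu F : cinteg mu F -> cmeas F.
Proof. by move=> [/rinteg_measurable a /rinteg_measurable b]. Qed.

Lemma rintegD mu (f g : T -> R) : rinteg mu f -> rinteg mu g ->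
  rinteg mu (fun t => f t + g t).
Proof. by move=> a b; exact: (integrableD measurableT a b). Qed.

Lemma rintegB mu (f g : T -> R) : rinteg mu f -> rinteg mu g ->
  rinteg mu (fun t => f t - g t).
Proof. by move=> a b; exact: (integrableB measurableT a b). Qed.

Lemma rintegZ mu k (f : T -> R) : rinteg mu f -> rinteg mu (fun t => k * f t).
Proof. by move=> a; exact: (integrableZl measurableT k a). Qed.

Lemma rinteg_norm mu (f : T -> R) : rinteg mu f -> rinteg mu (fun t => `|f t|).
Proof. by move/integrable_norm. Qed.

Lemma rinteg0 mu : rinteg mu (fun=> 0).
Proof. exact: integrable0. Qed.

Lemma rinteg_normc mu F : cinteg mu F -> rinteg mu (fun t => normc (F t)).
Proof.
move=> iF; have mF := cinteg_meas iF; case: iF => a b.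
apply: le_rinteg (rintegD (rinteg_norm a) (rinteg_norm b)).
  exact: measurable_normc.
by move=> t; rewrite ler_normc_norm normc_leD.
Qed.

Lemma rinteg_ltyP mu (f : T -> R) : measurable_fun setT f ->
  (forall t, 0 <= f t) -> (\int[mu]_t (f t)%:E < +oo)%E -> rinteg mu f.
Proof.
move=> mf f0 foo; apply/integrableP; split; first exact/measurable_EFinP.
by under eq_integral => t _ do rewrite /= ger0_norm//.
Qed.

Lemma rinteg_lty mu (f : T -> R) : (forall t, 0 <= f t) -> rinteg mu f ->
  (\int[mu]_t (f t)%:E < +oo)%E.
Proof.
move=> f0 /integrableP[_]; apply: le_lt_trans.
by rewrite le_eqVlt; apply/orP; left; apply/eqP/eq_integral => t _ /=;
  rewrite ger0_norm.
Qed.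

Lemma EFin_Rintegral mu (f : T -> R) : rinteg mu f ->
  (\int[mu]_t f t)%:E = (\int[mu]_t (f t)%:E)%E.
Proof. by move=> h; rewrite fineK//; exact: integrable_fin_num. Qed.

Lemma cintegD mu F G : cinteg mu F -> cinteg mu G ->
  cinteg mu (fun t => F t + G t).
Proof.
move=> [a b] [c e]; split.
  by under eq_fun do rewrite ReD; exact: rintegD.
by under eq_fun do rewrite ImD; exact: rintegD.
Qed.

Lemma cintegZ mu (c : R[i]) F : cinteg mu F -> cinteg mu (fun t => c * F t).
Proof.
move=> [a b]; split.
  by under eq_fun do rewrite ReM; apply: rintegB; exact: rintegZ.
by under eq_fun do rewrite ImM; apply: rintegD; exact: rintegZ.
Qed.

Lemma cintegN mu F : cinteg mu F -> cinteg mu (fun t => - F t).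
Proof. by move/(cintegZ (-1)); under eq_fun do rewrite mulN1r. Qed.

Lemma cintegB mu F G : cinteg mu F -> cinteg mu G ->
  cinteg mu (fun t => F t - G t).
Proof. by move=> iF iG; apply: cintegD => //; exact: cintegN. Qed.

Lemma eq_cint mu F G : F =1 G -> cint mu F = cint mu G.
Proof. by move=> /funext ->. Qed.

Lemma cintD mu F G : cinteg mu F -> cinteg mu G ->
  cint mu (fun t => F t + G t) = cint mu F + cint mu G.
Proof.
move=> [a b] [c e]; apply: complex_ext; rewrite ?ReD ?ImD /=.
  by under eq_Rintegral do rewrite ReD; rewrite RintegralD.
by under eq_Rintegral do rewrite ImD; rewrite RintegralD.
Qed.

Lemma cintZ mu (c : R[i]) F : cinteg mu F ->
  cint mu (fun t => c * F t) = c * cint mu F.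
Proof.
move=> [a b]; apply: complex_ext; rewrite ?ReM ?ImM /=.
  under eq_Rintegral do rewrite ReM.
  by rewrite RintegralB ?RintegralZl//; exact: rintegZ.
under eq_Rintegral do rewrite ImM.
by rewrite RintegralD ?RintegralZl//; exact: rintegZ.
Qed.

Lemma cintZr mu (c : R[i]) F : cinteg mu F ->
  cint mu (fun t => F t * c) = cint mu F * c.
Proof.
by move=> iF; rewrite mulrC -cintZ//; apply: eq_cint => t; rewrite mulrC.
Qed.

Lemma cintB mu F G : cinteg mu F -> cinteg mu G ->
  cint mu (fun t => F t - G t) = cint mu F - cint mu G.
Proof.
move=> iF iG; rewrite cintD//; last exact: cintegN.
congr (_ + _); rewrite -mulN1r -cintZ//; apply: eq_cint => t.
by rewrite mulN1r.
Qed.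

(** Writing [z] for the integral, [|z|^2] is the integral of
    [Re z Re F + Im z Im F], which is at most [|z|] times the integral of [|F|]
    by the Cauchy-Schwarz inequality in the plane. *)
Lemma normc_cint_le mu F : cinteg mu F ->
  normc (cint mu F) <= \int[mu]_t normc (F t).
Proof.
move=> iF; have [a b] := iF.
set z := cint mu F; have [z0|z0] := eqVneq (normc z) 0.
  by rewrite z0 Rintegral_ge0// => t _; exact: normc_ge0.
have zp : 0 < normc z by rewrite lt_neqAle eq_sym z0 normc_ge0.
have iN := rinteg_normc iF.
have z2 : normc z ^+ 2 =
    \int[mu]_t (complex.Re z * complex.Re (F t) + complex.Im z * complex.Im (F t)).
  by rewrite normc_sqr RintegralD ?RintegralZl//; exact: rintegZ.
rewrite -(ler_pM2l zp) -expr2 z2 -RintegralZl//.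
apply: le_Rintegral => //.
- by apply: rintegD; exact: rintegZ.
- exact: rintegZ.
move=> t _; rewrite (le_trans (ler_norm _))//.
rewrite -(@ler_pXn2r _ 2) ?nnegrE ?mulr_ge0 ?normc_ge0//.
rewrite exprMn [normc z ^+ 2]normc_sqr [normc (F t) ^+ 2]normc_sqr real_normK ?num_real//.
rewrite -subr_ge0 (_ : _ - _ = (complex.Re z * complex.Im (F t) -
  complex.Im z * complex.Re (F t)) ^+ 2) ?sqr_ge0//.
ring.
Qed.

Lemma normc_cint_le_bound mu F (g : T -> R) : cmeas F -> rinteg mu g ->
  (forall t, normc (F t) <= g t) -> normc (cint mu F) <= \int[mu]_t g t.
Proof.
move=> mF ig Fg; have iF := le_cinteg mF Fg ig.
by rewrite (le_trans (normc_cint_le iF))// le_Rintegral//; exact: rinteg_normc.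
Qed.

Lemma cmeasN F : cmeas F -> cmeas (fun t => - F t).
Proof.
by move=> mF; under eq_fun do rewrite -mulN1r; apply: cmeasM => //; exact: cmeas_cst.
Qed.

End ComplexIntegral.

Section Fubini.
Context {R : realType} {d1 d2} {T1 : measurableType d1} {T2 : measurableType d2}.
Variables (m1 : {sigma_finite_measure set T1 -> \bar R}).
Variables (m2 : {sigma_finite_measure set T2 -> \bar R}).

Lemma rinteg_prod (a : T1 -> R) (b : T2 -> R) : rinteg m1 a -> rinteg m2 b ->
  rinteg (m1 \x m2)%E (fun z => a z.1 * b z.2).
Proof.
move=> ia ib; have ma := rinteg_measurable ia; have mb := rinteg_measurable ib.
apply/integrable12ltyP.
  by apply/measurable_EFinP; apply: measurable_funM; exact: measurableT_comp.
have -> : (\int[m1]_x \int[m2]_y `|(EFin \o (fun z => (a z.1 * b z.2)%R)) (x, y)| =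
   \int[m1]_x (`|a x|%:E * (\int[m2]_y `|b y|)%:E))%E.
  apply: eq_integral => x _; rewrite EFin_Rintegral; last exact: rinteg_norm.
  rewrite -ge0_integralZl//; last exact/measurable_EFinP/measurableT_comp.
  by apply: eq_integral => y _ /=; rewrite normrM EFinM.
rewrite ge0_integralZr//; last 2 first.
- exact/measurable_EFinP/measurableT_comp.
- by rewrite lee_fin Rintegral_ge0.
rewrite lte_mul_pinfty//.
- by apply: integral_ge0 => x _; rewrite lee_fin.
- by rewrite -EFin_Rintegral//; exact: rinteg_norm.
- exact: ltry.
Qed.

(** Domination by a tensor product is the form in which every double integral
    below converges absolutely. *)
Lemma cint_fubini (F : T1 -> T2 -> R[i]) (a : T1 -> R) (b : T2 -> R) :
  cmeas (fun z : T1 * T2 => F z.1 z.2) -> rinteg m1 a -> rinteg m2 b ->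
  (forall x y, normc (F x y) <= a x * b y) ->
  cint m1 (fun x => cint m2 (F x)) = cint m2 (fun y => cint m1 (F ^~ y)).
Proof.
move=> mF ia ib Fab.
have iF : cinteg (m1 \x m2)%E (fun z => F z.1 z.2).
  by apply: le_cinteg (rinteg_prod ia ib) => // -[x y]; exact: Fab.
have mF1 x : cmeas (F x).
  by case: mF => p q; split;
    [exact: (measurableT_comp p (pair1_measurable x))
    |exact: (measurableT_comp q (pair1_measurable x))].
have mF2 y : cmeas (F^~ y).
  by case: mF => p q; split;
    [exact: (measurableT_comp p (pair2_measurable y))
    |exact: (measurableT_comp q (pair2_measurable y))].
have i1 x : cinteg m2 (F x) by apply: le_cinteg (rintegZ (a x) ib) => // t; exact: Fab.
have i2 y : cinteg m1 (F^~ y).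
  by apply: le_cinteg (rintegZ (b y) ia) => // t; rewrite mulrC; exact: Fab.
case: iF => p q; apply: complex_ext => /=; congr fine.
- under eq_integral => x _ do rewrite (EFin_Rintegral (i1 x).1).
  rewrite (Fubini p); apply: eq_integral => y _.
  have [? ?] := i2 y; rewrite EFin_Rintegral//.
- under eq_integral => x _ do rewrite (EFin_Rintegral (i1 x).2).
  rewrite (Fubini q); apply: eq_integral => y _.
  have [? ?] := i2 y; rewrite EFin_Rintegral//.
Qed.

Lemma cint_prod (F : T1 -> T2 -> R[i]) (a : T1 -> R) (b : T2 -> R) :
  cmeas (fun z : T1 * T2 => F z.1 z.2) -> rinteg m1 a -> rinteg m2 b ->
  (forall x y, normc (F x y) <= a x * b y) ->
  cint (m1 \x m2)%E (fun z => F z.1 z.2) = cint m1 (fun x => cint m2 (F x)).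
Proof.
move=> mF ia ib Fab.
have iF : cinteg (m1 \x m2)%E (fun z => F z.1 z.2).
  by apply: le_cinteg (rinteg_prod ia ib) => // -[x y]; exact: Fab.
have mF1 x : cmeas (F x).
  by case: mF => p q; split;
    [exact: (measurableT_comp p (pair1_measurable x))
    |exact: (measurableT_comp q (pair1_measurable x))].
have i1 x : cinteg m2 (F x) by apply: le_cinteg (rintegZ (a x) ib) => // t; exact: Fab.
case: iF => p q; apply: complex_ext => /=; congr fine.
- rewrite -(integral12_prod_meas1 p); apply: eq_integral => x _.
  have [? ?] := i1 x; rewrite EFin_Rintegral//.
- rewrite -(integral12_prod_meas1 q); apply: eq_integral => x _.
  have [? ?] := i1 x; rewrite EFin_Rintegral//.
Qed.

End Fubini.

(** * Lebesgue measure on tuples: affine maps and tensor products *)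

Section LineAffine.
Context {R : realType}.
Local Notation mR := (measurableTypeR R).
Local Notation mu := (@lebesgue_measure R).
Variables (a s : R) (s0 : s != 0).

Let aff (x : mR) : mR := a + s * x.

Let measurable_aff : measurable_fun setT aff.
Proof. by apply: measurable_funD => //; exact: measurable_funM. Qed.

Let abs_s_ge0 : 0 <= `|s|. Proof. by []. Qed.
Let pushed : {measure set mR -> \bar R} :=
  measure_function_pushforward__canonical__measure_function_Measure
    mu measurable_aff.
Let scaled : {measure set mR -> \bar R} := mscale (NngNum abs_s_ge0) pushed.

Let scaledE A : measurable A -> mu A = scaled A.
Proof.
move=> mA; apply: lebesgue_measure_unique => // _ [[x y] _ <-].
rewrite /= /scaled /mscale /= /pushforward.
have si : 0 < `|s| by rewrite normr_gt0.
have [sp|sn|/eqP] := ltgtP 0 s; last by rewrite eq_sym (negbTE s0).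
- rewrite (_ : aff @^-1` _ = `](s^-1 * (x - a)), (s^-1 * (y - a))]%classic);
    last first.
    apply/seteqP; split=> t /=; rewrite !in_itv/= /aff;
    by rewrite -ltrBlDl -lerBrDl ltr_pdivrMl// ler_pdivlMl// mulrC.
  rewrite !lebesgue_measure_itv/= !lte_fin ltr_pM2l ?invr_gt0// ltrD2r.
  case: ifP => _; last by rewrite mule0.
  rewrite -!EFinB -EFinM; congr EFin; rewrite gtr0_norm// -mulrBr mulrA.
  by rewrite divff// mul1r opprB addrA subrK.
- rewrite (_ : aff @^-1` _ = `[(s^-1 * (y - a)), (s^-1 * (x - a))[%classic);
    last first.
    apply/seteqP; split=> t /=; rewrite !in_itv/= /aff;
    by rewrite andbC -ltrBlDl -lerBrDl ltr_ndivlMl// ler_ndivrMl// mulrC.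
  rewrite !lebesgue_measure_itv/= !lte_fin ltr_nM2l ?invr_lt0// ltrD2r.
  case: ifP => _; last by rewrite mule0.
  rewrite -!EFinB -EFinM; congr EFin; rewrite ltr0_norm// -mulrBr mulrA.
  by rewrite mulNr divff// mulN1r opprB opprB; ring.
Qed.

(** The image of Lebesgue measure under an affine map, rescaled by [|s|], agrees
    with Lebesgue measure on intervals, hence everywhere. *)
Lemma ge0_integral_affine (F : mR -> \bar R) : measurable_fun setT F ->
  (forall x, 0 <= F x)%E ->
  (\int[mu]_x F x = `|s|%:E * \int[mu]_x F (a + s * x)%R)%E.
Proof.
move=> mF F0; rewrite (eq_measure_integral scaled); last first.
  by move=> A mA _; exact: scaledE.
rewrite ge0_integral_mscale//=; congr (_ * _)%E.
by rewrite ge0_integral_pushforward.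
Qed.

End LineAffine.

Section TupleIntegral.
Context {R : realType}.
Local Notation mR := (measurableTypeR R).
Local Notation mu := (@lebesgue_measure R).
Local Notation ld n := (@lebesgue_nd R n).

Definition affine_tuple n (a : 'I_n -> R) (s : R) (t : n.-tuple mR)
    : n.-tuple mR := [tuple a i + s * tnth t i | i < n].

Lemma measurable_affine_tuple n (a : 'I_n -> R) s :
  measurable_fun setT (affine_tuple a s).
Proof.
apply/measurable_fun_tnthP => i.
rewrite (_ : _ \o _ = fun t => a i + s * tnth t i); last first.
  by apply/funext => t /=; rewrite tnth_mktuple.
apply: measurable_funD => //; apply: measurable_funM => //.
exact: measurable_tnth.
Qed.

Lemma affine_tuple_cons n (a : 'I_n.+1 -> R) s (x : mR) (t : n.-tuple mR) :
  affine_tuple a s (cons_pair (x, t)) =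
  cons_pair (a ord0 + s * x, affine_tuple (fun i => a (lift ord0 i)) s t).
Proof.
apply: eq_from_tnth => i; rewrite tnth_mktuple.
have [->|[j ->]] : i = ord0 \/ exists j, i = lift ord0 j.
  by case: (unliftP ord0 i) => [j ->|->]; [right; exists j|left].
- by rewrite /cons_pair/= !tnth0.
- by rewrite /cons_pair/= !tnthS tnth_mktuple.
Qed.

Lemma ge0_integral_cons n (F : n.+1.-tuple mR -> \bar R) :
  measurable_fun setT F -> (forall t, 0 <= F t)%E ->
  (\int[ld n.+1]_t F t = \int[mu]_x \int[ld n]_t F (cons_pair (x, t)))%E.
Proof.
move=> mF F0; rewrite /= /cons_measure.
rewrite (ge0_integral_pushforward (@measurable_cons_pair R n))//=.
rewrite preimage_setT (fubini_tonelli1 (F \o @cons_pair R n))//.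
  by apply: measurableT_comp => //; exact: measurable_cons_pair.
by move=> p; exact: F0.
Qed.

(** With one dilation factor for all coordinates, the change of variables is the
    one on the line applied coordinate by coordinate, by Tonelli. *)
Lemma ge0_integral_affine_tuple n (a : 'I_n -> R) s (F : n.-tuple mR -> \bar R) :
  s != 0 -> measurable_fun setT F -> (forall t, 0 <= F t)%E ->
  (\int[ld n]_t F t = (`|s| ^+ n)%:E * \int[ld n]_t F (affine_tuple a s t))%E.
Proof.
move=> s0; elim: n a F => [|n IH] a F mF F0.
  rewrite expr0 mul1e; apply: eq_integral => t _; congr F.
  by rewrite tuple0 [RHS]tuple0.
have mc : measurable_fun setT (fun p => F (@cons_pair R n p)).
  exact: (measurableT_comp mF (@measurable_cons_pair R n)).
rewrite ge0_integral_cons// [in RHS]ge0_integral_cons//; last first.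
  exact: (measurableT_comp mF (measurable_affine_tuple _ _)).
rewrite (ge0_integral_affine (a ord0) s0); last 2 first.
- exact: (measurable_fun_fubini_tonelli_F (F \o @cons_pair R n) mc (fun p => F0 _)).
- by move=> x; exact: integral_ge0.
rewrite exprS EFinM -muleA; congr (_ * _)%E.
rewrite -ge0_integralZl//; last 2 first.
- apply: (measurable_fun_fubini_tonelli_F
    (fun p => F (affine_tuple a s (@cons_pair R n p)))) => //.
  exact: (measurableT_comp mF (measurableT_comp (measurable_affine_tuple a s)
    (@measurable_cons_pair R n))).
- by move=> x _; exact: integral_ge0.
apply: eq_integral => x _; rewrite (IH (fun i => a (lift ord0 i))); last 2 first.
- exact: (measurableT_comp mc (pair1_measurable _)).
- by [].
by congr (_ * _)%E; apply: eq_integral => t _; rewrite affine_tuple_cons.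
Qed.

Lemma rinteg_affine_tuple n (a : 'I_n -> R) s (f : n.-tuple mR -> R) :
  s != 0 -> rinteg (ld n) f -> rinteg (ld n) (fun t => f (affine_tuple a s t)).
Proof.
move=> s0 fi; have mf := rinteg_measurable fi.
have mfa : measurable_fun setT (fun t => f (affine_tuple a s t)).
  exact: (measurableT_comp mf (measurable_affine_tuple _ _)).
apply/integrableP; split; first exact/measurable_EFinP.
move/integrableP : fi => [_].
rewrite (ge0_integral_affine_tuple a s0)//; last first.
  by apply: measurableT_comp => //; exact/measurable_EFinP.
rewrite /=; move: (integral _ _ _) => [r| |]//; first by rewrite !ltry.
by rewrite gt0_muley ?lte_fin ?exprn_gt0 ?normr_gt0.
Qed.

Lemma Rintegral_affine_tuple n (a : 'I_n -> R) s (f : n.-tuple mR -> R) :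
  s != 0 -> rinteg (ld n) f ->
  \int[ld n]_t f t = `|s| ^+ n * \int[ld n]_t f (affine_tuple a s t).
Proof.
move=> s0 fi; have mf := rinteg_measurable fi.
have fia := rinteg_affine_tuple a s0 fi.
apply: EFin_inj; rewrite EFinM !EFin_Rintegral//.
rewrite integralE [in RHS]integralE.
have sn0 : (0 < (`|s| ^+ n)%:E)%E by rewrite lte_fin exprn_gt0// normr_gt0.
rewrite muleBr//; last first.
  by apply: fin_num_adde_defr; exact: integrable_pos_fin_num.
congr (_ - _)%E.
- rewrite (ge0_integral_affine_tuple a s0)//.
  + by congr (_ * _)%E; apply: eq_integral => t _; rewrite !funeposE.
  + by apply: measurable_funepos; exact/measurable_EFinP.
- rewrite (ge0_integral_affine_tuple a s0)//.
  + by congr (_ * _)%E; apply: eq_integral => t _; rewrite !funenegE.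
  + by apply: measurable_funeneg; exact/measurable_EFinP.
Qed.

Lemma cinteg_affine_tuple n (a : 'I_n -> R) s (f : n.-tuple mR -> R[i]) :
  s != 0 -> cinteg (ld n) f -> cinteg (ld n) (fun t => f (affine_tuple a s t)).
Proof.
by move=> s0 [p q]; split;
  [exact: (rinteg_affine_tuple a s0 p)|exact: (rinteg_affine_tuple a s0 q)].
Qed.

Lemma cint_affine_tuple n (a : 'I_n -> R) s (f : n.-tuple mR -> R[i]) :
  s != 0 -> cinteg (ld n) f ->
  cint (ld n) f = (`|s| ^+ n)%:C%C * cint (ld n) (fun t => f (affine_tuple a s t)).
Proof.
move=> s0 [p q]; apply: complex_ext; rewrite ?ReM ?ImM/= !mul0r ?subr0 ?addr0.
- exact: (Rintegral_affine_tuple a s0 p).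
- exact: (Rintegral_affine_tuple a s0 q).
Qed.

(** By induction on the number of coordinates, with the product theorem for the
    first coordinate against the others. *)
Lemma rinteg_tensor n (g : 'I_n -> R -> R) :
  (forall i, rinteg mu (g i)) ->
  rinteg (ld n) (fun t => \prod_(i < n) g i (tnth t i)).
Proof.
elim: n g => [|n IH] g gi.
  apply/integrableP; split.
    by apply/measurable_EFinP; under eq_fun do rewrite big_ord0;
      exact: measurable_cst.
  rewrite integral_dirac//=; last first.
    apply: measurableT_comp => //; apply/measurable_EFinP.
    by under eq_fun do rewrite big_ord0; exact: measurable_cst.
  by rewrite diracT mul1e big_ord0 ltry.
have mp : measurable_fun setT
    (fun t : n.+1.-tuple mR => \prod_(i < n.+1) g i (tnth t i)).
  apply: measurable_prod => i _.
  exact: (measurableT_comp (rinteg_measurable (gi i)) (measurable_tnth i)).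
have := rinteg_prod (gi ord0) (IH _ (fun i => gi (lift ord0 i))).
move=> h; apply: (@integrable_pushforward _ _ _ _ _ _ (@measurable_cons_pair R n)).
- exact/measurable_EFinP.
- rewrite preimage_setT; apply: eq_integrable h => //= -[x t] _ /=.
  rewrite big_ord_recl /cons_pair/= tnth0; congr (_ * _)%:E.
  by apply: eq_bigr => i _; rewrite tnthS.
- exact: measurableT.
Qed.

Lemma cmeas_prod_tnth n (g : 'I_n -> R -> R[i]) : (forall i, cmeas (g i)) ->
  cmeas (fun t : n.-tuple mR => \prod_(i < n) g i (tnth t i)).
Proof.
move=> mg; rewrite (_ : (fun _ => _) =
    fun t : n.-tuple mR => \prod_(i <- enum 'I_n) g i (tnth t i)); last first.
  by apply/funext => t; rewrite big_enum.
elim: (enum _) => [|i s IH].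
  by under eq_fun do rewrite big_nil; exact: cmeas_cst.
under eq_fun do rewrite big_cons; apply: cmeasM IH.
have mi := measurable_tnth i : measurable_fun setT (fun t : n.-tuple mR => tnth t i).
by case: (mg i) => p q; split; [exact: measurableT_comp p mi|
  exact: measurableT_comp q mi].
Qed.

Lemma normc_prod (I : Type) (s : seq I) (z : I -> R[i]) :
  normc (\prod_(i <- s) z i) = \prod_(i <- s) normc (z i).
Proof.
elim: s => [|i s IH]; first by rewrite !big_nil ComplexField.Normc.normc1.
by rewrite !big_cons ComplexField.Normc.normcM IH.
Qed.

Lemma cint_cons n (F : n.+1.-tuple mR -> R[i]) (a : mR -> R)
    (b : n.-tuple mR -> R) :
  cmeas F -> rinteg mu a -> rinteg (ld n) b ->
  (forall x t, normc (F (cons_pair (x, t))) <= a x * b t) ->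
  cint (ld n.+1) F = cint mu (fun x => cint (ld n) (fun t => F (cons_pair (x, t)))).
Proof.
move=> mF ia ib Fab.
have mFc : cmeas (fun z : mR * n.-tuple mR => F (cons_pair (z.1, z.2))).
  have -> : (fun z : mR * n.-tuple mR => F (cons_pair (z.1, z.2))) =
    F \o @cons_pair R n by apply/funext => -[].
  by case: mF => p q; split; [exact: (measurableT_comp p (@measurable_cons_pair R n))|
    exact: (measurableT_comp q (@measurable_cons_pair R n))].
rewrite -(cint_prod mFc ia ib Fab).
have [p q] : cinteg (mu \x ld n)%E (fun z => F (cons_pair (z.1, z.2))).
  by apply: le_cinteg (rinteg_prod ia ib) => // -[x t]; exact: Fab.
case: mF => mR mI.
apply: complex_ext; rewrite /cint/= /Rintegral; congr fine; rewrite /cons_measure.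
- by rewrite (integral_pushforward (@measurable_cons_pair R n))//;
    exact/measurable_EFinP.
- by rewrite (integral_pushforward (@measurable_cons_pair R n))//;
    exact/measurable_EFinP.
Qed.

Lemma cint_tensor n (g : 'I_n -> R -> R[i]) :
  (forall i, cinteg mu (g i)) ->
  cint (ld n) (fun t => \prod_(i < n) g i (tnth t i)) = \prod_(i < n) cint mu (g i).
Proof.
elim: n g => [|n IH] g gi.
  rewrite big_ord0; apply: complex_ext => /=; rewrite /Rintegral.
    under eq_integral do rewrite big_ord0.
    by rewrite integral_dirac// diracT mul1e.
  under eq_integral do rewrite big_ord0.
  by rewrite integral_dirac// diracT mul1e.
have mg i := cinteg_meas (gi i).
rewrite (cint_cons (cmeas_prod_tnth mg) (rinteg_normc (gi ord0))
  (rinteg_tensor (fun i => rinteg_normc (gi (lift ord0 i))))); last first.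
  move=> x t; rewrite big_ord_recl /cons_pair/= tnth0.
  rewrite ComplexField.Normc.normcM normc_prod ler_wpM2l ?normc_ge0//.
  under eq_bigr do rewrite tnthS.
  exact: lexx.
rewrite big_ord_recl -IH// -cintZr//; apply: eq_cint => x.
under eq_cint => t do rewrite big_ord_recl /cons_pair/= tnth0.
rewrite -cintZ.
  by apply: eq_cint => t; congr (_ * _); apply: eq_bigr => i _; rewrite tnthS.
apply: (le_cinteg (cmeas_prod_tnth (fun i => mg (lift ord0 i))) _
  (rinteg_tensor (fun i => rinteg_normc (gi (lift ord0 i))))) => t.
by rewrite normc_prod lexx.
Qed.

End TupleIntegral.

(** * Euclidean geometry and measurability of continuous functions *)

Section Geometry.
Context {R : realType} {d : nat}.
Local Notation V := 'rV[R]_d.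
Implicit Types x y z : V.

Lemma mx_norm_le x e : 0 <= e -> (forall i, `|x 0 i| <= e) -> `|x| <= e.
Proof.
move=> e0 xe; rewrite /Num.norm/= mx_normrE; apply: bigmax_le => // -[i j] _ /=.
by rewrite (ord1 i).
Qed.

Lemma dotvC x y : dotv x y = dotv y x.
Proof. by apply: eq_bigr => i _; rewrite mulrC. Qed.
Lemma dotvDr x y z : dotv x (y + z) = dotv x y + dotv x z.
Proof. by rewrite -big_split; apply: eq_bigr => i _; rewrite mxE mulrDr. Qed.
Lemma dotvNr x y : dotv x (- y) = - dotv x y.
Proof. by rewrite -sumrN; apply: eq_bigr => i _; rewrite mxE mulrN. Qed.
Lemma dotvBr x y z : dotv x (y - z) = dotv x y - dotv x z.
Proof. by rewrite dotvDr dotvNr. Qed.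
Lemma dotvZr x y (k : R) : dotv x (k *: y) = k * dotv x y.
Proof. by rewrite mulr_sumr; apply: eq_bigr => i _; rewrite mxE mulrCA. Qed.
Lemma dotvDl x y z : dotv (y + z) x = dotv y x + dotv z x.
Proof. by rewrite dotvC dotvDr !(dotvC x). Qed.
Lemma dotvNl x y : dotv (- y) x = - dotv y x.
Proof. by rewrite dotvC dotvNr (dotvC x). Qed.
Lemma dotvBl x y z : dotv (y - z) x = dotv y x - dotv z x.
Proof. by rewrite dotvDl dotvNl. Qed.
Lemma dotvZl x y (k : R) : dotv (k *: y) x = k * dotv y x.
Proof. by rewrite dotvC dotvZr (dotvC x). Qed.
Lemma dotv0r x : dotv x 0 = 0.
Proof. by rewrite -(scale0r 0) dotvZr mul0r. Qed.
Lemma dotv_delta x i : dotv (delta_mx 0 i) x = x 0 i.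
Proof.
rewrite /dotv (bigD1 i)//= mxE !eqxx mul1r big1 ?addr0// => j ji.
by rewrite mxE (negbTE ji) andbF mul0r.
Qed.

Lemma enorm_ge0 x : 0 <= enorm x. Proof. exact: sqrtr_ge0. Qed.
Lemma enorm_sqr x : enorm x ^+ 2 = dotv x x.
Proof.
rewrite sqr_sqrtr; first by apply: eq_bigr => i _; rewrite expr2.
by apply: sumr_ge0 => i _; exact: sqr_ge0.
Qed.
Lemma enormN x : enorm (- x) = enorm x.
Proof. by congr Num.sqrt; apply: eq_bigr => i _; rewrite mxE sqrrN. Qed.
Lemma enorm0 : enorm (0 : V) = 0.
Proof. by rewrite /enorm big1 ?sqrtr0// => i _; rewrite mxE expr0n. Qed.
Lemma coord_le_enorm x i : `|x 0 i| <= enorm x.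
Proof.
rewrite -sqrtr_sqr ler_wsqrtr// (bigD1 i)//= lerDl.
by apply: sumr_ge0 => j _; exact: sqr_ge0.
Qed.

Lemma enorm_eq0 x : enorm x = 0 -> x = 0.
Proof.
move=> x0; apply/rowP => i; rewrite mxE; apply/eqP.
by rewrite -normr_le0 -x0 coord_le_enorm.
Qed.

Lemma dotv_le_enorm x y : dotv x y <= enorm x * enorm y.
Proof.
have [/enorm_eq0->|x0] := eqVneq (enorm x) 0.
  by rewrite dotvC dotv0r enorm0 mul0r.
have [/enorm_eq0->|y0] := eqVneq (enorm y) 0.
  by rewrite dotv0r enorm0 mulr0.
have p : 0 < enorm x * enorm y.
  by rewrite mulr_gt0// lt_neqAle eq_sym ?x0 ?y0 enorm_ge0.
have : 0 <= enorm (enorm y *: x - enorm x *: y) ^+ 2 by exact: sqr_ge0.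
rewrite enorm_sqr dotvBl !dotvBr !dotvZl !dotvZr -!enorm_sqr (dotvC y x).
move: (dotv x y) (enorm x) (enorm y) p => c a b p h.
rewrite -subr_ge0 -(pmulr_rge0 _ p).
rewrite (_ : _ * _ = 2^-1 * (b * (b * a ^+ 2) - a * (b * c) - (b * (a * c) - a * (a * b ^+ 2)))).
  by rewrite mulr_ge0// (le_trans h)// le_eqVlt; apply/orP; left; apply/eqP; ring.
by field.
Qed.

Lemma norm_dotv_le x y : `|dotv x y| <= enorm x * enorm y.
Proof. by rewrite ler_norml dotv_le_enorm andbT lerNl -dotvNr -(enormN y) dotv_le_enorm. Qed.

Lemma enormD x y : enorm (x + y) <= enorm x + enorm y.
Proof.
rewrite -(@ler_pXn2r _ 2) ?nnegrE ?addr_ge0 ?enorm_ge0//.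
rewrite enorm_sqr dotvDl !dotvDr sqrrD -!enorm_sqr (dotvC y x).
have := dotv_le_enorm x y; move: (enorm x) (enorm y) => a b; lra.
Qed.

Lemma continuous_sumr (I : Type) (s : seq I) (F : I -> V -> R) :
  (forall i, continuous (F i)) -> continuous (fun x => \sum_(i <- s) F i x).
Proof.
move=> cF; elim: s => [|i s IH].
  rewrite (_ : (fun _ => _) = cst 0); first exact: cst_continuous.
  by apply/funext => y; rewrite big_nil.
rewrite (_ : (fun _ => _) = fun x => F i x + \sum_(j <- s) F j x); last first.
  by apply/funext => y; rewrite big_cons.
by move=> x; exact: (cvgD (cF i x) (IH x)).
Qed.

Lemma continuous_prodr (I : Type) (s : seq I) (F : I -> V -> R) :
  (forall i, continuous (F i)) -> continuous (fun x => \prod_(i <- s) F i x).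
Proof.
move=> cF; elim: s => [|i s IH].
  rewrite (_ : (fun _ => _) = cst 1); first exact: cst_continuous.
  by apply/funext => y; rewrite big_nil.
rewrite (_ : (fun _ => _) = fun x => F i x * \prod_(j <- s) F j x); last first.
  by apply/funext => y; rewrite big_cons.
by move=> x; exact: (cvgM (cF i x) (IH x)).
Qed.

Lemma continuous_affine_row (a : V) (s : R) : continuous (fun z : V => a + s *: z).
Proof.
by move=> z; exact: (cvgD (cvg_cst a) (cvgZ (cvg_cst s) (@cvg_id _ (nbhs z)))).
Qed.

Lemma continuous_coord i : continuous (fun x : V => x 0 i).
Proof. exact: coord_continuous. Qed.

Lemma continuous_enorm : continuous (@enorm R d).
Proof.
move=> x; apply: continuous_comp; last exact: sqrt_continuous.
apply: continuous_sumr => i y; rewrite /=.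
exact: (cvgM (@continuous_coord i y) (@continuous_coord i y)).
Qed.

Lemma continuous_dotv y : continuous (fun x : V => dotv x y).
Proof.
apply: continuous_sumr => i x.
exact: (cvgM (@continuous_coord i x) (cvg_cst _)).
Qed.

(** The profile against which decay at infinity is measured, integrable because
    it is a tensor product. *)
Definition Wt x : R := \prod_(i < d) (oneDsqr (x 0 i))^-1.

Lemma oneDsqr_ge1 (t : R) : 1 <= oneDsqr t.
Proof. by rewrite /oneDsqr lerDl sqr_ge0. Qed.
Lemma oneDsqr_pos (t : R) : 0 < oneDsqr t.
Proof. exact: lt_le_trans (oneDsqr_ge1 t). Qed.

Lemma Wt_gt0 x : 0 < Wt x.
Proof. by apply: prodr_gt0 => i _; rewrite invr_gt0 oneDsqr_pos. Qed.
Lemma Wt_ge0 x : 0 <= Wt x. Proof. exact/ltW/Wt_gt0. Qed.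

Lemma Wt_le1 x : Wt x <= 1.
Proof.
rewrite (@le_trans _ _ (\prod_(i < d) (1 : R)))//; last by rewrite big1_eq.
apply: ler_prod => i _; rewrite invr_ge0 (ltW (oneDsqr_pos _))/=.
by rewrite invf_le1 ?oneDsqr_pos// oneDsqr_ge1.
Qed.

Lemma WtN x : Wt (- x) = Wt x.
Proof. by apply: eq_bigr => i _; rewrite mxE /oneDsqr sqrrN. Qed.

Lemma continuous_Wt : continuous Wt.
Proof.
apply: continuous_prodr => i x.
apply: (@continuous_comp _ _ _ (fun x : V => x 0 i) (fun t => (oneDsqr t)^-1)).
  exact: continuous_coord.
exact: continuous_oneDsqrV.
Qed.

Lemma Wt_ge x : 1 <= Wt x * (1 + enorm x) ^+ (2 * d).
Proof.
have -> : (1 + enorm x) ^+ (2 * d) = \prod_(i < d) (1 + enorm x) ^+ 2.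
  by rewrite exprM prodr_const card_ord.
rewrite -big_split/= (le_trans (_ : 1 <= \prod_(i < d) (1 : R)))//.
  by rewrite big1_eq.
apply: ler_prod => i _; rewrite ler01/= mulrC ler_pdivlMr ?oneDsqr_pos// mul1r.
rewrite /oneDsqr sqrrD expr1n mul1r -addrA lerD2l.
rewrite (@le_trans _ _ (enorm x ^+ 2))//.
  by rewrite -[leLHS]real_normK ?num_real// lerXn2r ?nnegrE ?enorm_ge0 ?coord_le_enorm.
by rewrite lerDr mulrn_wge0 ?enorm_ge0.
Qed.

End Geometry.

Section RowMeasurability.
Context {R : realType} {d : nat}.
Local Notation V := 'rV[R]_d.
Local Notation mR := (measurableTypeR R).
Local Notation ld := (@lebesgue_nd R d).
Local Notation row := (@row_of_tuple R d).

(** The lower corner of the cube of side [1 / (k + 1)] that contains [x]. *)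
Definition grid (k : nat) (x : V) : V :=
  \row_i ((Num.floor (k.+1%:R * x 0 i))%:~R / k.+1%:R).

Lemma grid_dist k x : `|x - grid k x| <= k.+1%:R^-1.
Proof.
apply: mx_norm_le => // i; rewrite !mxE.
have k0 : (0 : R) < k.+1%:R by [].
have /andP[a b] := floor_itv (k.+1%:R * x 0 i).
rewrite -(ler_pM2l k0) mulfV ?gt_eqF// -{1}(gtr0_norm k0) -normrM mulrBr mulrCA.
rewrite mulfV ?gt_eqF// mulr1 ger0_norm ?subr_ge0//.
by move: b; rewrite intrD => /ltW; rewrite -lerBlDl.
Qed.

Lemma grid_cvg x : grid k x @[k --> \oo] --> x.
Proof.
apply/cvgrPdist_le => e e0; near=> k.
rewrite (le_trans (grid_dist _ _))//; near: k.
by apply: filterS (near_infty_natSinv_lt (PosNum e0)) => k /ltW.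
Unshelve. all: by end_near. Qed.

(** A function of the grid point takes countably many values on the
    half-open boxes of the grid, so it is measurable whatever it is. *)
Lemma measurable_grid k (F : V -> R) :
  measurable_fun setT (fun t : d.-tuple mR => F (grid k (row t))).
Proof.
move=> _ B mB; rewrite setTI.
pose cell (z : {ffun 'I_d -> int}) : V := \row_i ((z i)%:~R / k.+1%:R).
rewrite (_ : _ @^-1` _ = \bigcup_z (if `[<B (F (cell z))>] then
    \bigcap_(i in [set: 'I_d]) [set t : d.-tuple mR |
      (z i)%:~R <= k.+1%:R * tnth t i < (z i + 1)%:~R] else set0)); last first.
  apply/seteqP; split=> [t Bt|t [z _]].
    exists [ffun i => Num.floor (k.+1%:R * tnth t i)] => //.
    have -> : cell [ffun i => Num.floor (k.+1%:R * tnth t i)] = grid k (row t).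
      by apply/rowP => i; rewrite !mxE ffunE.
    by rewrite asboolT// => i _ /=; rewrite ffunE floor_itv.
  case: asboolP => // Bz zt; rewrite /preimage /=.
  suff -> : grid k (row t) = cell z by [].
  by apply/rowP => i; rewrite !mxE (floor_def (zt i I)).
apply: countable_bigcupT_measurable; first exact: countableP.
move=> z; case: asboolP => // _.
apply: fin_bigcap_measurable => // i _.
have mi : measurable_fun setT (fun t : d.-tuple mR => k.+1%:R * tnth t i).
  by apply: measurable_funM => //; exact: measurable_tnth.
rewrite (_ : [set t | _] = (fun t : d.-tuple mR => k.+1%:R * tnth t i) @^-1`
  `[(z i)%:~R, (z i + 1)%:~R[%classic).
  by rewrite -[X in measurable X]setTI; exact: mi.
by apply/seteqP; split => t /=; rewrite in_itv.
Qed.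

(** Tuples carry the product sigma-algebra and row vectors the topology; the two
    meet because a continuous function is the limit of its samples on finer and
    finer grids. *)
Lemma continuous_measurable_row (F : V -> R) : continuous F ->
  measurable_fun setT (fun t : d.-tuple mR => F (row t)).
Proof.
move=> cF; apply: (@measurable_fun_cvg _ _ _ _ (fun k t => F (grid k (row t)))).
  by move=> k; exact: measurable_grid.
move=> t _. exact: (cvg_comp _ _ (@grid_cvg (row t)) (cF (row t))).
Qed.

Lemma ccontinuous_cmeas (f : V -> R[i]) : ccontinuous f ->
  cmeas (fun t : d.-tuple mR => f (row t)).
Proof. by move=> [a b]; split; [exact: (continuous_measurable_row a)|exact: (continuous_measurable_row b)]. Qed.

Lemma integral_oneDsqrV :
  (\int[@lebesgue_measure R]_x ((oneDsqr x)^-1)%:E = pi%:E)%E.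
Proof.
have c : continuous (fun x : R => (oneDsqr x)^-1) by exact: continuous_oneDsqrV.
have nn (x : R) : 0 <= (oneDsqr x)^-1 by rewrite invr_ge0 ltW// oneDsqr_pos.
have ev : (fun x : R => (oneDsqr x)^-1) =1 (fun x => (oneDsqr x)^-1) \o -%R.
  by move=> x /=; rewrite /oneDsqr sqrrN.
rewrite (ge0_symfun_integralT nn c ev) -set_itvcy integral0y_oneDsqr -EFinM.
by congr EFin; field.
Qed.

Lemma rinteg_oneDsqrV : rinteg (@lebesgue_measure R) (fun x => (oneDsqr x)^-1).
Proof.
apply: rinteg_ltyP.
- by apply: continuous_measurable_fun; exact: continuous_oneDsqrV.
- by move=> x; rewrite invr_ge0 ltW// oneDsqr_pos.
- by rewrite integral_oneDsqrV ltry.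
Qed.

Lemma Rintegral_oneDsqrV : \int[@lebesgue_measure R]_x (oneDsqr x)^-1 = pi.
Proof. by rewrite /Rintegral integral_oneDsqrV. Qed.

Lemma Wt_row (t : d.-tuple mR) : Wt (row t) = \prod_(i < d) (oneDsqr (tnth t i))^-1.
Proof. by apply: eq_bigr => i _; rewrite mxE. Qed.

Lemma rinteg_Wt : rinteg ld (fun t => Wt (row t)).
Proof.
under eq_fun do rewrite Wt_row.
exact: (@rinteg_tensor _ _ (fun _ x => (oneDsqr x)^-1) (fun=> rinteg_oneDsqrV)).
Qed.

Lemma row_affine (a : 'I_d -> R) s (t : d.-tuple mR) :
  row (affine_tuple a s t) = \row_i a i + s *: row t.
Proof. by apply/rowP => i; rewrite !mxE tnth_mktuple. Qed.

End RowMeasurability.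

(** * Complex limits and dominated convergence *)

Section ComplexLimits.
Context {R : realType}.

Definition ccvg (u : nat -> R[i]) (a : R[i]) :=
  normc (u k - a) @[k --> \oo] --> (0 : R).

Lemma ccvg_le (u : nat -> R[i]) a (b : nat -> R) :
  (forall k, normc (u k - a) <= b k) -> b k @[k --> \oo] --> (0 : R) -> ccvg u a.
Proof.
move=> ub b0; apply: (squeeze_cvgr _ (cvg_cst 0) b0).
by apply: nearW => k; rewrite normc_ge0 ub.
Qed.

Lemma ccvg_unique u a b : ccvg u a -> ccvg u b -> a = b.
Proof.
move=> ua ub; apply/eqP; rewrite -subr_eq0; apply/eqP/normc0_eq.
have uab : normc (u k - a) + normc (u k - b) @[k --> \oo] --> (0 : R).
  by rewrite -(addr0 0); exact: cvgD.
apply/eqP; rewrite eq_le normc_ge0 andbT.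
have -> : (0 : R) = limn (fun k => normc (u k - a) + normc (u k - b)).
  by apply/esym/cvg_lim.
apply: limr_ge; first by apply/cvg_ex; exists 0.
apply: nearW => k; rewrite (_ : a - b = (u k - b) - (u k - a)); last by ring.
by rewrite (le_trans (normcB _ _))// addrC.
Qed.

Lemma ccvg_ReP u a : ccvg u a ->
  complex.Re (u k) @[k --> \oo] --> complex.Re a /\
  complex.Im (u k) @[k --> \oo] --> complex.Im a.
Proof.
move=> ua; split; apply/cvgrPdist_le => e e0;
  move/cvgrPdist_le : ua => /(_ _ e0); apply: filterS => k;
  rewrite sub0r normrN ler_normc_norm; apply: le_trans.
- by rewrite -ReN -ReD normcBC Re_le_normc.
- by rewrite -ImN -ImD normcBC Im_le_normc.
Qed.

Lemma ccvg_Re_Im u a : complex.Re (u k) @[k --> \oo] --> complex.Re a ->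
  complex.Im (u k) @[k --> \oo] --> complex.Im a -> ccvg u a.
Proof.
move=> ra ia; apply: (ccvg_le (b := fun k => `|complex.Re (u k) - complex.Re a| +
  `|complex.Im (u k) - complex.Im a|)).
  by move=> k; rewrite (le_trans (normc_leD _))// ReD ImD ReN ImN.
rewrite -(addr0 0); apply: cvgD.
- rewrite -(normr0 R) -(subrr (complex.Re a)); apply: cvg_norm.
  by apply: cvgB => //; exact: cvg_cst.
- rewrite -(normr0 R) -(subrr (complex.Im a)); apply: cvg_norm.
  by apply: cvgB => //; exact: cvg_cst.
Qed.

Lemma ccvg_normc u a : ccvg u a -> normc (u k) @[k --> \oo] --> normc a.
Proof.
move=> ua; apply/cvgrPdist_le => e e0.
move/cvgrPdist_le : ua => /(_ _ e0); apply: filterS => k.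
rewrite sub0r normrN ler_normc_norm; apply: le_trans.
rewrite ler_norml; apply/andP; split.
- rewrite lerBrDr -lerBrDl opprK addrC.
  by rewrite -{1}(subrK a (u k)) normcD.
- by rewrite lerBlDr -{1}(subrK (u k) a) normcBC normcD.
Qed.

Lemma ccvg_cst a : ccvg (fun=> a) a.
Proof.
rewrite /ccvg; under eq_cvg do rewrite subrr.
by rewrite ComplexField.Normc.normc0; exact: cvg_cst.
Qed.

Lemma ccvgM u v a b : ccvg u a -> ccvg v b -> ccvg (fun k => u k * v k) (a * b).
Proof.
move=> ua vb; apply: (ccvg_le (b := fun k => normc (u k) * normc (v k - b) +
   normc (u k - a) * normc b)).
  move=> k; rewrite -!ComplexField.Normc.normcM (le_trans _ (normcD _ _))//.
  by rewrite le_eqVlt; apply/orP; left; apply/eqP; congr normc; ring.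
rewrite -(addr0 0) -[X in X + _](mulr0 (normc a)) -[X in _ + X](mul0r (normc b)).
apply: cvgD; first exact: (cvgM (ccvg_normc ua) vb).
exact: (cvgM ua (cvg_cst _)).
Qed.

End ComplexLimits.

Section DominatedConvergence.
Context {R : realType} {dT} {T : measurableType dT}.
Variable mu : {measure set T -> \bar R}.

Lemma ccvg_cmeas (F_ : nat -> T -> R[i]) (F : T -> R[i]) :
  (forall k, cmeas (F_ k)) -> (forall t, ccvg (F_^~ t) (F t)) -> cmeas F.
Proof.
move=> mF cF; split.
- apply: (@measurable_fun_cvg _ _ _ _ (fun k t => complex.Re (F_ k t))).
    by move=> k; case: (mF k).
  by move=> t _; case: (ccvg_ReP (cF t)).
- apply: (@measurable_fun_cvg _ _ _ _ (fun k t => complex.Im (F_ k t))).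
    by move=> k; case: (mF k).
  by move=> t _; case: (ccvg_ReP (cF t)).
Qed.

Lemma cint_dominated (F_ : nat -> T -> R[i]) (F : T -> R[i]) (g : T -> R) :
  (forall k, cmeas (F_ k)) -> (forall t, ccvg (F_^~ t) (F t)) ->
  rinteg mu g -> (forall k t, normc (F_ k t) <= g t) ->
  ccvg (fun k => cint mu (F_ k)) (cint mu F).
Proof.
move=> mF cF ig Fg; have mFl := ccvg_cmeas mF cF.
have Flg t : normc (F t) <= g t.
  have <- : limn (fun k => normc (F_ k t)) = normc (F t).
    by apply/cvg_lim => //; exact: (ccvg_normc (cF t)).
  apply: limr_le; last exact: nearW.
  by apply/cvg_ex; exists (normc (F t)); exact: (ccvg_normc (cF t)).
have iF k : cinteg mu (F_ k) by exact: (le_cinteg (mF k) (Fg k) ig).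
have iFl : cinteg mu F by exact: (le_cinteg mFl Flg ig).
apply: (ccvg_le (b := fun k => \int[mu]_t normc (F_ k t - F t))).
  by move=> k; rewrite -cintB// normc_cint_le//; exact: cintegB.
have mD k : measurable_fun setT (fun t => normc (F_ k t - F t)).
  by apply: measurable_normc; apply: cmeasD => //; exact: cmeasN.
have [] := @dominated_convergence _ _ _ mu setT measurableT
  (fun k t => (normc (F_ k t - F t))%:E) (cst 0%E) (fun t => (g t + g t)%:E).
- by move=> k; exact/measurable_EFinP.
- exact: measurable_cst.
- by apply: aeW => t _; apply: cvg_EFin; [exact: nearW|exact: cF].
- exact: rintegD.
- apply: aeW => t k _; rewrite gee0_abs ?lee_fin ?normc_ge0//.
  by rewrite (le_trans (normcB _ _))// lerD.
move=> _ _; rewrite integral_cst// mul0e => h.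
exact: (fine_cvg h).
Qed.

End DominatedConvergence.

(** * The Fourier transform of exp (- dl |t|) *)

Section PoissonKernel.
Context {R : realType}.
Local Notation mu := (@lebesgue_measure R).
Variable dl : R.
Hypothesis dl0 : 0 < dl.

Let is_derive_lin (c t : R) : is_derive t (1 : R) (fun u : R => c * u) c.
Proof.
apply: (@is_derive_eq _ _ _ _ _ _ _ (c *: (1 : R))); last by rewrite [LHS]mulr1.
Qed.

Let decay (t : R) := expR (- dl * t).
Let osc s (t : R) := (s * sin (s * t) - dl * cos (s * t)) / (dl ^+ 2 + s ^+ 2) - dl^-1.
(** [G s] is the primitive of [exp (- dl t) (1 + cos (s t))] that vanishes at
    infinity. *)
Let G s (t : R) := decay t * osc s t.

Let den s : dl ^+ 2 + s ^+ 2 != 0.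
Proof. by rewrite gt_eqF// ltr_wpDr ?sqr_ge0// exprn_gt0. Qed.

Let is_derive_decay (t : R) : is_derive t (1 : R) decay (- dl * decay t).
Proof.
have h := is_derive1_comp (is_derive_expR _) (is_derive_lin (- dl) t).
exact: (is_derive_eq h (mulrC _ _)).
Qed.

Let is_derive_osc s (t : R) : is_derive t (1 : R) (osc s)
  ((s * (s * cos (s * t)) + dl * (s * sin (s * t))) / (dl ^+ 2 + s ^+ 2)).
Proof.
have dS := is_derive1_comp (is_derive_sin _) (is_derive_lin s t).
have dC := is_derive1_comp (is_derive_cos _) (is_derive_lin s t).
have d1 := @is_deriveZ _ _ _ _ s _ _ _ dS.
have d2 := @is_deriveZ _ _ _ _ dl _ _ _ dC.
have d3 := @is_deriveZ _ _ _ _ (dl ^+ 2 + s ^+ 2)^-1 _ _ _ (is_deriveB d1 d2).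
have d4 := is_deriveB d3 (is_derive_cst dl^-1 t (1 : R)).
suff : is_derive t (1 : R) (osc s) ((dl ^+ 2 + s ^+ 2)^-1 *:
    (s *: (cos (s * t) * s) - dl *: (- sin (s * t) * s)) - 0).
  by move=> h; apply: (is_derive_eq h); rewrite subr0 /= /GRing.scale/=; ring.
rewrite (_ : osc s = (dl ^+ 2 + s ^+ 2)^-1 \*:
    (s \*: (sin \o (fun u => s * u)) - dl \*: (cos \o (fun u => s * u))) - cst dl^-1).
  exact: d4.
by apply/funext => u; rewrite /osc mulrC.
Qed.

Let is_derive_G s (t : R) : is_derive t (1 : R) (G s) (decay t * (1 + cos (s * t))).
Proof.
have h := is_deriveM (is_derive_decay t) (is_derive_osc s t).
apply: (is_derive_eq h).
rewrite /osc /GRing.scale/=; have := den s; have : dl != 0 by rewrite gt_eqF.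
by move=> a b; field; rewrite a b.
Qed.

Let G_cvg0 s : G s t @[t --> +oo] --> (0 : R).
Proof.
pose M := (`|s| + dl) / (dl ^+ 2 + s ^+ 2) + dl^-1.
have dt : expR (- (dl * t)) * M @[t --> +oo] --> (0 : R).
  rewrite -(mul0r M); apply: cvgM; last exact: cvg_cst.
  apply: (cvg_comp (fun t => dl * t) (fun x => expR (- x)) _ (@cvgr_expR R)).
  by apply: gt0_cvgMry.
apply/cvgrPdist_le => e e0; move/cvgrPdist_le : dt => /(_ _ e0).
apply: filterS => t; rewrite !sub0r !normrN; apply: le_trans.
rewrite /G /decay mulNr !normrM ler_wpM2l//.
rewrite (le_trans _ (ler_norm _))// (le_trans (ler_normB _ _))//.
rewrite /M lerD//; last by rewrite gtr0_norm// invr_gt0.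
have p : 0 < (dl ^+ 2 + s ^+ 2)^-1.
  by rewrite invr_gt0 ltr_wpDr ?sqr_ge0// exprn_gt0.
rewrite normrM (gtr0_norm p) ler_wpM2r ?(ltW p)// (le_trans (ler_normB _ _))//.
rewrite !normrM (gtr0_norm dl0) lerD//.
  by rewrite -[leRHS]mulr1 ler_wpM2l// sin_max.
by rewrite -[leRHS]mulr1 ler_wpM2l ?(ltW dl0)// cos_max.
Qed.

Let f s (t : R) := expR (- (dl * `|t|)) * (1 + cos (s * t)).

Let cont_f s : continuous (f s).
Proof.
move=> t; apply: cvgM.
  apply: (@continuous_comp _ _ _ (fun t => - (dl * `|t|)) expR); last exact: continuous_expR.
  by apply: cvgN; apply: cvgM; [exact: cvg_cst|exact: norm_continuous].
apply: cvgD; first exact: cvg_cst.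
apply: (@continuous_comp _ _ _ (fun t => s * t) cos); last exact: continuous_cos.
exact: mulrl_continuous.
Qed.

Let f_ge0 s t : 0 <= f s t.
Proof.
by rewrite mulr_ge0 ?expR_ge0.
Qed.

Let integral_f s : (\int[mu]_t (f s t)%:E =
  (2 / dl + 2 * dl / (dl ^+ 2 + s ^+ 2))%:E)%E.
Proof.
rewrite (ge0_symfun_integralT (f_ge0 s) (@cont_f s)); last first.
  by move=> t /=; rewrite /f normrN mulrN cosN.
rewrite -set_itvcy.
have -> : (\int[mu]_(t in `[0%R, +oo[) (f s t)%:E =
    \int[mu]_(t in `[0%R, +oo[) (decay t * (1 + cos (s * t)))%:E)%E.
  apply: eq_integral => t; rewrite inE/= in_itv/= andbT => t0.
  by rewrite /f /decay ger0_norm// mulNr.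
rewrite (@ge0_continuous_FTC2y _ _ (G s) 0 0).
- rewrite -EFinB -EFinM; congr EFin.
  rewrite /G /decay /osc !mulr0 expR0 sin0 cos0.
  have b := den s; have a : dl != 0 by rewrite gt_eqF.
  by field; rewrite a b.
- move=> t _; by rewrite mulr_ge0 ?expR_ge0.
- apply: continuous_subspaceT => t.
  apply: cvgM.
    apply: (@continuous_comp _ _ _ (fun t => - dl * t) expR); last exact: continuous_expR.
    exact: mulrl_continuous.
  apply: cvgD; first exact: cvg_cst.
  apply: (@continuous_comp _ _ _ (fun t => s * t) cos); last exact: continuous_cos.
  exact: mulrl_continuous.
- exact: G_cvg0.
- by move=> t _; case: (is_derive_G s t).
- apply: cvg_at_right_filter; apply: differentiable_continuous.
  by apply/derivable1_diffP; case: (is_derive_G s 0).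
- by move=> t _; rewrite derive1E; case: (is_derive_G s t).
Qed.

Let rinteg_f s : rinteg mu (f s).
Proof.
apply: rinteg_ltyP => //; last by rewrite integral_f ltry.
exact: continuous_measurable_fun.
Qed.

Let f0E t : f 0 t = 2 * expR (- (dl * `|t|)).
Proof. by rewrite /f mul0r cos0 mulrC. Qed.

Lemma rinteg_expR_abs : rinteg mu (fun t => expR (- (dl * `|t|))).
Proof.
rewrite (_ : (fun _ => _) = fun t => 2^-1 * f 0 t); first exact: rintegZ.
by apply/funext => t; rewrite f0E mulrA mulVf// mul1r.
Qed.

Let Rintegral_expR_abs : \int[mu]_t expR (- (dl * `|t|)) = 2 / dl.
Proof.
rewrite (_ : (fun _ => _) = fun t => 2^-1 * f 0 t); last first.
  by apply/funext => t; rewrite f0E mulrA mulVf// mul1r.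
rewrite RintegralZl//; last exact: rinteg_f.
rewrite /Rintegral integral_f /= expr0n addr0.
have a : dl != 0 by rewrite gt_eqF.
by field.
Qed.

Lemma rinteg_expR_abs_expi s :
  cinteg mu (fun t => (expR (- (dl * `|t|)))%:C%C * expi (s * t)).
Proof.
apply: (le_cinteg _ _ rinteg_expR_abs).
  apply: cmeasM; last by apply: cmeas_expi; exact: measurable_funM.
  exact/cmeas_real/rinteg_measurable/rinteg_expR_abs.
move=> t; rewrite ComplexField.Normc.normcM normc_expi mulr1 normc_real.
by rewrite ger0_norm ?expR_ge0.
Qed.

Let odd_integral (h : R -> R) : rinteg mu h -> (forall t, h (- t) = - h t) ->
  \int[mu]_t h t = 0.
Proof.
move=> ih oh; rewrite /Rintegral integralE.
have mh := rinteg_measurable ih.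
have -> : (\int[mu]_t (EFin \o h)^\- t = \int[mu]_t (EFin \o h)^\+ t)%E.
  have n1 : (-1 : R) != 0 by rewrite oppr_eq0 oner_eq0.
  have mp : measurable_fun setT (EFin \o h)^\+%E.
    by apply: measurable_funepos; exact/measurable_EFinP.
  rewrite [RHS](ge0_integral_affine 0 n1 mp); last by move=> t; exact: funepos_ge0.
  rewrite normrN1 mul1e; apply: eq_integral => t _.
  by rewrite funenegE funeposE /= add0r mulN1r oh EFinN.
by rewrite subee//; exact: integrable_pos_fin_num.
Qed.

(** The cosine part is obtained from the nonnegative even function
    [exp (- dl |t|) (1 + cos (s t))], for which the fundamental theorem of
    calculus on a half-line applies; the sine part is odd. *)
Lemma cint_expR_abs_expi s :
  cint mu (fun t => (expR (- (dl * `|t|)))%:C%C * expi (s * t)) =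
  (2 * dl / (dl ^+ 2 + s ^+ 2))%:C%C.
Proof.
have [iR iI] := rinteg_expR_abs_expi s.
apply: complex_ext => /=.
  have -> : (fun t => complex.Re ((expR (- (dl * `|t|)))%:C%C * expi (s * t))) =
      fun t => f s t - expR (- (dl * `|t|)).
    by apply/funext => t; rewrite ReM /= mul0r subr0 /f mulrDr mulr1; ring.
  rewrite RintegralB//; [|exact: rinteg_f|exact: rinteg_expR_abs].
  rewrite Rintegral_expR_abs /Rintegral integral_f /=; ring.
apply: odd_integral => // t.
by rewrite !mul0r !addr0 normrN mulrN sinN mulrN.
Qed.

End PoissonKernel.

(** * Fourier inversion *)

Section FourierInversion.
Context {R : realType} {d : nat}.
Local Notation V := 'rV[R]_d.
Local Notation mR := (measurableTypeR R).
Local Notation mu := (@lebesgue_measure R).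
Local Notation ld := (@lebesgue_nd R d).
Local Notation row := (@row_of_tuple R d).

Definition vmeas (f : V -> R[i]) := cmeas (fun t : d.-tuple mR => f (row t)).
Definition vinteg (f : V -> R[i]) := cinteg ld (fun t => f (row t)).
Definition norm1 (f : V -> R[i]) : R := \int[ld]_t normc (f (row t)).

Lemma norm1_ge0 f : 0 <= norm1 f.
Proof. by apply: Rintegral_ge0 => t _; exact: normc_ge0. Qed.

Lemma measurable_dotv (y : V) :
  measurable_fun setT (fun t : d.-tuple mR => dotv (row t) y).
Proof. exact: (@continuous_measurable_row _ _ (fun x => dotv x y) (@continuous_dotv _ _ y)). Qed.

Lemma measurable_dotv2 {d' : measure_display} {T : measurableType d'}
    (a b : T -> d.-tuple mR) : measurable_fun setT a -> measurable_fun setT b ->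
  measurable_fun setT (fun z => dotv (row (a z)) (row (b z))).
Proof.
move=> ma mb; rewrite /dotv; apply: measurable_sum => i.
apply: measurable_funM.
- under eq_fun do rewrite mxE; exact: (measurableT_comp (measurable_tnth i) ma).
- under eq_fun do rewrite mxE; exact: (measurableT_comp (measurable_tnth i) mb).
Qed.

Lemma vmeas_expi (y : V) : vmeas (fun x => expi (dotv x y)).
Proof. exact: (cmeas_expi (measurable_dotv y)). Qed.

Lemma normc_mul_expi (z : R[i]) (s : R) : normc (z * expi s) = normc z.
Proof. by rewrite ComplexField.Normc.normcM normc_expi mulr1. Qed.

Lemma vinteg_expi f y : vinteg f -> vinteg (fun x => f x * expi (dotv x y)).
Proof.
move=> fi; apply: (le_cinteg _ _ (rinteg_normc fi)).
  exact: (cmeasM (cinteg_meas fi) (vmeas_expi y)).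
by move=> t; rewrite normc_mul_expi.
Qed.

Lemma fourierE f xi :
  fourier f xi = cint ld (fun t => f (row t) * expi (dotv (row t) (- xi))).
Proof. by apply: eq_cint => t; rewrite dotvNr. Qed.

Lemma normc_fourier_le f xi : vinteg f -> normc (fourier f xi) <= norm1 f.
Proof.
move=> fi; rewrite fourierE (le_trans (normc_cint_le (vinteg_expi (- xi) fi)))//.
by rewrite /norm1; under eq_Rintegral do rewrite normc_mul_expi.
Qed.

Lemma expi_sum n (F : 'I_n -> R) : expi (\sum_(i < n) F i) = \prod_(i < n) expi (F i).
Proof. by apply: (big_morph (@expi R)); [exact: expiD|exact: expi0]. Qed.

(** A convergence factor that is a product over the coordinates, so that its
    Fourier transform is the product of Poisson kernels on the line. *)
Definition damp (dl : R) (x : V) : R := expR (- (dl * \sum_(i < d) `|x 0 i|)).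

Lemma damp_prod dl x : damp dl x = \prod_(i < d) expR (- (dl * `|x 0 i|)).
Proof. by rewrite /damp mulr_sumr -sumrN expR_sum. Qed.

Lemma rinteg_damp dl : 0 < dl -> rinteg ld (fun t => damp dl (row t)).
Proof.
move=> dl0; have := @rinteg_tensor _ d _ (fun=> rinteg_expR_abs dl0).
by congr (rinteg _ _); apply/funext => t; rewrite damp_prod;
  apply: eq_bigr => i _; rewrite mxE.
Qed.

Lemma cint_damp_expi dl (y : V) : 0 < dl ->
  cint ld (fun t => (damp dl (row t))%:C%C * expi (dotv (row t) y)) =
  ((2 / dl) ^+ d * Wt (dl^-1 *: y))%:C%C.
Proof.
move=> dl0.
have -> : (2 / dl) ^+ d * Wt (dl^-1 *: y) =
    \prod_(i < d) (2 * dl / (dl ^+ 2 + y 0 i ^+ 2)).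
  rewrite -[X in _ ^+ X](card_ord d) -prodr_const -big_split/=.
  apply: eq_bigr => i _; rewrite mxE /oneDsqr.
  have a : dl != 0 by rewrite gt_eqF.
  have b : dl ^+ 2 + y 0 i ^+ 2 != 0 by rewrite gt_eqF// ltr_wpDr ?sqr_ge0// exprn_gt0.
  by field; rewrite b a.
rewrite rmorph_prod/=.
under [RHS]eq_bigr do rewrite -(cint_expR_abs_expi dl0).
rewrite -(@cint_tensor _ d (fun i t => (expR (- (dl * `|t|)))%:C%C * expi (y 0 i * t))).
  apply: eq_cint => t; rewrite big_split/= damp_prod rmorph_prod/=; congr (_ * _).
    by apply: eq_bigr => i _; rewrite mxE.
  by rewrite -expi_sum; congr expi; apply: eq_bigr => i _; rewrite mxE mulrC.
by move=> i; exact: rinteg_expR_abs_expi.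
Qed.

Lemma Rintegral_Wt : \int[ld]_t Wt (row t) = pi ^+ d :> R.
Proof.
pose g (_ : 'I_d) (x : R) : R[i] := ((oneDsqr x)^-1)%:C%C.
have gi i : cinteg mu (g i).
  by split; [exact: rinteg_oneDsqrV|exact: rinteg0].
have := cint_tensor gi.
have -> : (fun t : d.-tuple mR => \prod_(i < d) g i (tnth t i)) =
    fun t => (Wt (row t))%:C%C.
  by apply/funext => t; rewrite Wt_row rmorph_prod.
have -> : \prod_(i < d) cint mu (g i) = (pi ^+ d)%:C%C.
  rewrite rmorphXn -[X in _ ^+ X](card_ord d) -prodr_const.
  apply: eq_bigr => i _; apply: complex_ext => /=; first exact: Rintegral_oneDsqrV.
  by rewrite /Rintegral integral0.
by move=> /(congr1 (@complex.Re R)).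
Qed.

Variable f : V -> R[i].
Hypotheses (fi : vinteg f) (fc : ccontinuous f).

Let fourier_damped dl x : 0 < dl ->
  cint ld (fun t => fourier f (row t) * expi (dotv x (row t)) *
    (damp dl (row t))%:C%C) =
  cint ld (fun t => f (row t) * ((2 / dl) ^+ d * Wt (dl^-1 *: (x - row t)))%:C%C).
Proof.
move=> dl0.
pose F (s t : d.-tuple mR) : R[i] :=
  f (row t) * ((damp dl (row s))%:C%C * expi (dotv (row s) (x - row t))).
transitivity (cint ld (fun s => cint ld (F s))).
  apply: eq_cint => s; rewrite fourierE -mulrA -cintZr; last exact: vinteg_expi.
  apply: eq_cint => t; rewrite /F -mulrA; congr (_ * _).
  rewrite mulrC mulrAC mulrC; congr (_ * _).
  by rewrite -expiD dotvBr dotvNr (dotvC x) (dotvC (row t)).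
have mdamp := rinteg_measurable (rinteg_damp dl0).
rewrite (@cint_fubini _ _ _ _ _ ld ld F _ _ _ (rinteg_damp dl0) (rinteg_normc fi)).
- apply: eq_cint => t; rewrite /F cintZ ?cint_damp_expi//.
  apply: (le_cinteg _ _ (rinteg_damp dl0)).
    by apply: cmeasM; [exact: cmeas_real|exact: vmeas_expi].
  by move=> s; rewrite normc_mul_expi normc_real ger0_norm// expR_ge0.
- have [mfR mfI] := cinteg_meas fi.
  apply: cmeasM; last apply: cmeasM.
  + by split; [exact: measurableT_comp mfR measurable_snd|
      exact: measurableT_comp mfI measurable_snd].
  + by apply: cmeas_real; exact: measurableT_comp mdamp measurable_fst.
  + apply: cmeas_expi; under eq_fun do rewrite dotvBr.
    apply: measurable_funB.
      exact: (measurableT_comp (measurable_dotv x) measurable_fst).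
    by apply: measurable_dotv2; [exact: measurable_fst|exact: measurable_snd].
- move=> s t; rewrite /F ComplexField.Normc.normcM normc_mul_expi normc_real.
  by rewrite ger0_norm ?expR_ge0// mulrC.
Qed.

Let fourier_damped_scaled dl x : 0 < dl ->
  cint ld (fun t => fourier f (row t) * expi (dotv x (row t)) *
    (damp dl (row t))%:C%C) =
  cint ld (fun t => f (x + dl *: row t) * (2 ^+ d * Wt (row t))%:C%C).
Proof.
move=> dl0; rewrite fourier_damped//.
have dln : dl != 0 by rewrite gt_eqF.
have gi : cinteg ld (fun t => f (row t) *
    ((2 / dl) ^+ d * Wt (dl^-1 *: (x - row t)))%:C%C).
  apply: (le_cinteg _ _ (rintegZ ((2 / dl) ^+ d) (rinteg_normc fi))).
    apply: cmeasM; first exact: cinteg_meas fi.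
    apply: cmeas_real; apply: measurable_funM => //.
    apply: (@continuous_measurable_row _ _ (fun z => Wt (dl^-1 *: (x - z)))).
    under eq_fun do rewrite scalerBr -scaleNr.
    move=> z; apply: (@continuous_comp _ _ _
      (fun z : V => dl^-1 *: x + (- dl^-1) *: z) (@Wt R d)).
      exact: continuous_affine_row.
    exact: continuous_Wt.
  move=> t; rewrite ComplexField.Normc.normcM normc_real mulrC ler_wpM2r ?normc_ge0//.
  have c0 : 0 <= (2 / dl) ^+ d by rewrite exprn_ge0// divr_ge0// ltW.
  rewrite ger0_norm ?mulr_ge0 ?Wt_ge0//.
  by rewrite -[leRHS]mulr1 ler_wpM2l// Wt_le1.
rewrite (cint_affine_tuple (fun i => x 0 i) dln gi).
rewrite -cintZ; last exact: (cinteg_affine_tuple (fun i => x 0 i) dln gi).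
apply: eq_cint => t; rewrite row_affine.
have -> : \row_i x 0 i = x by apply/rowP => i; rewrite mxE.
rewrite mulrCA -rmorphM; congr (_ * _%:C%C).
rewrite opprD addrA subrr sub0r scalerN scalerA mulVf// scale1r WtN.
rewrite gtr0_norm// mulrA -exprMn; congr (_ ^+ _ * _); field.
exact: dln.
Qed.

(** The damped inversion integral is, by Fubini and a dilation, the average of
    [f (x + dl z)] against the fixed integrable profile [2^d Wt z]; the damping
    is then removed on both sides by dominated convergence. *)
Theorem fourier_inversion M x : (forall y, normc (f y) <= M) ->
  vinteg (fourier f) ->
  cint ld (fun t => fourier f (row t) * expi (dotv x (row t))) =
  ((2 * pi) ^+ d)%:C%C * f x.
Proof.
move=> fM ffi.
pose dl (k : nat) : R := k.+1%:R^-1.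
have dl0 k : 0 < dl k by rewrite invr_gt0.
have dlc : dl k @[k --> \oo] --> (0 : R) by exact: cvg_harmonic.
have mff := cinteg_meas ffi.
pose F k t := fourier f (row t) * expi (dotv x (row t)) * (damp (dl k) (row t))%:C%C.
pose H k t := f (x + dl k *: row t) * (2 ^+ d * Wt (row t))%:C%C.
have expix : cmeas (fun t : d.-tuple mR => expi (dotv x (row t))).
  by under eq_fun do rewrite dotvC; exact: vmeas_expi.
have mF k : cmeas (F k).
  apply: cmeasM; first exact: cmeasM.
  by apply: cmeas_real; exact: (rinteg_measurable (rinteg_damp (dl0 k))).
have cF : ccvg (fun k => cint ld (F k))
    (cint ld (fun t => fourier f (row t) * expi (dotv x (row t)))).
  apply: (@cint_dominated _ _ _ ld F _ (fun t => normc (fourier f (row t))) mF _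
    (rinteg_normc ffi)) => [t|k t].
    rewrite -[X in ccvg _ X]mulr1; apply: ccvgM; first exact: ccvg_cst.
    apply: ccvg_Re_Im => /=; last exact: cvg_cst.
    rewrite -(@expR0 R); apply: continuous_cvg; first exact: continuous_expR.
    rewrite -[X in _ --> X]oppr0; apply: cvgN.
    rewrite -[X in _ --> X](mul0r (\sum_(i < d) `|row t 0 i|)).
    exact: (cvgM dlc (cvg_cst _)).
  rewrite ComplexField.Normc.normcM normc_mul_expi -[leRHS]mulr1.
  rewrite ler_wpM2l ?normc_ge0// normc_real ger0_norm ?expR_ge0//.
  rewrite /damp -expR0 ler_expR oppr_le0 mulr_ge0 ?(ltW (dl0 k))//.
  exact: sumr_ge0.
have W0 t : 0 <= 2 ^+ d * Wt (row t) :> R by rewrite mulr_ge0 ?exprn_ge0 ?Wt_ge0.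
have mW : cmeas (fun t : d.-tuple mR => (2 ^+ d * Wt (row t))%:C%C).
  by apply: cmeas_real; apply: measurable_funM => //;
    exact: rinteg_measurable rinteg_Wt.
have cH : ccvg (fun k => cint ld (H k))
    (cint ld (fun t => f x * (2 ^+ d * Wt (row t))%:C%C)).
  apply: (@cint_dominated _ _ _ ld H _ (fun t => M * (2 ^+ d * Wt (row t)))).
  - move=> k; apply: cmeasM => //.
    have c := @continuous_affine_row R d x (dl k).
    apply: (@ccontinuous_cmeas _ _ (fun z => f (x + dl k *: z))); case: fc => a b.
    split => z.
    + exact: (cvg_comp _ _ (c z) (a _)).
    + exact: (cvg_comp _ _ (c z) (b _)).
  - move=> t; apply: ccvgM; last exact: ccvg_cst.
    have c : x + dl k *: row t @[k --> \oo] --> x.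
      rewrite -[X in _ --> X]addr0 -(scale0r (row t)).
      exact: (cvgD (cvg_cst x) (cvgZ dlc (cvg_cst (row t)))).
    apply: ccvg_Re_Im; case: fc => a b.
    + exact: (cvg_comp _ _ c (a x)).
    + exact: (cvg_comp _ _ c (b x)).
  - by apply: rintegZ; apply: rintegZ; exact: rinteg_Wt.
  - move=> k t; rewrite ComplexField.Normc.normcM ler_pM ?normc_ge0//.
    by rewrite normc_real ger0_norm.
have FH k : cint ld (F k) = cint ld (H k) by exact: fourier_damped_scaled.
move: cH; rewrite (_ : (fun k => cint ld (H k)) = fun k => cint ld (F k)); last first.
  by apply/funext => k; rewrite FH.
move/(ccvg_unique cF) => ->.
rewrite cintZ; last first.
  apply: (le_cinteg mW _ (rintegZ (2 ^+ d) rinteg_Wt)) => t.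
  by rewrite normc_real ger0_norm.
rewrite mulrC; congr (_ * _); apply: complex_ext => /=; last first.
  by rewrite /Rintegral integral0.
rewrite RintegralZl//; last exact: rinteg_Wt.
by rewrite exprMn Rintegral_Wt.
Qed.

End FourierInversion.

(** * Smoothness of inverse Fourier transforms *)

Section ExpBounds.
Context {R : realType}.

Lemma norm_sin_le (h : R) : `|sin h| <= `|h|.
Proof.
wlog h0 : h / 0 <= h.
  move=> H; have [/H//|h0] := leP 0 h.
  by have := H (- h); rewrite sinN !normrN; apply; rewrite oppr_ge0 ltW.
have [c _] := MVT_segment h0 (fun x _ => is_derive_sin x)
  (continuous_subspaceT (@continuous_sin R)).
rewrite sin0 !subr0 => ->; rewrite normrM -[leRHS]mul1r ler_wpM2r//.
exact: cos_max.
Qed.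

Lemma norm_cosB1_le (h : R) : `|cos h - 1| <= `|h| ^+ 2.
Proof.
wlog h0 : h / 0 <= h.
  move=> H; have [/H//|h0] := leP 0 h.
  by have := H (- h); rewrite cosN normrN; apply; rewrite oppr_ge0 ltW.
have [c] := MVT_segment h0 (fun x _ => is_derive_cos x)
  (continuous_subspaceT (@continuous_cos R)).
rewrite in_itv/= => /andP[c0 ch]; rewrite cos0 !subr0 => ->.
rewrite normrM normrN expr2 ler_wpM2r// (le_trans (norm_sin_le _))//.
by rewrite !ger0_norm.
Qed.

Lemma norm_cosB1_le1 (h : R) : `|cos h - 1| <= `|h|.
Proof.
wlog h0 : h / 0 <= h.
  move=> H; have [/H//|h0] := leP 0 h.
  by have := H (- h); rewrite cosN normrN; apply; rewrite oppr_ge0 ltW.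
have [c _] := MVT_segment h0 (fun x _ => is_derive_cos x)
  (continuous_subspaceT (@continuous_cos R)).
rewrite cos0 !subr0 => ->; rewrite normrM normrN -[leRHS]mul1r ler_wpM2r//.
exact: sin_max.
Qed.

Lemma norm_sinBid_le (h : R) : `|sin h - h| <= `|h| ^+ 2.
Proof.
wlog h0 : h / 0 <= h.
  move=> H; have [/H//|h0] := leP 0 h.
  by have := H (- h); rewrite sinN -opprD !normrN; apply; rewrite oppr_ge0 ltW.
have ds (x : R) : is_derive x (1 : R) (sin - id) (cos x - 1).
  exact: is_deriveB (is_derive_sin x) (is_derive_id x 1).
have cs : continuous (sin - id : R -> R).
  by move=> x; exact: (cvgB (@continuous_sin R x) cvg_id).
have [c] := MVT_segment h0 (fun x _ => ds x) (continuous_subspaceT cs).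
rewrite in_itv/= => /andP[c0 ch].
rewrite -[(sin - id) h]/(sin h - h) -[(sin - id) 0]/(sin 0 - 0) sin0 !subr0 => ->.
rewrite normrM expr2 ler_wpM2r// (le_trans (norm_cosB1_le1 _))//.
by rewrite !ger0_norm.
Qed.

Lemma normc_expiB1 (h : R) : normc (expi h - 1) <= 2 * `|h|.
Proof.
rewrite (le_trans (normc_leD _))// ReD ImD ReN ImN/= subr0 mulr2n mulrDl mul1r.
by rewrite lerD ?norm_cosB1_le1 ?norm_sin_le.
Qed.

Lemma normc_expiB1i (h : R) :
  normc (expi h - 1 - Complex 0 h) <= 2 * `|h| ^+ 2.
Proof.
rewrite (le_trans (normc_leD _))// !ReD !ImD !ReN !ImN/= !subr0 mulr2n mulrDl mul1r.
by rewrite lerD ?norm_cosB1_le ?norm_sinBid_le.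
Qed.

End ExpBounds.

Section InverseTransform.
Context {R : realType} {d : nat}.
Local Notation V := 'rV[R]_d.
Local Notation mR := (measurableTypeR R).
Local Notation ld := (@lebesgue_nd R d).
Local Notation row := (@row_of_tuple R d).

(** Decay is measured against [Wt], so that all polynomial multiples are
    integrable. *)
Definition rapid (A : V -> R[i]) := vmeas A /\
  forall N, exists C, forall x, normc (A x) * (1 + enorm x) ^+ N <= C * Wt x.

(** The inverse Fourier transform up to its normalising constant, which is [cd]
    below. *)
Definition invF (A : V -> R[i]) (x : V) : R[i] :=
  cint ld (fun t => A (row t) * expi (dotv x (row t))).

Lemma fourier_invF f xi : fourier f xi = invF f (- xi).
Proof. by rewrite fourierE; apply: eq_cint => t; rewrite dotvC. Qed.

Lemma measurable_enorm : measurable_fun setT (fun t : d.-tuple mR => enorm (row t)).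
Proof. exact: (continuous_measurable_row (@continuous_enorm R d)). Qed.

Lemma rapid_rinteg A N : rapid A ->
  rinteg ld (fun t => normc (A (row t)) * enorm (row t) ^+ N).
Proof.
move=> [mA /(_ N)[C CA]]; apply: (le_rinteg _ _ (rintegZ C rinteg_Wt)).
  apply: measurable_funM; first exact: measurable_normc.
  exact: (measurable_funX N measurable_enorm).
move=> t; rewrite ger0_norm ?mulr_ge0 ?normc_ge0 ?exprn_ge0 ?enorm_ge0//.
rewrite (le_trans _ (CA _))// ler_wpM2l ?normc_ge0// lerXn2r ?nnegrE ?enorm_ge0//.
- by rewrite addr_ge0 ?enorm_ge0.
- by rewrite lerDr.
Qed.

Lemma rapid_vinteg A : rapid A -> vinteg A.
Proof.
move=> rA; have [mA _] := rA.
apply: (le_cinteg mA _ (rapid_rinteg 0 rA)) => t.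
by rewrite expr0 mulr1.
Qed.

Definition mul_coord i (A : V -> R[i]) (x : V) : R[i] := Complex 0 (x 0 i) * A x.

Lemma rapid_mul_coord i A : rapid A -> rapid (mul_coord i A).
Proof.
move=> [mA dA]; split.
  apply: cmeasM => //; split => /=; first exact: measurable_cst.
  by under eq_fun do rewrite mxE; exact: measurable_tnth.
move=> N; have [C CA] := dA N.+1; exists C => x; apply: le_trans (CA x).
rewrite ComplexField.Normc.normcM -mulrA exprS [leRHS]mulrCA.
rewrite ler_wpM2r ?mulr_ge0 ?exprn_ge0 ?addr_ge0 ?enorm_ge0 ?normc_ge0//.
rewrite normcE /= expr0n add0r sqrtr_sqr (le_trans (coord_le_enorm _ _))//.
by rewrite lerDr.
Qed.

Lemma vmeas_expi_r (x : V) :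
  cmeas (fun t : d.-tuple mR => expi (dotv x (row t))).
Proof. by under eq_fun do rewrite dotvC; exact: vmeas_expi. Qed.

Lemma cinteg_invF A x : vinteg A ->
  cinteg ld (fun t => A (row t) * expi (dotv x (row t))).
Proof.
move=> iA; apply: (le_cinteg _ _ (rinteg_normc iA)).
  exact: cmeasM (cinteg_meas iA) (vmeas_expi_r x).
by move=> t; rewrite normc_mul_expi.
Qed.

Lemma normc_invF_le A x : vinteg A -> normc (invF A x) <= norm1 A.
Proof.
move=> iA; rewrite (le_trans (normc_cint_le (cinteg_invF x iA)))//.
by rewrite /norm1; under eq_Rintegral do rewrite normc_mul_expi.
Qed.

Lemma invF_lip A : rapid A -> exists2 L, 0 <= L &
  forall x y, normc (invF A x - invF A y) <= L * enorm (x - y).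
Proof.
move=> rA; have iA := rapid_vinteg rA.
have i1 := rapid_rinteg 1 rA.
exists (2 * \int[ld]_t (normc (A (row t)) * enorm (row t) ^+ 1)).
  rewrite mulr_ge0// Rintegral_ge0// => t _.
  by rewrite mulr_ge0 ?normc_ge0 ?exprn_ge0 ?enorm_ge0.
move=> x y; rewrite -cintB; [|exact: cinteg_invF..].
rewrite mulrC mulrA -RintegralZl//.
apply: normc_cint_le_bound.
- apply: cmeasD; last apply: cmeasN;
  by apply: cmeasM; [exact: (cinteg_meas iA)|exact: vmeas_expi_r].
- exact: rintegZ.
- move=> t; rewrite -mulrBr ComplexField.Normc.normcM expr1.
  rewrite mulrCA ler_wpM2l ?normc_ge0//.
  rewrite -{1}(subrK y x) dotvDl expiD -{2}(mul1r (expi (dotv y _))) -mulrBl.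
  rewrite normc_mul_expi (le_trans (normc_expiB1 _))//.
  by rewrite [leRHS]mulrAC [leRHS]mulrC ler_wpM2l// norm_dotv_le.
Qed.

Lemma lip_continuous (F : V -> R) L : 0 <= L ->
  (forall x y, `|F x - F y| <= L * enorm (x - y)) -> continuous F.
Proof.
move=> L0 FL x; apply/(@cvgrPdist_le R R V (nbhs x) _ F (F x)) => e e0.
have L1 : 0 < L + 1 by rewrite ltr_wpDl.
have c : enorm (x - y) @[y --> x] --> (0 : R).
  rewrite -(@enorm0 R d) -(subrr x).
  exact: (cvg_comp _ _ (cvgB (cvg_cst x) (@cvg_id _ (nbhs x)))
    (@continuous_enorm R d (x - x))).
have /(@cvgrPdist_le R R V (nbhs x) _)/(_ (e / (L + 1)))/(_ (divr_gt0 e0 L1)) := c.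
apply: filterS => y; rewrite sub0r normrN ger0_norm ?enorm_ge0// => xy.
rewrite (le_trans (FL _ _))// (le_trans (ler_wpM2l L0 xy))//.
by rewrite mulrCA ler_piMr ?(ltW e0)// ler_pdivrMr// mul1r lerDl.
Qed.

Lemma invF_ccontinuous A : rapid A -> ccontinuous (invF A).
Proof.
move=> rA; have [L L0 AL] := invF_lip rA.
split; apply: (lip_continuous L0) => x y; apply: le_trans (AL x y).
- by rewrite -ReN -ReD Re_le_normc.
- by rewrite -ImN -ImD Im_le_normc.
Qed.

Lemma quadratic_derive (F : V -> R) x v L C :
  (forall h : R, `|F (x + h *: v) - F x - h * L| <= C * h ^+ 2) ->
  is_derive x v F L.
Proof.
move=> FC; have cv : h^-1 *: (F (h *: v + x) - F x) @[h --> 0^'] --> L.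
  apply/cvgrPdist_le => e e0.
  have C1 : 0 < `|C| + 1 by rewrite ltr_wpDl.
  near=> h.
  have h0 : h != 0 by near: h; exact: nbhs_dnbhs_neq.
  rewrite /GRing.scale/= -normrN opprB.
  rewrite -(ler_pM2l (_ : 0 < `|h|)) ?normr_gt0// -normrM mulrBr mulrA divff// mul1r.
  rewrite addrC [h *: v + x]addrC addrC (le_trans (FC h))//.
  rewrite (le_trans (ler_norm _))// normrM normrX expr2 mulrCA ler_wpM2l//.
  rewrite (le_trans (_ : _ <= (`|C| + 1) * `|h|)) ?ler_wpM2r ?lerDl//.
  rewrite mulrC -ler_pdivlMr//.
  near: h; apply: dnbhs0_le; exact: divr_gt0.
apply: DeriveDef; first by apply/cvg_ex; exists L.
exact/cvg_lim.
Unshelve. all: by end_near. Qed.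

(** Differentiation under the integral sign, with the explicit remainder
    [|e^{ih} - 1 - ih| <= 2 h^2]. *)
Lemma invF_quadratic A i x : rapid A -> exists C, forall h : R,
  normc (invF A (x + h *: delta_mx 0 i) - invF A x -
    h%:C%C * invF (mul_coord i A) x) <= C * h ^+ 2.
Proof.
move=> rA; have iA := rapid_vinteg rA.
have iM := rapid_vinteg (rapid_mul_coord i rA).
have i2 := rapid_rinteg 2 rA.
exists (2 * \int[ld]_t (normc (A (row t)) * enorm (row t) ^+ 2)) => h.
have iMx := cinteg_invF x iM.
have iAx := cinteg_invF x iA.
have iAh := cinteg_invF (x + h *: delta_mx 0 i) iA.
rewrite -cintZ// -cintB// -cintB//; [|exact: (cintegB iAh iAx)|exact: (cintegZ _ iMx)].
rewrite mulrC mulrA -RintegralZl//.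
apply: normc_cint_le_bound.
- exact: (cinteg_meas (cintegB (cintegB iAh iAx) (cintegZ _ iMx))).
- exact: rintegZ.
move=> t; rewrite dotvDl expiD dotvZl dotv_delta /mul_coord.
set z := A _; set u := expi (dotv x _); set s := row t 0 i.
have -> : z * (u * expi (h * s)) - z * u - h%:C%C * (Complex 0 s * z * u) =
    z * (expi (h * s) - 1 - Complex 0 (h * s)) * u.
  have -> : Complex 0 (h * s) = h%:C%C * Complex 0 s.
    by apply: complex_ext; rewrite ?ReM ?ImM/= ?mul0r ?mulr0 ?subr0 ?addr0.
  ring.
rewrite normc_mul_expi ComplexField.Normc.normcM mulrCA ler_wpM2l ?normc_ge0//.
rewrite (le_trans (normc_expiB1i _))// normrM exprMn real_normK ?num_real//.
have h2 : 0 <= h ^+ 2 * 2 by rewrite pmulr_lge0// sqr_ge0.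
rewrite mulrA [2 * _]mulrC ler_wpM2l//.
rewrite lerXn2r ?nnegrE ?enorm_ge0//.
exact: coord_le_enorm.
Qed.

Lemma invF_derive_Re A i x : rapid A ->
  is_derive x (delta_mx 0 i) (fun x => complex.Re (invF A x))
    (complex.Re (invF (mul_coord i A) x)).
Proof.
move=> rA; have [C AC] := invF_quadratic i x rA.
apply: (quadratic_derive (C := C)) => h; apply: le_trans (AC h).
rewrite (le_trans _ (Re_le_normc _))// !ReD !ReN ReM /= mul0r subr0.
exact: lexx.
Qed.

Lemma invF_derive_Im A i x : rapid A ->
  is_derive x (delta_mx 0 i) (fun x => complex.Im (invF A x))
    (complex.Im (invF (mul_coord i A) x)).
Proof.
move=> rA; have [C AC] := invF_quadratic i x rA.
apply: (quadratic_derive (C := C)) => h; apply: le_trans (AC h).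
rewrite (le_trans _ (Im_le_normc _))// !ImD !ImN ImM /= mul0r addr0.
exact: lexx.
Qed.

(** A partial derivative of the inverse transform of [A] is the inverse
    transform of [mul_coord i A], again rapidly decreasing: smoothness thus
    reduces to the existence and the continuity of first derivatives. *)
Lemma invF_iter_partial A (s : seq 'I_d) : rapid A -> exists2 B, rapid B &
  iter_partial s (fun x => complex.Re (invF A x)) =
    (fun x => complex.Re (invF B x)) /\
  iter_partial s (fun x => complex.Im (invF A x)) =
    (fun x => complex.Im (invF B x)).
Proof.
move=> rA; elim: s => [|i s [B rB [IHR IHI]]]; first by exists A.
exists (mul_coord i B); first exact: rapid_mul_coord.
split; apply/funext => x /=.
- by rewrite IHR; case: (invF_derive_Re i x rB).
- by rewrite IHI; case: (invF_derive_Im i x rB).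
Qed.

Lemma iter_partial_near (s : seq 'I_d) (F G : V -> R) (x : V) :
  (\forall y \near x, F y = G y) ->
  \forall y \near x, iter_partial s F y = iter_partial s G y.
Proof.
move=> FG; elim: s => [//|i s IH] /=.
by apply: filterS (near_join IH) => y; exact: near_eq_derive.
Qed.

(** Iterated partial derivatives depend on germs only. *)
Lemma smooth_on_near (Omega : set V) (F : V -> R) :
  (forall x, Omega x -> exists2 G : V -> R,
     (\forall y \near x, F y = G y) & smooth_on setT G) -> smooth_on Omega F.
Proof.
move=> FG s x Ox; have [G FGx sG] := FG x Ox.
have eq := iter_partial_near s FGx.
have [cG dG] := sG s x I; split.
  suff : iter_partial s F y @[y --> x] --> iter_partial s F x by [].
  rewrite (nbhs_singleton eq).
  have eq' : {near x, iter_partial s G =1 iter_partial s F}.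
    by apply: (@filterS _ (nbhs x) _ _ _ _ eq) => y.
  exact: (cvg_trans (@near_eq_cvg _ _ (nbhs x) _ _ _ eq') cG).
move=> i; apply: near_eq_derivable (dG i).
by apply: (@filterS _ (nbhs x) _ _ _ _ eq) => y.
Qed.

Lemma invF_smooth A : rapid A ->
  smooth_on setT (fun x => complex.Re (invF A x)) /\
  smooth_on setT (fun x => complex.Im (invF A x)).
Proof.
move=> rA; split=> s x _; have [B rB [ER EI]] := invF_iter_partial s rA;
  have [cR cI] := invF_ccontinuous rB.
- rewrite ER; split; first exact: cR.
  by move=> i; exact: (@ex_derive _ _ _ _ _ _ _ (invF_derive_Re i x rB)).
- rewrite EI; split; first exact: cI.
  by move=> i; exact: (@ex_derive _ _ _ _ _ _ _ (invF_derive_Im i x rB)).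
Qed.

End InverseTransform.

(** * Transforms of compactly supported functions *)

Section CompactSupport.
Context {R : realType} {d : nat}.
Local Notation V := 'rV[R]_d.
Local Notation mR := (measurableTypeR R).
Local Notation ld := (@lebesgue_nd R d).
Local Notation row := (@row_of_tuple R d).

Definition cc (f : V -> R[i]) := ccontinuous f /\ compact (tsupport f).

Lemma tsupport_eq0 (f : V -> R[i]) x : ~ tsupport f x -> f x = 0.
Proof.
by move=> h; apply/eqP; apply: contra_notT h => fx; exact: subset_closure.
Qed.

Lemma tsupport_subset (f g : V -> R[i]) : (forall x, f x = 0 -> g x = 0) ->
  tsupport g `<=` tsupport f.
Proof.
by move=> fg; apply: closure_subset => x /=; apply: contra_neq; exact: fg.
Qed.

Lemma tsupport_compact (f g : V -> R[i]) : (forall x, f x = 0 -> g x = 0) ->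
  compact (tsupport f) -> compact (tsupport g).
Proof.
move=> fg sf.
exact: (subclosed_compact (@closed_closure _ _) sf (tsupport_subset fg)).
Qed.

Lemma ccontinuousM (f g : V -> R[i]) : ccontinuous f -> ccontinuous g ->
  ccontinuous (fun x => f x * g x).
Proof.
move=> [a b] [c e]; split.
- under eq_fun do rewrite ReM.
  by move=> x; exact: (cvgB (cvgM (a x) (c x)) (cvgM (b x) (e x))).
- under eq_fun do rewrite ImM.
  by move=> x; exact: (cvgD (cvgM (a x) (e x)) (cvgM (b x) (c x))).
Qed.

Lemma ccontinuousD (f g : V -> R[i]) : ccontinuous f -> ccontinuous g ->
  ccontinuous (fun x => f x + g x).
Proof.
move=> [a b] [c e]; split.
- by under eq_fun do rewrite ReD; move=> x; exact: (cvgD (a x) (c x)).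
- by under eq_fun do rewrite ImD; move=> x; exact: (cvgD (b x) (e x)).
Qed.

Lemma ccontinuous_cst (c : R[i]) : ccontinuous (fun _ : V => c).
Proof. by split; exact: cst_continuous. Qed.

Lemma ccontinuous_expi (y : V) : ccontinuous (fun x => expi (dotv x y)).
Proof.
split => x /=.
- exact: (cvg_comp _ _ (@continuous_dotv _ _ y x) (@continuous_cos R _)).
- exact: (cvg_comp _ _ (@continuous_dotv _ _ y x) (@continuous_sin R _)).
Qed.

Lemma ccontinuous_normc (f : V -> R[i]) : ccontinuous f ->
  continuous (fun x => normc (f x)).
Proof.
move=> [a b]; under eq_fun do rewrite normcE.
move=> x; apply: continuous_comp; last exact: sqrt_continuous.
exact: (cvgD (cvgM (a x) (a x)) (cvgM (b x) (b x))).
Qed.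

Lemma cc_mul (f g : V -> R[i]) : cc f -> ccontinuous g -> cc (fun x => f x * g x).
Proof.
move=> [cf sf] cg; split; first exact: ccontinuousM.
by apply: tsupport_compact sf => x ->; rewrite mul0r.
Qed.

Lemma cc_bound (f : V -> R[i]) (g : V -> R) : cc f -> continuous g ->
  exists2 C, 0 <= C & forall x, normc (f x) * g x <= C.
Proof.
move=> [cf sf] cg.
have c : continuous (fun x => normc (f x) * g x).
  by move=> x; exact: (cvgM (@ccontinuous_normc f cf x) (cg x)).
have /compact_bounded [M [_ HM]] :=
  continuous_compact (continuous_subspaceT c) sf.
exists (`|M| + 1) => [|x]; first by rewrite addr_ge0.
have [xs|xs] := pselect (tsupport f x); last first.
  by rewrite (tsupport_eq0 xs) ComplexField.Normc.normc0 mul0r addr_ge0.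
rewrite (le_trans (ler_norm _))// HM//; last by exists x.
by rewrite (le_lt_trans (ler_norm M))// ltrDl.
Qed.

Lemma cc_rapid f : cc f -> rapid f.
Proof.
move=> ccf; split; first by case: ccf => cf _; exact: ccontinuous_cmeas.
move=> N.
have c : continuous (fun x : V => (1 + enorm x) ^+ N * (Wt x)^-1).
  move=> x.
  have h : (1 + enorm y) ^+ N @[y --> x] --> (1 + enorm x) ^+ N.
    apply: (@continuous_comp _ _ _ (fun y : V => 1 + enorm y) (fun z : R => z ^+ N)).
      exact: (cvgD (cvg_cst (1 : R)) (@continuous_enorm R d x)).
    exact: exprn_continuous.
  have W0 : Wt x != 0 by rewrite gt_eqF// Wt_gt0.
  exact: (cvgM h (cvgV W0 (@continuous_Wt R d x))).
have [C _ HC] := cc_bound ccf c; exists C => x.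
by rewrite -ler_pdivrMr ?Wt_gt0// -mulrA.
Qed.

Lemma cc_vinteg f : cc f -> vinteg f.
Proof. by move/cc_rapid/rapid_vinteg. Qed.

Lemma fourier_ccontinuous f : cc f -> ccontinuous (fourier f).
Proof.
move=> /cc_rapid rf; have [a b] := invF_ccontinuous rf.
have c : continuous (fun x : V => - x) by exact: opp_continuous.
split; under eq_fun do rewrite fourier_invF.
- by move=> x; exact: (cvg_comp _ _ (c x) (a (- x))).
- by move=> x; exact: (cvg_comp _ _ (c x) (b (- x))).
Qed.

Lemma fourier_vmeas f : cc f -> vmeas (fourier f).
Proof. by move=> /fourier_ccontinuous; exact: ccontinuous_cmeas. Qed.

Lemma cc_inversion f x : cc f -> vinteg (fourier f) ->
  invF (fourier f) x = ((2 * pi) ^+ d)%:C%C * f x.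
Proof.
move=> ccf iff; have [cf _] := ccf.
have [M _ fM] := cc_bound ccf (@cst_continuous V R 1).
apply: (fourier_inversion (cc_vinteg ccf) cf x (M := M) _ iff) => y.
by have := fM y; rewrite mulr1.
Qed.

Definition cd : R := ((2 * pi) ^+ d)^-1.

Lemma twopi_gt0 : 0 < (2 * pi) ^+ d :> R.
Proof. by rewrite exprn_gt0// mulr_gt0// pi_gt0. Qed.

Lemma cd_gt0 : 0 < cd. Proof. by rewrite invr_gt0 twopi_gt0. Qed.

Lemma cc_inversionV f x : cc f -> vinteg (fourier f) ->
  f x = cd%:C%C * invF (fourier f) x.
Proof.
move=> ccf iff; rewrite cc_inversion// mulrA -rmorphM /cd mulVf ?mul1r//.
by rewrite gt_eqF// twopi_gt0.
Qed.

Lemma normc_le_fourier f x : cc f -> vinteg (fourier f) ->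
  normc (f x) <= cd * norm1 (fourier f).
Proof.
move=> ccf iff; rewrite [in leLHS](cc_inversionV x ccf iff).
rewrite ComplexField.Normc.normcM normc_real gtr0_norm ?cd_gt0//.
by rewrite ler_wpM2l ?(ltW cd_gt0)// normc_invF_le.
Qed.

(** Expand one factor by the inversion formula and exchange the integrals. *)
Lemma fourierM f g xi : cc f -> vinteg (fourier f) -> vinteg g ->
  fourier (fun x => g x * f x) xi =
  cd%:C%C * cint ld (fun s => fourier f (row s) * fourier g (xi - row s)).
Proof.
move=> ccf iff ig; have mff := cinteg_meas iff; have mg := cinteg_meas ig.
pose F (t s : d.-tuple mR) : R[i] :=
  g (row t) * (fourier f (row s) * expi (dotv (row t) (row s - xi))).
have mF : cmeas (fun z : d.-tuple mR * d.-tuple mR => F z.1 z.2).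
  apply: cmeasM; last apply: cmeasM.
  - by case: mg => p q; split; [exact: (measurableT_comp p measurable_fst)|
      exact: (measurableT_comp q measurable_fst)].
  - by case: mff => p q; split; [exact: (measurableT_comp p measurable_snd)|
      exact: (measurableT_comp q measurable_snd)].
  - apply: cmeas_expi; under eq_fun do rewrite dotvBr.
    apply: measurable_funB.
      by apply: measurable_dotv2; [exact: measurable_fst|exact: measurable_snd].
    exact: (measurableT_comp (measurable_dotv xi) measurable_fst).
have FE t s : normc (F t s) <= normc (g (row t)) * normc (fourier f (row s)).
  by rewrite /F ComplexField.Normc.normcM normc_mul_expi.
have gfi : vinteg (fun x => g x * f x).
  have [C _ fC] := cc_bound ccf (@cst_continuous V R 1).
  apply: (le_cinteg _ _ (rintegZ C (rinteg_normc ig))).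
    by apply: cmeasM => //; case: ccf => cf _; exact: ccontinuous_cmeas.
  move=> t; rewrite ComplexField.Normc.normcM mulrC ler_wpM2r ?normc_ge0//.
  by have := fC (row t); rewrite mulr1.
have FtE t : cint ld (F t) =
    ((2 * pi) ^+ d)%:C%C * (g (row t) * f (row t) * expi (dotv (row t) (- xi))).
  transitivity (g (row t) * expi (dotv (row t) (- xi)) * invF (fourier f) (row t)).
    rewrite -cintZ; last exact: cinteg_invF.
    by apply: eq_cint => s; rewrite /F dotvDr expiD; ring.
  by rewrite cc_inversion//; ring.
transitivity (cd%:C%C * cint ld (fun t => cint ld (F t))).
  under eq_cint do rewrite FtE.
  rewrite cintZ; last exact: (vinteg_expi (- xi) gfi).
  rewrite mulrA -rmorphM /cd mulVf ?mul1r ?gt_eqF ?twopi_gt0//.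
  by rewrite fourierE.
rewrite (cint_fubini mF (rinteg_normc ig) (rinteg_normc iff) FE).
congr (_ * _); apply: eq_cint => s; rewrite [fourier g _]fourierE opprB -cintZ.
  by apply: eq_cint => t; rewrite /F; ring.
exact: vinteg_expi.
Qed.

End CompactSupport.

(** * Weights and weighted Fourier norms *)

Section WeightFacts.
Context {R : realType} {d : nat}.
Local Notation V := 'rV[R]_d.
Local Notation mR := (measurableTypeR R).
Local Notation ld := (@lebesgue_nd R d).
Local Notation row := (@row_of_tuple R d).
Local Notation cd := (@cd R d).
Variable w : R -> R.
Hypothesis hw : weight w.

Definition om (x : V) : R := w (enorm x).

Lemma om_ge0 x : 0 <= om x.
Proof. by apply: (weight_ge0 hw); exact: enorm_ge0. Qed.

Lemma omD x y : om (x + y) <= om x + om y.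
Proof.
rewrite /om (le_trans _ (weightD hw (enorm_ge0 x) (enorm_ge0 y)))//.
by apply: (weight_homo hw); [exact: enorm_ge0|exact: enormD].
Qed.

Lemma omN x : om (- x) = om x. Proof. by rewrite /om enormN. Qed.

Lemma measurable_om : measurable_fun setT (fun t : d.-tuple mR => om (row t)).
Proof.
pose w' (x : R) := w (Num.max x 0).
have mw' : measurable_fun setT w'.
  apply: nondecreasing_measurable => //; move=> x y xy.
  rewrite /w'; apply: (weight_homo hw); first by rewrite le_max lexx orbT.
  by rewrite ge_max !le_max xy lexx orbT.
have -> : (fun t : d.-tuple mR => om (row t)) = w' \o (fun t => enorm (row t)).
  by apply/funext => t /=; rewrite /w' max_l ?enorm_ge0.
exact: (measurableT_comp mw' measurable_enorm).
Qed.

Lemma measurable_exp_om (l : R) :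
  measurable_fun setT (fun t : d.-tuple mR => expR (l * om (row t))).
Proof.
have h : measurable_fun setT (fun t : d.-tuple mR => l * om (row t)).
  by apply: measurable_funM => //; exact: measurable_om.
exact: (measurableT_comp (@measurable_expR R) h).
Qed.

Lemma weight_ge_ln (K : R) : exists2 t0, 0 < t0 &
  forall t, t0 <= t -> K * ln (1 + t) <= w t.
Proof.
have /cvgryPge/(_ K)[M [_ HM]] := weight_lim hw.
exists (`|M| + 1) => [|t tM]; first by rewrite ltr_wpDl.
have Mt : M < t by rewrite (lt_le_trans _ tM)// ltr_pwDr// ler_norm.
have t0 : 0 < t by rewrite (lt_le_trans _ tM)// ltr_wpDl.
have l0 : 0 < ln (1 + t) by rewrite ln_gt0// ltrDl.
by rewrite -ler_pdivlMr//; exact: HM.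
Qed.

(** The weight dominates every multiple of the logarithm, so its exponential
    dominates every power; the extra [2 d] powers pay for [Wt]. *)
Lemma exp_om_decay (c : R) N : 0 < c -> exists2 C, 0 <= C &
  forall x, expR (- (c * om x)) * (1 + enorm x) ^+ N <= C * Wt x.
Proof.
move=> c0; pose P := (N + 2 * d)%N.
have [t0 t00 Ht0] := weight_ge_ln (P%:R / c).
exists ((1 + t0) ^+ P) => [|x]; first by rewrite exprn_ge0// addr_ge0// ltW.
have e1 : 0 < 1 + enorm x by rewrite ltr_pwDl// enorm_ge0.
suff H : expR (- (c * om x)) * (1 + enorm x) ^+ P <= (1 + t0) ^+ P.
  rewrite -[leLHS]mulr1 (le_trans (ler_wpM2l _ (Wt_ge x)))//.
    by rewrite mulr_ge0 ?expR_ge0// exprn_ge0// ltW.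
  rewrite mulrCA mulrC ler_wpM2r ?Wt_ge0// (le_trans _ H)//.
  by rewrite mulrAC -mulrA -exprD addnC.
have [ht|ht] := leP t0 (enorm x).
  rewrite (@le_trans _ _ 1)//; last by rewrite exprn_ege1// lerDl ltW.
  have E : expR (- (c * om x)) * expR (c * om x) = 1 by rewrite -expRD addNr expR0.
  rewrite -[leRHS]E ler_wpM2l ?expR_ge0//.
  have -> : (1 + enorm x) ^+ P = expR (P%:R * ln (1 + enorm x)).
    by rewrite expRM_natl lnK ?posrE.
  rewrite ler_expR.
  by have := Ht0 _ ht; rewrite mulrAC ler_pdivrMr// (mulrC (w _)).
rewrite -[leRHS]mul1r ler_pM ?expR_ge0 ?exprn_ge0 ?(ltW e1)//.
  by rewrite -expR0 ler_expR oppr_le0 mulr_ge0 ?(ltW c0) ?om_ge0.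
by rewrite lerXn2r ?nnegrE ?(ltW e1) ?lerD2l ?ltW// addr_gt0.
Qed.

Lemma exp_om_Wt (c : R) : 0 < c -> exists2 C, 0 <= C &
  forall x, expR (- (c * om x)) <= C * Wt x.
Proof.
move=> c0; have [C C0 HC] := exp_om_decay 0 c0; exists C => // x.
by have := HC x; rewrite expr0 mulr1.
Qed.

Lemma rapid_exp_om (A : V -> R[i]) (c C : R) : vmeas A -> 0 < c ->
  (forall x, normc (A x) <= C * expR (- (c * om x))) -> rapid A.
Proof.
move=> mA c0 AC; split => // N; have [D D0 HD] := exp_om_decay N c0.
exists (`|C| * D) => x.
rewrite (le_trans (ler_wpM2r _ (AC x))) ?exprn_ge0 ?addr_ge0 ?enorm_ge0//.
rewrite -mulrA (le_trans (ler_wpM2r _ (ler_norm C)))//.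
  by rewrite mulr_ge0 ?expR_ge0// exprn_ge0// addr_ge0 ?enorm_ge0.
by rewrite -mulrA ler_wpM2l.
Qed.

(** By continuity the weight takes every nonnegative value, and arbitrarily
    large values only at large arguments: the regularisation parameter can be
    tuned so that [w e^-1] has a prescribed large value. *)
Lemma weight_inv (e0 s : R) : 0 < e0 -> w e0^-1 < s ->
  exists2 e, 0 < e < e0 & w e^-1 = s.
Proof.
move=> e00 es; have e0i : 0 < e0^-1 by rewrite invr_gt0.
have [t1 t10 Ht1] := weight_ge_ln 1.
pose T := Num.max (Num.max t1 e0^-1) (expR s).
have T1 : t1 <= T by rewrite !le_max lexx.
have Te : e0^-1 <= T by rewrite !le_max lexx orbT.
have Ts : expR s <= T by rewrite !le_max lexx orbT.
have T0 : 0 < T by exact: lt_le_trans T1.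
have sT : s <= w T.
  rewrite (le_trans _ (Ht1 _ T1))// mul1r -ler_expR lnK ?posrE ?addr_gt0//.
  by rewrite (le_trans Ts)// lerDr.
have cw : {within `[e0^-1, T], continuous w}.
  apply: continuous_subspaceW (weight_continuous hw) => x /=.
  by rewrite !in_itv/= andbT => /andP[+ _]; apply: le_trans; exact: ltW.
have hv : Num.min (w e0^-1) (w T) <= s <= Num.max (w e0^-1) (w T).
  by rewrite ge_min le_max sT orbT (ltW es).
have [c] := IVT Te cw hv.
rewrite in_itv/= => /andP[ec cT] wc.
have ec' : e0^-1 < c.
  rewrite lt_neqAle ec andbT; apply: contraTN es => /eqP ->.
  by rewrite wc ltxx.
have c0 : 0 < c by exact: lt_trans ec'.
exists c^-1; last by rewrite invrK.
by rewrite invr_gt0 c0 -(invrK e0) ltf_pV2 ?posrE.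
Qed.

Lemma unormE l f : unorm w l f = (\int[ld]_t
  (normc (fourier f (row t)) * expR (l * om (row t)))%:E)%E.
Proof. by []. Qed.

(** [un] is the real value of [unorm], meaningful under [ufin]; see [ufinP] and
    [unorm_un]. *)
Definition ufin l (f : V -> R[i]) :=
  rinteg ld (fun t => normc (fourier f (row t)) * expR (l * om (row t))).
Definition un l (f : V -> R[i]) : R :=
  \int[ld]_t (normc (fourier f (row t)) * expR (l * om (row t))).

Lemma un_ge0 l f : 0 <= un l f.
Proof. by apply: Rintegral_ge0 => t _; rewrite mulr_ge0 ?normc_ge0 ?expR_ge0. Qed.

Lemma measurable_un l f : cc f ->
  measurable_fun setT (fun t : d.-tuple mR =>
    normc (fourier f (row t)) * expR (l * om (row t))).
Proof.
move=> ccf; apply: measurable_funM; last exact: measurable_exp_om.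
exact: measurable_normc (fourier_vmeas ccf).
Qed.

Lemma ufinP l f : cc f -> ufin l f <-> (unorm w l f < +oo)%E.
Proof.
move=> ccf; split; rewrite unormE.
  by apply: rinteg_lty => t; rewrite mulr_ge0 ?normc_ge0 ?expR_ge0.
apply: rinteg_ltyP; first exact: measurable_un.
by move=> t; rewrite mulr_ge0 ?normc_ge0 ?expR_ge0.
Qed.

Lemma unorm_un l f : ufin l f -> unorm w l f = (un l f)%:E.
Proof. by move=> fl; rewrite unormE -EFin_Rintegral. Qed.

Lemma ufin_le l l' f : cc f -> l' <= l -> ufin l f -> ufin l' f.
Proof.
move=> ccf ll; apply: le_rinteg; first exact: measurable_un.
move=> t; rewrite ger0_norm ?mulr_ge0 ?normc_ge0 ?expR_ge0//.
by rewrite ler_wpM2l ?normc_ge0// ler_expR ler_wpM2r// om_ge0.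
Qed.

Lemma un_le l l' f : cc f -> l' <= l -> ufin l f -> un l' f <= un l f.
Proof.
move=> ccf ll fl; apply: le_Rintegral => //; first exact: ufin_le fl.
by move=> t _; rewrite ler_wpM2l ?normc_ge0// ler_expR ler_wpM2r// om_ge0.
Qed.

Lemma ufin_vinteg l f : cc f -> 0 <= l -> ufin l f -> vinteg (fourier f).
Proof.
move=> ccf l0; apply: le_cinteg; first exact: fourier_vmeas.
move=> t; rewrite -[leLHS]mulr1 ler_wpM2l ?normc_ge0//.
by rewrite -expR0 ler_expR mulr_ge0 ?om_ge0.
Qed.

Lemma norm1_le_un l f : cc f -> 0 <= l -> ufin l f -> norm1 (fourier f) <= un l f.
Proof.
move=> ccf l0 fl; apply: le_Rintegral => //.
  exact: rinteg_normc (ufin_vinteg ccf l0 fl).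
move=> t _; rewrite -[leLHS]mulr1 ler_wpM2l ?normc_ge0//.
by rewrite -expR0 ler_expR mulr_ge0 ?om_ge0.
Qed.

Lemma ufin_decay f (a c C : R) : cc f -> a < c ->
  (forall x, normc (fourier f x) <= C * expR (- (c * om x))) -> ufin a f.
Proof.
move=> ccf ac fC; have [D D0 HD] := exp_om_Wt (c := c - a) ltac:(by rewrite subr_gt0).
apply: (le_rinteg _ _ (rintegZ (`|C| * D) rinteg_Wt)); first exact: measurable_un.
move=> t; rewrite ger0_norm ?mulr_ge0 ?normc_ge0 ?expR_ge0//.
rewrite (le_trans (ler_wpM2r _ (fC _))) ?expR_ge0//.
rewrite -mulrA -expRD (le_trans (ler_wpM2r _ (ler_norm C))) ?expR_ge0//.
rewrite -mulrA ler_wpM2l// (le_trans _ (HD _))// ler_expR; lra.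
Qed.

(** ** Sup bounds for Fourier transforms of products *)

Section Convolution.
Variables f g : V -> R[i].
Hypotheses (ccf : cc f) (ccg : cc g).

(** Subadditivity of the weight distributes [exp (b om xi)] over the two factors
    of the convolution. *)
Lemma normc_fourierM_le b xi (h : V -> R) : vinteg (fourier f) ->
  (forall s, normc (fourier f s) * expR (b * om s) *
     (normc (fourier g (xi - s)) * expR (b * om (xi - s))) <= h s) ->
  rinteg ld (fun t => h (row t)) -> 0 <= b ->
  normc (fourier (fun x => g x * f x) xi) * expR (b * om xi) <=
  cd * \int[ld]_t h (row t).
Proof.
move=> iff fgh ih b0.
rewrite fourierM//; last exact: cc_vinteg.
rewrite ComplexField.Normc.normcM normc_real gtr0_norm ?cd_gt0// -mulrA.
rewrite ler_wpM2l ?(ltW (@cd_gt0 R d))//.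
have e0 : 0 < expR (b * om xi) by exact: expR_gt0.
rewrite -ler_pdivlMr// mulrC -RintegralZl//.
have [cfR cfI] := fourier_ccontinuous ccf.
have [cgR cgI] := fourier_ccontinuous ccg.
apply: normc_cint_le_bound; last 2 first.
- exact: rintegZ.
- move=> t; rewrite ComplexField.Normc.normcM [leRHS]mulrC ler_pdivlMr//.
  apply: le_trans (fgh _).
  rewrite [leRHS](_ : _ = normc (fourier f (row t)) *
    (normc (fourier g (xi - row t)) *
     expR (b * om (row t) + b * om (xi - row t)))); last by rewrite expRD; ring.
  rewrite [leLHS](_ : _ = normc (fourier f (row t)) *
    (normc (fourier g (xi - row t)) * expR (b * om xi))); last by ring.
  rewrite ler_wpM2l ?normc_ge0// ler_wpM2l ?normc_ge0// ler_expR -mulrDr.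
  by rewrite ler_wpM2l// -{1}(subrK (row t) xi) addrC omD.
apply: cmeasM; first exact: fourier_vmeas.
have c : continuous (fun s : V => xi - s).
  by move=> s; exact: (cvgB (cvg_cst xi) (@cvg_id _ (nbhs s))).
apply: (@ccontinuous_cmeas _ _ (fun s => fourier g (xi - s))); split => s.
- exact: (cvg_comp _ _ (c s) (cgR _)).
- exact: (cvg_comp _ _ (c s) (cgI _)).
Qed.

Lemma fourierM_sup_un b S : ufin b f -> 0 <= b ->
  (forall s, normc (fourier g s) * expR (b * om s) <= S) ->
  forall xi, normc (fourier (fun x => g x * f x) xi) * expR (b * om xi) <=
    cd * S * un b f.
Proof.
move=> fb b0 gS xi; rewrite -mulrA /un -RintegralZl//.
apply: (normc_fourierM_le (h := fun s => S * (normc (fourier f s) * expR (b * om s)))).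
- exact: ufin_vinteg fb.
- by move=> s; rewrite mulrC ler_wpM2r// mulr_ge0 ?normc_ge0 ?expR_ge0.
- exact: rintegZ.
- by [].
Qed.

Lemma mul_le_weighted_squares (x y A B p q : R) : 0 <= x -> 0 <= y ->
  x <= A -> y <= B -> x * p * (y * q) <= A * (x * p ^+ 2) + B * (y * q ^+ 2).
Proof.
move=> x0 y0 xA yB.
apply: (@le_trans _ _ ((x * p) ^+ 2 + (y * q) ^+ 2)).
  have := sqr_ge0 (x * p - y * q); have := sqr_ge0 (x * p); have := sqr_ge0 (y * q).
  by rewrite sqrrB; move: (x * p) (y * q) => *; lra.
by rewrite !exprMn (mulrA A) (mulrA B); apply: lerD; rewrite ler_wpM2r ?sqr_ge0// expr2 ler_wpM2r.
Qed.

(** Both transforms are bounded, and integrable with the factor [exp (a om)];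
    hence they are square integrable with the factor [exp (a/2 om)], and their
    convolution is bounded. *)
Lemma fourierM_sup a : 0 < a -> ufin a f -> ufin a g -> exists S, forall xi,
  normc (fourier (fun x => g x * f x) xi) * expR (a / 2 * om xi) <= S.
Proof.
move=> a0 fa ga.
pose u (f : V -> R[i]) s := normc (fourier f s) * expR (a * om s).
have u0 h s : 0 <= u h s by rewrite mulr_ge0 ?normc_ge0 ?expR_ge0.
exists (cd * (norm1 f * un a f + norm1 g * un a g)) => xi.
have m1 : (-1 : R) != 0 by rewrite oppr_eq0 oner_eq0.
pose ug := fun t : d.-tuple mR => u g (row t).
have rE t : row (affine_tuple (fun i => xi 0 i) (-1) t) = xi - row t.
  by rewrite row_affine scaleN1r; apply/rowP => i; rewrite !mxE.
have reflE : (fun t => ug (affine_tuple (fun i => xi 0 i) (-1) t)) =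
    fun t => u g (xi - row t).
  by apply/funext => t; rewrite /ug rE.
have igs : rinteg ld (fun t => u g (xi - row t)).
  by rewrite -reflE; exact: rinteg_affine_tuple.
have Igs : \int[ld]_t u g (xi - row t) = un a g.
  rewrite -[LHS]/(Rintegral ld setT (fun t => u g (xi - row t))) -reflE.
  rewrite /un [RHS](@Rintegral_affine_tuple _ _ (fun i => xi 0 i) (-1) ug)//.
  by rewrite normrN1 expr1n mul1r.
have i1 : rinteg ld (fun t => norm1 f * u f (row t)) by exact: rintegZ.
have i2 : rinteg ld (fun t => norm1 g * u g (xi - row t)) by exact: rintegZ.
have -> : norm1 f * un a f + norm1 g * un a g =
    \int[ld]_t (norm1 f * u f (row t) + norm1 g * u g (xi - row t)).
  apply/esym; etransitivity; first exact: (RintegralD measurableT i1 i2).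
  congr (_ + _); first exact: (RintegralZl _ measurableT fa).
  by rewrite -Igs; exact: (RintegralZl _ measurableT igs).
apply: (@normc_fourierM_le (a / 2) xi
  (fun s => norm1 f * u f s + norm1 g * u g (xi - s))).
- exact: (ufin_vinteg ccf (ltW a0) fa).
- move=> s; rewrite /u.
  have ee x : expR (a * om x) = expR (a / 2 * om x) ^+ 2.
    by rewrite -expRM_natl; congr expR; field.
  rewrite !ee.
  have fb := normc_fourier_le s (cc_vinteg ccf).
  have gb := normc_fourier_le (xi - s) (cc_vinteg ccg).
  by apply: mul_le_weighted_squares; rewrite ?normc_ge0.
- exact: (rintegD i1 i2).
- exact: (divr_ge0 (ltW a0) (ler0n R 2)).
Qed.

End Convolution.

End WeightFacts.

(** * A uniform boundedness principle *)

Section GlidingHump.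
Context {R : realType} {I : Type}.

Lemma exists_near_max (f : I -> R) i0 B : 0 < f i0 -> (forall i, f i <= B) ->
  exists2 i, 3 / 4 * f i0 <= f i & forall i', f i' <= 4 / 3 * f i.
Proof.
move=> f0 fB; pose E := range f.
have hE : has_sup E by split; [exists (f i0), i0|exists B => _ [i _ <-]].
have sE i : f i <= sup E by apply: sup_upper_bound => //; exists i.
have s0 : 0 < sup E by rewrite (lt_le_trans f0).
have /(sup_gt hE.1) [_ [i _ <-] hi] : 3 / 4 * sup E < sup E by lra.
exists i => [|i']; first by have := sE i0; lra.
by have := sE i'; lra.
Qed.

Variables (a : R -> I -> R[i]) (phi : R -> R) (P : R -> Prop).
Hypothesis phi0 : forall e, P e -> 0 <= phi e.
Hypothesis bounded : forall e, P e -> exists B, forall i, normc (a e i) <= B.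
Hypothesis summed : forall (i : nat -> I) (s : nat -> R),
  (forall j, `|s j| <= 3^-1 ^+ j) ->
  exists (S : R -> R[i]) (l : R), [/\ 0 < l,
    forall e, P e -> exists B, forall n,
      normc (S e - \sum_(j < n) (s j)%:C%C * a e (i j)) <= B * 3^-1 ^+ n &
    exists2 dl, 0 < dl & forall e, P e -> e < dl ->
      normc (S e) <= expR (- (l * phi e))].

(** The uniform boundedness principle by a gliding hump. Were the bound to
    fail for each constant [4 3^j], at a parameter [e j] and for a nearly
    extremal index [i j], then the signs of [+- 3^-j] could be chosen one after
    the other so that, at [e j], the terms up to [j] of the series are at least
    as large as its [j]-th term, while the later terms recover at most two
    thirds of it. *)
Lemma gliding_hump : exists2 K, 0 < K & forall e, P e -> e < K^-1 ->
  forall i, normc (a e i) <= K * expR (- (phi e / K)).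
Proof.
apply: contrapT => /forall2NP noK.
pose K j : R := 4 * 3 ^+ j.
have K0 j : 0 < K j by rewrite mulr_gt0// exprn_gt0.
have /choice [ei Hei] : forall j, exists ei : R * I, [/\ P ei.1, ei.1 < (K j)^-1,
    3 / 4 * (K j * expR (- (phi ei.1 / K j))) < normc (a ei.1 ei.2) &
    forall i', normc (a ei.1 i') <= 4 / 3 * normc (a ei.1 ei.2)].
  move=> j; have [/(_ (K0 j))//|] := noK (K j).
  move=> /existsNP [e /not_implyP [Pe /not_implyP [eK /existsNP [i /negP]]]].
  rewrite -ltNge => ai; have [B aB] := bounded Pe.
  have ai0 : 0 < normc (a e i).
    by rewrite (lt_trans _ ai)// mulr_gt0 ?expR_gt0.
  have [i1 h1 h2] := exists_near_max ai0 aB.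
  by exists (e, i1); split => //=; move: ai h1; lra.
pose e j := (ei j).1; pose i j := (ei j).2.
pose part (l : seq R) n e := \sum_(k < n) (l`_k)%:C%C * a e (i k).
pose sg j (l : seq R) : R :=
  if 3^-1 ^+ j * normc (a (e j) (i j)) <=
     normc (part l j (e j) + (3^-1 ^+ j)%:C%C * a (e j) (i j))
  then 3^-1 ^+ j else - (3^-1 ^+ j).
(* the first [n] signed coefficients; each sign is chosen from the previous ones *)
pose st := fix st n := if n is m.+1 then rcons (st m) (sg m (st m)) else [::].
have size_st n : size (st n) = n by elim: n => //= n IH; rewrite size_rcons IH.
pose s j := (st j.+1)`_j.
have sE j : s j = sg j (st j) by rewrite /s /= nth_rcons size_st ltnn eqxx.
have nth_st n k : (k < n)%N -> (st n)`_k = s k.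
  elim: n => // n IH; rewrite ltnS leq_eqVlt => /predU1P[->//|kn].
  by rewrite /= nth_rcons size_st kn IH.
have h3 j : 0 < 3^-1 ^+ j :> R by rewrite exprn_gt0// invr_gt0.
have s_norm j : `|s j| = 3^-1 ^+ j.
  by rewrite sE /sg; case: ifP; rewrite ?normrN gtr0_norm.
pose sum n e := \sum_(k < n) (s k)%:C%C * a e (i k).
have hump j : 3^-1 ^+ j * normc (a (e j) (i j)) <= normc (sum j.+1 (e j)).
  have sumj : part (st j) j (e j) = sum j (e j).
    by apply: eq_bigr => k _; rewrite nth_st.
  rewrite /sum big_ord_recr/= -/(sum j (e j)) sE /sg -sumj.
  set q := part _ _ _; set z := a (e j) (i j).
  case: ifPn => //; rewrite -ltNge => h.
  have zz : (3^-1 ^+ j + 3^-1 ^+ j) * normc z <=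
      normc (q + (3^-1 ^+ j)%:C%C * z) + normc (q + (- (3^-1 ^+ j))%:C%C * z).
    rewrite (le_trans _ (normcB _ _))// rmorphN/=.
    rewrite (_ : _ - _ = (3^-1 ^+ j + 3^-1 ^+ j)%:C%C * z).
      by rewrite ComplexField.Normc.normcM normc_real ger0_norm// addr_ge0// ltW.
    by rewrite rmorphD/=; ring.
  by move: h zz; rewrite mulrDl; lra.
have [S [l [l0 SB [dl dl0 Sl]]]] := summed i (s := s) ltac:(by move=> j; rewrite s_norm).
have large j : expR (- (phi (e j) / K j)) < normc (S (e j)).
  have [Pe _ am aM] := Hei j; have [B HB] := SB _ Pe.
  rewrite -/(e j) -/(i j) in Pe am aM HB.
  set m := normc (a (e j) (i j)) in am aM *.
  have m0 : 0 <= m by exact: normc_ge0.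
  (* as [i j] is nearly extremal at [e j], the values of [a (e j)] at the later
     indices are at most [4 / 3 m] *)
  have tail n : normc (sum (j.+1 + n)%N (e j) - sum j.+1 (e j)) <=
      2 / 3 * m * (3^-1 ^+ j - 3^-1 ^+ (j + n)).
    elim: n => [|n IH]; first by rewrite !addn0 !subrr mulr0 ComplexField.Normc.normc0.
    rewrite addnS {1}/sum big_ord_recr/= -/(sum (j.+1 + n)%N (e j)).
    rewrite addrAC (le_trans (normcD _ _))//.
    rewrite ComplexField.Normc.normcM normc_real s_norm.
    have := ler_wpM2l (ltW (h3 (j.+1 + n)%N)) (aM (i (j.+1 + n)%N)).
    have -> : 3^-1 ^+ (j.+1 + n) = 3^-1 * 3^-1 ^+ (j + n) :> R by rewrite addSn exprS.
    have -> : 3^-1 ^+ (j + n.+1) = 3^-1 * 3^-1 ^+ (j + n) :> R by rewrite addnS exprS.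
    move: IH; set X := normc (_ - _); set Y := normc (a _ _).
    set u := 3^-1 ^+ (j + n); set v := 3^-1 ^+ j.
    have -> : 3^-1 * u * (4 / 3 * m) = 4 / 9 * (m * u) by field.
    have -> : 2 / 3 * m * (v - u) = 2 / 3 * (m * v) - 2 / 3 * (m * u) by ring.
    have -> : 2 / 3 * m * (v - 3^-1 * u) = 2 / 3 * (m * v) - 2 / 9 * (m * u) by field.
    by lra.
  have rest : normc (S (e j) - sum j.+1 (e j)) <= 2 / 3 * m * 3^-1 ^+ j.
    apply/ler_addgt0Pr => eta eta0.
    have [n Hn] : exists n, `|B| * 3^-1 ^+ n <= eta.
      have c : `|B| * 3^-1 ^+ n @[n --> \oo] --> (0 : R).
        rewrite -(mulr0 `|B|); apply: (cvgM (cvg_cst `|B|)).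
        by apply: cvg_expr; rewrite gtr0_norm ?invr_gt0// invf_lt1// ltr1n.
      have /cvgrPdist_le/(_ _ eta0)[N _ HN] := c.
      exists N; have := HN N (leqnn N); rewrite sub0r normrN.
      by apply: le_trans; exact: ler_norm.
    have h1 := HB (j.+1 + n)%N; have h2 := tail n.
    rewrite -(subrK (sum (j.+1 + n)%N (e j)) (S (e j))) -addrA.
    apply: (le_trans (normcD _ _)); rewrite [leRHS]addrC; apply: lerD; last first.
      by rewrite (le_trans h2)// ler_wpM2l ?mulr_ge0// lerBlDr lerDl ltW.
    rewrite (le_trans h1)// (le_trans (ler_wpM2r (ltW (h3 _)) (ler_norm B)))//.
    rewrite (le_trans _ Hn)// ler_wpM2l// addnC exprD ler_piMr ?(ltW (h3 _))//.
    by rewrite exprn_ile1 ?invr_ge0// invf_le1// ler1n.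
  have S1 : 3^-1 ^+ j * m <= normc (S (e j)) + normc (S (e j) - sum j.+1 (e j)).
    rewrite (le_trans (hump j))//.
    by rewrite -[X in normc X <= _](subKr (S (e j))) normcB.
  have : expR (- (phi (e j) / K j)) < 3^-1 * (3^-1 ^+ j * m).
    have -> : expR (- (phi (e j) / K j)) =
      3^-1 * (3^-1 ^+ j * (3 / 4 * (K j * expR (- (phi (e j) / K j))))).
      rewrite /K exprVn; have : 3 ^+ j != 0 :> R by rewrite gt_eqF// exprn_gt0.
      by move=> h; field.
    by rewrite ltr_pM2l ?invr_gt0// ltr_pM2l.
  move: S1 rest; rewrite -mulrA [m * _]mulrC; set X := 3^-1 ^+ j * m; lra.
have [j Hj] : exists j, Num.max dl^-1 l^-1 <= K j.
  have [n Hn] : exists n : nat, Num.max dl^-1 l^-1 <= n%:R.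
    exists (Num.truncn (Num.max dl^-1 l^-1)).+1.
    by rewrite ltW// truncnS_gt.
  exists n; rewrite (le_trans Hn)// /K (@le_trans _ _ (3 ^+ n))//.
    by rewrite -natrX ler_nat ltnW// ltn_expl.
  by rewrite ler_peMl ?exprn_ge0// ler1n.
move: Hj; rewrite ge_max => /andP[Hd Hl].
have [Pe eK _ _] := Hei j; rewrite -/(e j) in Pe eK.
have ed : e j < dl.
  rewrite (lt_le_trans eK)// -(invrK dl) lef_pV2 ?posrE ?invr_gt0//.
have := lt_le_trans (large j) (Sl _ Pe ed).
rewrite ltr_expR ltrN2 mulrC -subr_gt0 -mulrBr; apply/negP; rewrite -leNgt.
rewrite mulr_ge0_le0 ?phi0// subr_le0 -(invrK l) lef_pV2 ?posrE ?invr_gt0//.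
Qed.

End GlidingHump.

(** * Modulation, linearity and limits in the weighted norms *)

Section UnormCalculus.
Context {R : realType} {d : nat}.
Local Notation V := 'rV[R]_d.
Local Notation mR := (measurableTypeR R).
Local Notation ld := (@lebesgue_nd R d).
Local Notation row := (@row_of_tuple R d).
Variable w : R -> R.
Hypothesis hw : weight w.
Local Notation om := (@om R d w).
Local Notation un := (@un R d w).
Local Notation ufin := (@ufin R d w).

Definition modulate (chi : V -> R[i]) (xi x : V) : R[i] := chi x * expi (dotv x xi).

Lemma modulate_cc chi xi : cc chi -> cc (modulate chi xi).
Proof. by move=> cch; apply: cc_mul => //; exact: ccontinuous_expi. Qed.

Lemma fourier_modulate chi xi eta :
  fourier (modulate chi xi) eta = fourier chi (eta - xi).
Proof.
rewrite !fourierE; apply: eq_cint => t.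
by rewrite /modulate -mulrA -expiD -dotvDr opprB.
Qed.

Lemma exp_om_shift l x y : 0 <= l ->
  expR (l * om x) <= expR (l * om y) * expR (l * om (x - y)).
Proof.
move=> l0; rewrite -expRD ler_expR -mulrDr ler_wpM2l// addrC.
by have := omD hw (x - y) y; rewrite subrK.
Qed.

(** Modulation translates the transform, and by subadditivity of the weight a
    translation by [xi] costs a factor [exp (l om xi)]. *)
Lemma ufin_modulate l chi xi : 0 <= l -> cc chi -> ufin l chi ->
  ufin l (modulate chi xi) /\
  un l (modulate chi xi) <= expR (l * om xi) * un l chi.
Proof.
move=> l0 cch fl.
pose u := fun t : d.-tuple mR => normc (fourier chi (row t)) * expR (l * om (row t)).
pose v := fun t : d.-tuple mR => u (affine_tuple (fun i => - xi 0 i) 1 t).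
have rE t : row (affine_tuple (fun i => - xi 0 i) 1 t) = row t - xi.
  by rewrite row_affine scale1r addrC; apply/rowP => i; rewrite !mxE.
have vE t : v t = normc (fourier chi (row t - xi)) * expR (l * om (row t - xi)).
  by rewrite /v /u rE.
have n1 : (1 : R) != 0 by exact: oner_neq0.
have iv : rinteg ld v by exact: (rinteg_affine_tuple (fun i => - xi 0 i) n1 fl).
have Iv : \int[ld]_t v t = un l chi.
  have := Rintegral_affine_tuple (fun i => - xi 0 i) n1 (fl : rinteg ld u).
  by rewrite normr1 expr1n mul1r => /esym.
have le t : normc (fourier (modulate chi xi) (row t)) * expR (l * om (row t)) <=
    expR (l * om xi) * v t.
  rewrite fourier_modulate vE mulrCA; apply: ler_wpM2l; first exact: normc_ge0.
  exact: exp_om_shift.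
have ivx : rinteg ld (fun t => expR (l * om xi) * v t) by exact: rintegZ.
have fm : ufin l (modulate chi xi).
  have mm := measurable_un hw l (modulate_cc xi cch).
  apply: (le_rinteg mm _ ivx) => t.
  rewrite ger0_norm; first exact: le.
  by rewrite mulr_ge0 ?normc_ge0 ?expR_ge0.
split; first exact: fm.
rewrite -Iv -(RintegralZl _ measurableT iv).
exact: (le_Rintegral measurableT fm ivx (fun t _ => le t)).
Qed.

Lemma fourierD (f g : V -> R[i]) xi : vinteg f -> vinteg g ->
  fourier (fun x => f x + g x) xi = fourier f xi + fourier g xi.
Proof.
move=> fi gi; rewrite !fourierE -cintD; [|exact: vinteg_expi..].
by apply: eq_cint => t; rewrite mulrDl.
Qed.

Lemma fourierZ c (f : V -> R[i]) xi : vinteg f ->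
  fourier (fun x => c * f x) xi = c * fourier f xi.
Proof.
move=> fi; rewrite !fourierE -cintZ; last exact: vinteg_expi.
by apply: eq_cint => t; rewrite mulrA.
Qed.

Lemma ccD (f g : V -> R[i]) : cc f -> cc g -> cc (fun x => f x + g x).
Proof.
move=> [cf sf] [cg sg]; split; first exact: ccontinuousD.
have cU : compact (tsupport f `|` tsupport g).
  exact: compactU.
apply: (subclosed_compact (@closed_closure _ _) cU) => x.
rewrite /tsupport -closureU; apply: closure_subset => y /= fg.
have [fy|fy] := eqVneq (f y) 0; last by left.
by right => /=; move: fg; rewrite fy add0r.
Qed.

Lemma ccZ c (f : V -> R[i]) : cc f -> cc (fun x => c * f x).
Proof.
move=> cf; under eq_fun do rewrite mulrC.
by apply: cc_mul => //; exact: ccontinuous_cst.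
Qed.

Lemma unD l (f g : V -> R[i]) : cc f -> cc g -> ufin l f -> ufin l g ->
  ufin l (fun x => f x + g x) /\ un l (fun x => f x + g x) <= un l f + un l g.
Proof.
move=> cf cg fl gl.
have le t : normc (fourier (fun x => f x + g x) (row t)) * expR (l * om (row t)) <=
    normc (fourier f (row t)) * expR (l * om (row t)) +
    normc (fourier g (row t)) * expR (l * om (row t)).
  rewrite -mulrDl ler_wpM2r ?expR_ge0// fourierD; [|exact: cc_vinteg..].
  exact: normcD.
have ifg := rintegD fl gl.
have fm : ufin l (fun x => f x + g x).
  have mm := measurable_un hw l (ccD cf cg).
  apply: (le_rinteg mm _ ifg) => t.
  rewrite ger0_norm; first exact: le.
  by rewrite mulr_ge0 ?normc_ge0 ?expR_ge0.
split; first exact: fm.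
rewrite /un -(RintegralD measurableT fl gl).
exact: (le_Rintegral measurableT fm ifg (fun t _ => le t)).
Qed.

Lemma unZ l c (f : V -> R[i]) : cc f -> ufin l f ->
  ufin l (fun x => c * f x) /\ un l (fun x => c * f x) = normc c * un l f.
Proof.
move=> cf fl.
have E : (fun t : d.-tuple mR =>
    normc (fourier (fun x => c * f x) (row t)) * expR (l * om (row t))) =
  fun t => normc c * (normc (fourier f (row t)) * expR (l * om (row t))).
  apply/funext => t; rewrite fourierZ; last exact: cc_vinteg.
  by rewrite ComplexField.Normc.normcM mulrA.
rewrite /ufin /un -(RintegralZl _ measurableT fl) E; split => //.
exact: rintegZ.
Qed.

(** Lower semicontinuity of the weighted norms, by Fatou's lemma: this is the
    form in which the spaces of test functions are complete. *)
Lemma un_fatou l (f_ : nat -> V -> R[i]) (f : V -> R[i]) C :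
  (forall n, cc (f_ n)) -> cc f -> (forall n, ufin l (f_ n)) ->
  (forall n, un l (f_ n) <= C) ->
  (forall xi, ccvg (fun n => fourier (f_ n) xi) (fourier f xi)) ->
  ufin l f /\ un l f <= C.
Proof.
move=> cf_ cf fl unC cv.
pose h n (t : d.-tuple mR) :=
  (normc (fourier (f_ n) (row t)) * expR (l * om (row t)))%:E.
have mh n : measurable_fun setT (h n).
  by apply/measurable_EFinP; exact: measurable_un.
have h0 n t : (0 <= h n t)%E by rewrite lee_fin mulr_ge0 ?normc_ge0 ?expR_ge0.
have hl t : limn_einf (h^~ t) =
    (normc (fourier f (row t)) * expR (l * om (row t)))%:E.
  have hc : h n t @[n --> \oo] -->
      (normc (fourier f (row t)) * expR (l * om (row t)))%:E.
    apply: cvg_EFin; first exact: nearW.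
    exact: (cvgM (ccvg_normc (cv (row t))) (cvg_cst _)).
  by rewrite is_cvg_limn_einfE; [exact/cvg_lim|apply/cvg_ex; eexists; exact: hc].
have bound : (unorm w l f <= C%:E)%E.
  rewrite unormE; under eq_integral do rewrite -hl.
  apply: (le_trans (fatou ld measurableT mh (fun n t _ => h0 n t))).
  rewrite limn_einf_lim; apply: lime_le; first exact: is_cvg_einfs.
  apply: nearW => n; apply: ge_ereal_inf.
  exists (\int[ld]_t h n t)%E; first by exists n => /=.
  rewrite -[leLHS]/(unorm w l (f_ n)) (unorm_un (fl n)).
  by rewrite lee_fin; exact: unC.
have fm : ufin l f by apply/ufinP => //; exact: le_lt_trans bound (ltry _).
by split => //; rewrite -lee_fin -unorm_un.
Qed.

End UnormCalculus.

(** * Test functions and association *)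

Section TestFunctions.
Context {R : realType} {d : nat}.
Local Notation V := 'rV[R]_d.
Local Notation ld := (@lebesgue_nd R d).
Local Notation row := (@row_of_tuple R d).
Local Notation cd := (@cd R d).
Variables (w : R -> R) (Om : set V).
Hypothesis hw : weight w.
Local Notation un := (@un R d w).
Local Notation ufin := (@ufin R d w).
Local Notation test := (test_functions w Om).

Lemma test_cc f : test f -> cc f.
Proof. by move=> [cf sf _ _]. Qed.

Lemma test_sub f : test f -> tsupport f `<=` Om.
Proof. by move=> [_ _ sf _]. Qed.

Lemma test_ufin f : test f -> exists2 l, 0 < l & ufin l f.
Proof.
move=> tf; have cf := test_cc tf; have [_ _ _ [l l0 fl]] := tf.
by exists l => //; apply/ufinP.
Qed.

Lemma testP f l : cc f -> tsupport f `<=` Om -> 0 < l -> ufin l f -> test f.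
Proof. by move=> cf sf l0 fl; case: (cf) => c s; split => //; exists l => //; exact/ufinP. Qed.

Lemma near0P (P : R -> Prop) : (\forall e \near 0^'+, P e) ->
  exists2 dl, 0 < dl & forall e, 0 < e -> e < dl -> P e.
Proof.
move=> [dl /= dl0 H]; exists dl => // e e0 ed; apply: H => //=.
by rewrite sub0r normrN gtr0_norm.
Qed.

Lemma ultradiff_test f chi : ultradiff w Om f -> test chi ->
  test (fun x => chi x * f x).
Proof. by move=> [_ H] /H. Qed.

Lemma unormK_lt K h f (c : R) : ultradiff w Om f ->
  (unormK w Om K h f < c%:E)%E -> exists2 psi, test psi &
    [/\ forall x, K x -> psi x = 1, ufin h (fun x => psi x * f x) &
      un h (fun x => psi x * f x) < c].
Proof.
move=> uf /ereal_inf_lt [_ [psi [tpsi psi1] <-] psic].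
have fin : ufin h (fun x => psi x * f x).
  apply/ufinP => //; first exact/test_cc/ultradiff_test.
  exact: lt_trans psic (ltry _).
by exists psi => //; split => //; rewrite -lte_fin -unorm_un.
Qed.

Lemma little_oP (N : R -> \bar R) k (c : R) : 0 < c -> little_o_exp w N k ->
  exists2 dl, 0 < dl & forall e, 0 < e -> e < dl ->
    (`|N e| <= (c * expR (k * w e^-1))%:E)%E.
Proof. by move=> c0 /(_ c c0) /near0P. Qed.

Lemma pairingE (f phi : V -> R[i]) : pairing f phi = fourier (fun x => phi x * f x) 0.
Proof.
rewrite fourierE; apply: eq_cint => t.
by rewrite oppr0 dotv0r expi0 mulr1 mulrC.
Qed.

(** Insert a cutoff equal to one on the support of [phi], and bound the cut-off
    function uniformly by its Fourier transform. *)
Lemma normc_pairing_le f phi h c : ultradiff w Om f -> test phi -> 0 <= h ->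
  (unormK w Om (tsupport phi) h f < c%:E)%E ->
  normc (pairing f phi) <= cd * c * norm1 phi.
Proof.
move=> uf tphi h0 /(unormK_lt uf) [psi tpsi [psi1 fin lt]].
have cpf := test_cc (ultradiff_test uf tpsi).
have cphi := test_cc tphi.
have bound x : normc (psi x * f x) <= cd * c.
  rewrite (le_trans (normc_le_fourier x cpf (ufin_vinteg hw cpf h0 fin)))//.
  rewrite ler_wpM2l ?(ltW (@cd_gt0 R d))// (le_trans (norm1_le_un hw cpf h0 fin))//.
  exact: ltW.
have E x : phi x * f x = (psi x * f x) * phi x.
  have [xs|/tsupport_eq0 ->] := pselect (tsupport phi x); last by rewrite mul0r mulr0.
  by rewrite psi1// mul1r mulrC.
have iphi := cc_vinteg cphi.
have in1 : rinteg ld (fun t => normc (phi (row t))) by exact: rinteg_normc.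
rewrite pairingE fourierE /norm1 -(RintegralZl _ measurableT in1).
apply: normc_cint_le_bound.
- apply: cmeasM; last exact: vmeas_expi.
  by have [cc1 _] := test_cc (ultradiff_test uf tphi); exact: (ccontinuous_cmeas cc1).
- exact: rintegZ.
- move=> t; rewrite normc_mul_expi E ComplexField.Normc.normcM.
  by rewrite ler_wpM2r ?normc_ge0.
Qed.

Lemma negligible_pairing (n : @net R d) phi : negligible_net w Om n -> test phi ->
  exists2 k, 0 < k & forall c, 0 < c -> exists2 dl, 0 < dl &
    forall e, 0 < e < 1 -> e < dl ->
    normc (pairing (n e) phi) <= c * expR (- (k * w e^-1)).
Proof.
move=> [un_ neg] tphi; have [_ sphi] := test_cc tphi.
have [k [h [k0 h0 lo]]] := neg _ sphi (test_sub tphi).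
exists k => // c c0.
pose D := 2 * cd * (norm1 phi + 1).
have D0 : 0 < D.
  by rewrite !mulr_gt0 ?(@cd_gt0 R d)// ltr_wpDl ?norm1_ge0.
have [dl dl0 H] := little_oP (divr_gt0 c0 D0) lo.
exists dl => // e e01 ed; have /andP[e0 _] := e01.
have He := H e e0 ed.
set X := c / D * expR (- k * w e^-1) in He.
have X0 : 0 < X by rewrite mulr_gt0 ?expR_gt0 ?divr_gt0.
have lt : (unormK w Om (tsupport phi) h (n e) < (2 * X)%:E)%E.
  rewrite (le_lt_trans (lee_abs _))// (le_lt_trans He)// lte_fin; lra.
rewrite (le_trans (normc_pairing_le (un_ e e01) tphi (ltW h0) lt))//.
rewrite -mulNr -/X.
have -> : c * expR (- k * w e^-1) = D * X.
  by rewrite /X mulrA mulrCA divff ?mulr1// gt_eqF.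
rewrite /D (_ : cd * (2 * X) * norm1 phi = 2 * cd * X * norm1 phi); last by ring.
rewrite (_ : 2 * cd * (norm1 phi + 1) * X = 2 * cd * X * (norm1 phi + 1)); last by ring.
apply: ler_wpM2l; last by rewrite lerDl.
exact: (mulr_ge0 (mulr_ge0 (ler0n R 2) (ltW (@cd_gt0 R d))) (ltW X0)).
Qed.

Lemma pairingB f g phi : ultradiff w Om f -> ultradiff w Om g -> test phi ->
  pairing (fun x => f x - g x) phi = pairing f phi - pairing g phi.
Proof.
move=> uf ug tphi.
have i1 := cc_vinteg (test_cc (ultradiff_test uf tphi)).
have i2 := cc_vinteg (test_cc (ultradiff_test ug tphi)).
rewrite !pairingE !fourierE -cintB; [|exact: (vinteg_expi (- 0) i1)|exact: (vinteg_expi (- 0) i2)].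
by apply: eq_cint => t; ring.
Qed.

(** Two representatives differ by a negligible net, whose pairings with a test
    function are exponentially small. *)
Lemma associated_representative (T : (V -> R[i]) -> R[i]) X g :
  gen_functions w Om X -> X g -> strictly_associated w Om T X ->
  forall phi, test phi -> exists l dl, [/\ 0 < l, 0 < dl &
    forall e, 0 < e < 1 -> e < dl ->
    normc (pairing (g e) phi - T phi) <= expR (- (l * w e^-1))].
Proof.
move=> [g0 [ug0 _] <-] [[ug _] ng] [g1 [[ug1 _] n1] as1] phi tphi.
have [l1 l10 lo1] := as1 phi tphi.
have [k k0 Hk] := negligible_pairing ng tphi.
have [k1 k10 Hk1] := negligible_pairing n1 tphi.
have c0 : 0 < 3^-1 :> R by rewrite invr_gt0.
have [d1 d10 H1] := little_oP c0 lo1.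
have [d2 d20 H2] := Hk _ c0.
have [d3 d30 H3] := Hk1 _ c0.
exists (Num.min l1 (Num.min k k1)), (Num.min d1 (Num.min d2 d3)).
rewrite !lt_min l10 k0 k10 d10 d20 d30; split => // e e01.
rewrite !lt_min => /andP[ed1 /andP[ed2 ed3]]; have /andP[e0 _] := e01.
set l := Num.min _ _; set y := w e^-1.
have y0 : 0 <= y by apply: (weight_ge0 hw); rewrite invr_ge0 ltW.
have step m : l <= m -> 3^-1 * expR (- (m * y)) <= 3^-1 * expR (- (l * y)).
  by move=> lm; rewrite ler_wpM2l ?(ltW c0)// ler_expR lerN2 ler_wpM2r.
have := H2 e e01 ed2; have := H3 e e01 ed3; have := H1 e e0 ed1.
rewrite gee0_abs ?lee_fin ?normc_ge0// mulNr.
rewrite (pairingB (ug e e01) (ug0 e e01) tphi).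
rewrite (pairingB (ug1 e e01) (ug0 e e01) tphi).
have s1 : l <= l1 by rewrite /l ge_min lexx.
have s2 : l <= k by rewrite /l !ge_min lexx orbT.
have s3 : l <= k1 by rewrite /l !ge_min lexx !orbT.
have := step _ s1; have := step _ s2; have := step _ s3; rewrite -/y.
set a := pairing (g e) phi; set b := pairing (g0 e) phi; set c := pairing (g1 e) phi.
have tri : normc (a - T phi) <= normc (a - b) + normc (c - b) + normc (c - T phi).
  rewrite (_ : a - T phi = (a - b) - (c - b) + (c - T phi)); last by ring.
  by rewrite (le_trans (normcD _ _))// lerD// normcB.
move=> q1 q2 q3 p1 p2 p3.
move: tri q1 q2 q3 p1 p2 p3; set E := expR (- (l * y)); lra.
Qed.

End TestFunctions.

(** * Series of modulated test functions *)

Section GeometricSeries.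
Context {R : realType} {d : nat}.
Local Notation V := 'rV[R]_d.

Lemma cvg_geometric3 (B : R) : B * 3^-1 ^+ n @[n --> \oo] --> (0 : R).
Proof.
rewrite -(mulr0 B); apply: (cvgM (cvg_cst B)).
by apply: cvg_expr; rewrite gtr0_norm ?invr_gt0// invf_lt1// ltr1n.
Qed.

Lemma geometric_rsum (u : nat -> R) : (forall j, `|u j| <= 3^-1 ^+ j) ->
  exists S, forall n, `|S - \sum_(j < n) u j| <= 3 / 2 * 3^-1 ^+ n.
Proof.
move=> ub; pose p n := \sum_(j < n) u j.
have diff n k : `|p (n + k)%N - p n| <= 3 / 2 * (3^-1 ^+ n - 3^-1 ^+ (n + k)).
  elim: k => [|k IH]; first by rewrite addn0 !subrr normr0 mulr0.
  rewrite addnS {1}/p big_ord_recr/= -/(p (n + k)%N) addrAC.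
  rewrite (le_trans (ler_normD _ _))// exprS.
  have := ub (n + k)%N; move: IH; set x := `|_|; set y := `|u _|; set v := 3^-1 ^+ (n + k).
  set q := 3^-1 ^+ n; lra.
have h3 n : 0 <= 3^-1 ^+ n :> R by rewrite exprn_ge0// invr_ge0.
have pE : p = series u by apply/funext => n; rewrite /series/= big_mkord.
have cp : cvgn p.
  rewrite pE; apply: normed_cvg.
  apply: (@series_le_cvg _ _ (geometric 1 3^-1)) => [n|n|n|].
  - exact: normr_ge0.
  - by rewrite /geometric/= mul1r.
  - by rewrite /geometric/= mul1r; exact: ub.
  - by apply: is_cvg_geometric_series; rewrite gtr0_norm ?invr_gt0// invf_lt1// ltr1n.
exists (limn p) => n.
have cn : `|p k - p n| @[k --> \oo] --> `|limn p - p n|.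
  by apply: cvg_norm; exact: (cvgB cp (cvg_cst _)).
have <- := cvg_lim (@Rhausdorff R) cn.
apply: limr_le; first by apply/cvg_ex; eexists; exact: cn.
exists n => // k /= nk; rewrite -(subnKC nk) (le_trans (diff _ _))//.
by rewrite ler_wpM2l// lerBlDr lerDl.
Qed.

Lemma geometric_csum (z : nat -> R[i]) : (forall j, normc (z j) <= 3^-1 ^+ j) ->
  exists S, forall n, normc (S - \sum_(j < n) z j) <= 3 * 3^-1 ^+ n.
Proof.
move=> zb.
have [a Ha] := geometric_rsum (fun j => le_trans (Re_le_normc (z j)) (zb j)).
have [b Hb] := geometric_rsum (fun j => le_trans (Im_le_normc (z j)) (zb j)).
exists (Complex a b) => n; rewrite (le_trans (normc_leD _))//.
have ReS : complex.Re (\sum_(j < n) z j) = \sum_(j < n) complex.Re (z j).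
  by apply: (big_morph (@complex.Re R)); [exact: ReD|].
have ImS : complex.Im (\sum_(j < n) z j) = \sum_(j < n) complex.Im (z j).
  by apply: (big_morph (@complex.Im R)); [exact: ImD|].
rewrite ReD ImD ReN ImN ReS ImS /=.
rewrite (le_trans (lerD (Ha n) (Hb n)))// -mulrDl ler_wpM2r ?exprn_ge0 ?invr_ge0//; lra.
Qed.

Lemma uniform_continuousR (F_ : nat -> V -> R) (F : V -> R) (b : nat -> R) :
  (forall n, continuous (F_ n)) -> (forall n x, `|F x - F_ n x| <= b n) ->
  b n @[n --> \oo] --> (0 : R) -> continuous F.
Proof.
move=> cF Fb b0 x; apply/(@cvgrPdist_le R R V (nbhs x) _ F (F x)) => e e0.
have e3 : 0 < e / 3 by rewrite divr_gt0.
have /cvgrPdist_le/(_ _ e3)[N _ HN] := b0.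
have bN : b N <= e / 3.
  by have := HN N (leqnn N); rewrite sub0r normrN; apply: le_trans; exact: ler_norm.
have /(@cvgrPdist_le R R V (nbhs x) _)/(_ _ e3) := cF N x.
apply: (@filterS _ (nbhs x)) => y xy.
rewrite (_ : F x - F y = (F x - F_ N x) + (F_ N x - F_ N y) - (F y - F_ N y)); last by ring.
rewrite (le_trans (ler_normB _ _))// (le_trans (lerD (ler_normD _ _) (lexx _)))//.
have := Fb N x; have := Fb N y; move: xy bN; lra.
Qed.

Lemma uniform_ccontinuous (F_ : nat -> V -> R[i]) (F : V -> R[i]) (b : nat -> R) :
  (forall n, ccontinuous (F_ n)) -> (forall n x, normc (F x - F_ n x) <= b n) ->
  b n @[n --> \oo] --> (0 : R) -> ccontinuous F.
Proof.
move=> cF Fb b0; split.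
- apply: (uniform_continuousR (fun n => (cF n).1) _ b0) => n x.
  by rewrite -ReN -ReD (le_trans (Re_le_normc _)).
- apply: (uniform_continuousR (fun n => (cF n).2) _ b0) => n x.
  by rewrite -ImN -ImD (le_trans (Im_le_normc _)).
Qed.

End GeometricSeries.

Section TestSeries.
Context {R : realType} {d : nat}.
Local Notation V := 'rV[R]_d.
Local Notation mR := (measurableTypeR R).
Local Notation ld := (@lebesgue_nd R d).
Local Notation row := (@row_of_tuple R d).
Variables (w : R -> R) (Om : set V).
Hypothesis hw : weight w.
Local Notation om := (@om R d w).
Local Notation un := (@un R d w).
Local Notation ufin := (@ufin R d w).
Local Notation test := (test_functions w Om).

Lemma cc0 : cc (fun _ : V => 0 : R[i]).
Proof.
split; first exact: ccontinuous_cst.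
rewrite /tsupport (_ : [set x | _] = set0) ?closure0; first exact: compact0.
by apply/seteqP; split => x //=; rewrite eqxx.
Qed.

Lemma un0 l : ufin l (fun _ => 0) /\ un l (fun _ => 0) = 0.
Proof.
have E : (fun t : d.-tuple mR =>
    normc (fourier (fun _ : V => 0 : R[i]) (row t)) * expR (l * om (row t))) = fun=> 0.
  apply/funext => t; rewrite (_ : fourier _ _ = 0).
    by rewrite ComplexField.Normc.normc0 mul0r.
  rewrite fourierE (_ : (fun _ => _) = fun=> 0); last first.
    by apply/funext => t'; rewrite mul0r.
  by apply: complex_ext; rewrite /= /Rintegral integral0.
rewrite /ufin /un E; split; first exact: rinteg0.
by rewrite /Rintegral integral0.
Qed.

Lemma tsupport_lin a (f g : V -> R[i]) :
  tsupport (fun x => a * f x + g x) `<=` tsupport f `|` tsupport g.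
Proof.
rewrite /tsupport -closureU; apply: closure_subset => y /= fg.
have [fy|fy] := eqVneq (f y) 0; last by left.
by right => /=; move: fg; rewrite fy mulr0 add0r.
Qed.

Lemma test_lin a f g : test f -> test g -> test (fun x => a * f x + g x).
Proof.
move=> tf tg; have cf := test_cc tf; have cg := test_cc tg.
have [l l0 fl] := test_ufin hw tf; have [m m0 gm] := test_ufin hw tg.
have caf := ccZ a cf.
have k0 : 0 < Num.min l m by rewrite lt_min l0.
have fl' : ufin (Num.min l m) f by apply: (ufin_le hw cf _ fl); rewrite ge_min lexx.
have gl' : ufin (Num.min l m) g by apply: (ufin_le hw cg _ gm); rewrite ge_min lexx orbT.
apply: (testP hw (ccD caf cg) _ k0).
  have sU : tsupport f `|` tsupport g `<=` Om.
    by rewrite subUset; split; [exact: (test_sub tf)|exact: (test_sub tg)].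
  exact: (subset_trans (@tsupport_lin a f g) sU).
exact: (unD hw caf cg (unZ a cf fl').1 gl').1.
Qed.

Lemma test0 : test (fun _ => 0).
Proof.
apply: (testP hw cc0 _ ltr01 (un0 1).1).
rewrite /tsupport (_ : [set x | _] = set0) ?closure0//.
by apply/seteqP; split => x //=; rewrite eqxx.
Qed.

Lemma test_modulate chi xi : test chi -> test (modulate chi xi).
Proof.
move=> tchi; have cch := test_cc tchi; have [l l0 fl] := test_ufin hw tchi.
apply: (testP hw (modulate_cc xi cch) _ l0 (ufin_modulate hw xi (ltW l0) cch fl).1).
apply: subset_trans (test_sub tchi); apply: tsupport_subset => x.
by rewrite /modulate => ->; rewrite mul0r.
Qed.

Definition comb (chi : V -> R[i]) (c : nat -> R) (xi : nat -> V) n (x : V) : R[i] :=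
  \sum_(j < n) (c j)%:C%C * modulate chi (xi j) x.

Lemma combS chi c xi n : comb chi c xi n.+1 =
  fun x => (c n)%:C%C * modulate chi (xi n) x + comb chi c xi n x.
Proof. by apply/funext => x; rewrite /comb big_ord_recr/= addrC. Qed.

Lemma comb0 chi c xi : comb chi c xi 0 = fun=> 0.
Proof. by apply/funext => x; rewrite /comb big_ord0. Qed.

Lemma combE chi c xi n x :
  comb chi c xi n x = chi x * \sum_(j < n) (c j)%:C%C * expi (dotv x (xi j)).
Proof. by rewrite mulr_sumr; apply: eq_bigr => j _; rewrite /modulate; ring. Qed.

Lemma test_comb chi c xi n : test chi -> test (comb chi c xi n).
Proof.
move=> tchi; elim: n => [|n IH]; first by rewrite comb0; exact: test0.
rewrite combS; exact: (test_lin _ (test_modulate (xi n) tchi) IH).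
Qed.

Lemma linear_comb (L : (V -> R[i]) -> R[i]) chi c xi n :
  linear_on_test w Om L -> test chi ->
  L (comb chi c xi n) = \sum_(j < n) (c j)%:C%C * L (modulate chi (xi j)).
Proof.
move=> linL tchi; elim: n => [|n IH].
  rewrite comb0 big_ord0; have := linL 1 _ _ test0 test0.
  rewrite (_ : (fun _ => _) = fun=> 0); last by apply/funext => x; rewrite mulr0 addr0.
  by rewrite mul1r => /eqP; rewrite eq_sym -subr_eq0 addrK => /eqP.
rewrite combS (linL _ _ _ (test_modulate (xi n) tchi) (test_comb c xi n tchi)).
by rewrite IH big_ord_recr addrC.
Qed.

Variables (chi : V -> R[i]) (l : R).
Hypotheses (cch : cc chi) (l0 : 0 <= l) (fl : ufin l chi).

Lemma geometric_step (a b r u q : R) :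
  a <= 3 / 2 * r * u * (1 - q) -> b <= r * q * u ->
  b + a <= 3 / 2 * r * u * (1 - 3^-1 * q).
Proof.
have -> : r * q * u = r * u * q by ring.
have -> : 3 / 2 * r * u * (1 - q) = 3 / 2 * (r * u) - 3 / 2 * (r * u * q) by ring.
have -> : 3 / 2 * r * u * (1 - 3^-1 * q) =
  3 / 2 * (r * u) - 1 / 2 * (r * u * q) by field.
by move: (r * u * q) => p; lra.
Qed.

(** The factor [1 - 3^-1 ^+ n] is the partial sum of the geometric series; it is
    what makes the induction close. *)
Lemma comb_un c xi r n : (forall j, `|c j| * expR (l * om (xi j)) <= r * 3^-1 ^+ j) ->
  [/\ cc (comb chi c xi n), ufin l (comb chi c xi n) &
   un l (comb chi c xi n) <= 3 / 2 * r * un l chi * (1 - 3^-1 ^+ n)].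
Proof.
move=> cr; elim: n => [|n [IH1 IH2 IH3]].
  rewrite comb0; have [a b] := un0 l.
  by split; [exact: cc0|exact: a|rewrite b expr0 subrr mulr0].
have cm := modulate_cc (xi n) cch.
have [fm um] := ufin_modulate hw (xi n) l0 cch fl.
have [fz uz] := unZ (c n)%:C%C cm fm.
have [fs us] := unD hw (ccZ (c n)%:C%C cm) IH1 fz IH2.
rewrite combS; split; [exact: ccD (ccZ _ cm) IH1|exact: fs|].
apply: (le_trans us); rewrite uz normc_real.
have h : `|c n| * un l (modulate chi (xi n)) <= r * 3^-1 ^+ n * un l chi.
  apply: (le_trans (ler_wpM2l (normr_ge0 _) um)); rewrite mulrA.
  by apply: (ler_wpM2r (un_ge0 w l chi)); exact: cr.
rewrite exprS; exact: geometric_step IH3 h.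
Qed.

(** The Banach space of functions supported in [tsupport chi] is complete along
    such series: the limit is uniform, and Fatou bounds its norm. *)
Lemma series_un c xi r Y B : 0 <= r ->
  (forall j, `|c j| * expR (l * om (xi j)) <= r * 3^-1 ^+ j) ->
  (forall n x, normc (Y x - comb chi c xi n x) <= normc (chi x) * (B * 3^-1 ^+ n)) ->
  [/\ cc Y, tsupport Y `<=` tsupport chi, ufin l Y & un l Y <= 3 / 2 * r * un l chi].
Proof.
move=> r0 cr YB.
have ccn n := (comb_un n cr).
have Y0 x : chi x = 0 -> Y x = 0.
  move=> x0; apply: normc0_eq; apply/eqP; rewrite eq_le normc_ge0 andbT.
  by have := YB 0%N x; rewrite comb0 subr0 x0 ComplexField.Normc.normc0 mul0r.
have cY : ccontinuous Y.
  have [M _ HM] := cc_bound cch (@cst_continuous V R 1).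
  apply: (@uniform_ccontinuous _ _ (comb chi c xi) Y (fun n => `|M| * `|B| * 3^-1 ^+ n)).
  - by move=> n; case: (ccn n) => -[].
  - move=> n x; apply: (le_trans (YB n x)); rewrite -mulrA.
    have := HM x; rewrite mulr1 => HMx.
    have h3 : 0 <= 3^-1 ^+ n :> R by rewrite exprn_ge0// invr_ge0.
    apply: (@le_trans _ _ (normc (chi x) * (`|B| * 3^-1 ^+ n))).
      by rewrite ler_wpM2l ?normc_ge0// ler_wpM2r// ler_norm.
    by rewrite ler_wpM2r ?mulr_ge0// (le_trans HMx)// ler_norm.
  - exact: (@cvg_geometric3 R (`|M| * `|B|)).
have sY := tsupport_subset Y0.
have ccY : cc Y by split => //; exact: (tsupport_compact Y0 cch.2).
have ichi := cc_vinteg cch; have iY := cc_vinteg ccY.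
have in1 : rinteg ld (fun t => normc (chi (row t))) := rinteg_normc ichi.
have [fY uY] : ufin l Y /\ un l Y <= 3 / 2 * r * un l chi.
  apply: (un_fatou hw (f_ := comb chi c xi)) => [n| |n|n|eta].
  - by case: (ccn n).
  - exact: ccY.
  - by case: (ccn n).
  - case: (ccn n) => _ _ h; apply: (le_trans h); apply: ler_piMr.
      by rewrite !mulr_ge0 ?un_ge0.
    by rewrite lerBlDr lerDl exprn_ge0// invr_ge0.
  - apply: (ccvg_le (b := fun n => norm1 chi * B * 3^-1 ^+ n)); last exact: (@cvg_geometric3 R (norm1 chi * B)).
    move=> n; have [cn _ _] := ccn n; have icn := cc_vinteg cn.
    have i1 := vinteg_expi (- eta) icn; have i2 := vinteg_expi (- eta) iY.
    rewrite !fourierE -cintB//.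
    have -> : norm1 chi * B * 3^-1 ^+ n = \int[ld]_t (B * 3^-1 ^+ n * normc (chi (row t))).
      by rewrite (RintegralZl _ measurableT in1) /norm1; ring.
    apply: normc_cint_le_bound.
    + exact: (cinteg_meas (cintegB i1 i2)).
    + exact: (rintegZ _ in1).
    + move=> t; rewrite -mulrBl normc_mul_expi normcBC [leRHS]mulrC.
      exact: YB.
split; [exact: ccY|exact: sY|exact: fY|exact: uY].
Qed.

End TestSeries.

(** * Association at a uniform rate *)

Section UniformAssociation.
Context {R : realType} {d : nat}.
Local Notation V := 'rV[R]_d.
Local Notation ld := (@lebesgue_nd R d).
Local Notation row := (@row_of_tuple R d).
Variables (w : R -> R) (Om : set V).
Hypothesis hw : weight w.
Local Notation om := (@om R d w).
Local Notation un := (@un R d w).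
Local Notation ufin := (@ufin R d w).
Local Notation test := (test_functions w Om).
Variable T : (V -> R[i]) -> R[i].
Hypothesis hT : ultradistribution w Om T.

Let linT : linear_on_test w Om T. Proof. by case: hT. Qed.

Let T0 : T (fun _ => 0) = 0.
Proof.
have := linT 1 (test0 Om hw) (test0 Om hw).
rewrite (_ : (fun _ => _) = fun=> 0); last by apply/funext => x; rewrite mulr0 addr0.
by rewrite mul1r => /eqP; rewrite eq_sym -subr_eq0 addrK => /eqP.
Qed.

Let TZ a f : test f -> T (fun x => a * f x) = a * T f.
Proof.
move=> tf; have := linT a tf (test0 Om hw); rewrite T0 addr0 => <-.
by congr T; apply/funext => x; rewrite addr0.
Qed.

(** Continuity at the origin, rescaled. The bound is in terms of a number [s]
    above the norm because the norm itself, by which one would rescale, may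
    vanish. *)
Lemma ultradistribution_bound K l : compact K -> K `<=` Om -> 0 < l -> exists2 D, 0 <= D &
  forall f, test f -> tsupport f `<=` K -> ufin l f ->
  forall s, un l f < s -> normc (T f) <= D * s.
Proof.
move=> cK KO l0; have cT := hT.2 K l cK KO l0.
have [z1 z2] := @un0 R d w l.
have b0 : banach_space w K l (fun _ => 0).
  split; [exact: ccontinuous_cst| |].
    rewrite /tsupport (_ : [set x | _] = set0) ?closure0//.
    by apply/seteqP; split => x //=; rewrite eqxx.
  by apply/(ufinP hw) => //; exact: cc0.
have [dl dl0 H] := cT _ b0 1 ltr01.
exists (2 / dl) => [|f tf sf fl s us]; first by rewrite divr_ge0// ltW.
have cf := test_cc tf.
have s0 : 0 < s by rewrite (le_lt_trans (un_ge0 w l f)).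
pose a : R := dl / (2 * s).
have a0 : 0 < a by rewrite divr_gt0// mulr_gt0.
have [af au] := unZ a%:C%C cf fl.
have cg := ccZ a%:C%C cf.
have bg : banach_space w K l (fun x => a%:C%C * f x).
  split; first by case: cg.
    apply: subset_trans sf; apply: tsupport_subset => x ->.
    by rewrite mulr0.
  by apply/(ufinP hw).
have := H (fun x => a%:C%C * f x) bg.
rewrite (_ : (fun x => a%:C%C * f x - 0) = fun x => a%:C%C * f x); last first.
  by apply/funext => x; rewrite subr0.
rewrite (unorm_un af) lte_fin au normc_real (gtr0_norm a0) T0 subr0 TZ//.
have lt : a * un l f < dl.
  rewrite /a mulrAC ltr_pdivrMr ?mulr_gt0// ltr_pM2l//.
  by rewrite (lt_trans us)// ltr_pMl// ltr1n.
move=> /(_ lt); rewrite ComplexField.Normc.normcM normc_real (gtr0_norm a0) => h.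
have : normc (T f) < a^-1 by rewrite -[a^-1]mul1r ltr_pdivlMr// mulrC.
by move=> /ltW h'; rewrite (le_trans h')// /a invf_div mulrAC.
Qed.

Lemma pairing_lin f : ultradiff w Om f -> forall a phi psi, test phi -> test psi ->
  pairing f (fun x => a * phi x + psi x) = a * pairing f phi + pairing f psi.
Proof.
move=> uf a phi psi tphi tpsi.
have i1 := cc_vinteg (test_cc (ultradiff_test uf tphi)).
have i2 := cc_vinteg (test_cc (ultradiff_test uf tpsi)).
have i1' := vinteg_expi (- 0) i1; have i2' := vinteg_expi (- 0) i2.
rewrite !pairingE !fourierE -cintZ// -cintD//; last exact: (cintegZ a i1').
by apply: eq_cint => t; ring.
Qed.

Variables (g : @net R d) (chi : V -> R[i]) (l : R).
Hypotheses (ug : ultradiff_net w Om g) (tchi : test chi) (l0 : 0 < l)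
  (fl : ufin l chi).
Hypothesis assoc : forall phi, test phi -> exists m dl, [/\ 0 < m, 0 < dl &
    forall e, 0 < e < 1 -> e < dl ->
    normc (pairing (g e) phi - T phi) <= expR (- (m * w e^-1))].

Let L e phi := pairing (g e) phi - T phi.

Let linL e : 0 < e < 1 -> linear_on_test w Om (L e).
Proof.
move=> e01 a phi psi tphi tpsi.
by rewrite /L (pairing_lin (ug e01))// linT//; ring.
Qed.

Let cch : cc chi. Proof. exact: test_cc tchi. Qed.

Let affine_lt (u p : R) : 0 < p -> 3 / 2 * p * u < (3 / 2 * u + 1) * p.
Proof. by move=> p0; rewrite [ltLHS]mulrAC [ltRHS]mulrC mulrDr mulr1 [p * _]mulrC ltrDl. Qed.

(** The rate at which a net tends to [T] on a test function is made uniform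
    over the modulations of [chi]: an absolutely convergent combination of the
    modulations, normalised by [exp (- l om xi)], is again a test function, so
    [gliding_hump] applies to [L e] along them. *)
Theorem uniform_association : exists2 K, 0 < K &
  forall e, 0 < e < 1 -> e < K^-1 -> forall xi,
  normc (pairing (g e) (modulate chi xi) - T (modulate chi xi)) <=
    K * expR (l * om xi) * expR (- (w e^-1 / K)).
Proof.
have cK : compact (tsupport chi) by case: cch.
have [D D0 HD] := ultradistribution_bound cK (test_sub tchi) l0.
pose a e xi : R[i] := (expR (- (l * om xi)))%:C%C * L e (modulate chi xi).
have pair_le e phi B : 0 < e < 1 -> test phi -> 0 <= B ->
    (forall x, normc (phi x) <= normc (chi x) * B) ->
    normc (pairing (g e) phi) <= norm1 (fun x => chi x * g e x) * B.
  move=> e01 tphi B0 phiB.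
  have i1 := cc_vinteg (test_cc (ultradiff_test (ug e01) tphi)).
  have i2 := cc_vinteg (test_cc (ultradiff_test (ug e01) tchi)).
  have in2 : rinteg ld (fun t => normc (chi (row t) * g e (row t))) := rinteg_normc i2.
  rewrite pairingE (le_trans (normc_fourier_le 0 i1))//.
  rewrite /norm1 -(RintegralZr _ measurableT in2).
  apply: le_Rintegral => //; first exact: rinteg_normc.
    under eq_fun do rewrite mulrC; exact: rintegZ.
  move=> t _; rewrite !ComplexField.Normc.normcM mulrAC ler_wpM2r ?normc_ge0//.
have [||i s s3|K K0 HK] := @gliding_hump R V a (fun e => w e^-1) (fun e => 0 < e < 1).
- by move=> e /andP[e0 _]; apply: (weight_ge0 hw); rewrite invr_ge0 ltW.
- move=> e e01.
  exists (norm1 (fun x => chi x * g e x) + D * (un l chi + 1)) => xi.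
  have tm := test_modulate hw xi tchi.
  have [fm um] := ufin_modulate hw xi (ltW l0) cch fl.
  have sm : tsupport (modulate chi xi) `<=` tsupport chi.
    by apply: tsupport_subset => x; rewrite /modulate => ->; rewrite mul0r.
  have e0 := expR_gt0 (l * om xi).
  have ee : expR (- (l * om xi)) * expR (l * om xi) = 1 by rewrite -expRD addNr expR0.
  have e1 : 1 <= expR (l * om xi).
    by rewrite -expR0 ler_expR mulr_ge0 ?(om_ge0 hw)// ltW.
  have h1 : normc (pairing (g e) (modulate chi xi)) <=
      norm1 (fun x => chi x * g e x) * 1.
    by apply: pair_le => // x; rewrite normc_mul_expi mulr1.
  have h2 : normc (T (modulate chi xi)) <= D * (expR (l * om xi) * (un l chi + 1)).
    apply: (HD _ tm sm fm); rewrite (le_lt_trans um)// ltr_pM2l// ltrDl ltr01.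
    by [].
  rewrite /a ComplexField.Normc.normcM normc_real gtr0_norm ?expR_gt0//.
  rewrite -(ler_pM2l e0) mulrA [expR (l * om xi) * _]mulrC ee mul1r.
  rewrite (le_trans (normcB _ _))// mulrDr lerD//.
    rewrite (le_trans h1)// mulr1 ler_peMl ?norm1_ge0//.
  by rewrite (le_trans h2)// mulrCA.
(* the sum [X] of the series and its remainders [Y n] are [chi] times bounded
   functions, and the norm of [Y n] decreases geometrically *)
- pose c j := s j * expR (- (l * om (i j))).
  have cE j : c j * expR (l * om (i j)) = s j.
    by rewrite /c -mulrA -expRD addNr expR0 mulr1.
  have cs n j : `|c (n + j)%N| * expR (l * om (i (n + j)%N)) <= 3^-1 ^+ n * 3^-1 ^+ j.
    rewrite -[expR _]gtr0_norm ?expR_gt0// -normrM cE -exprD; exact: s3.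
  have c3 j : `|c j| <= 3^-1 ^+ j.
    have sc : `|s j| = `|c j| * expR (l * om (i j)).
      by rewrite -[in LHS](cE j) normrM [`|expR _|]gtr0_norm ?expR_gt0.
    have e1 : 1 <= expR (l * om (i j)).
      by rewrite -expR0 ler_expR mulr_ge0 ?(om_ge0 hw)// ltW.
    by apply: le_trans (s3 j); rewrite sc ler_peMr.
  have /choice [m Hm] : forall x, exists m, forall n,
      normc (m - \sum_(j < n) (c j)%:C%C * expi (dotv x (i j))) <= 3 * 3^-1 ^+ n.
    move=> x; apply: (@geometric_csum R (fun j => (c j)%:C%C * expi (dotv x (i j)))) => j.
    by rewrite normc_mul_expi normc_real.
  pose X x := chi x * m x.
  pose Y n x := X x - comb chi c i n x.
  have h3 n : 0 <= 3^-1 ^+ n :> R by rewrite exprn_ge0// invr_ge0.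
  have YE n k x : normc (Y n x - comb chi (fun j => c (n + j)%N) (fun j => i (n + j)%N) k x)
      <= normc (chi x) * ((3 * 3^-1 ^+ n) * 3^-1 ^+ k).
    rewrite /Y /X !combE.
    have -> : chi x * m x - chi x * (\sum_(j < n) (c j)%:C%C * expi (dotv x (i j))) -
       chi x * (\sum_(j < k) (c (n + j)%N)%:C%C * expi (dotv x (i (n + j)%N))) =
       chi x * (m x - \sum_(j < n + k) (c j)%:C%C * expi (dotv x (i j))).
      by rewrite big_split_ord/=; ring.
    rewrite ComplexField.Normc.normcM ler_wpM2l ?normc_ge0//.
    by rewrite -mulrA -exprD; exact: Hm.
  have YB n x : normc (Y n x) <= normc (chi x) * (3 * 3^-1 ^+ n).
    by have := YE n 0%N x; rewrite comb0 subr0 expr0 mulr1.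
  have HY n := series_un hw cch (ltW l0) fl (h3 n) (cs n) (YE n).
  have tY n : test (Y n).
    have [cY sY fY _] := HY n.
    exact: (testP hw cY (subset_trans sY (test_sub tchi)) l0 fY).
  have tX : test X.
    have := tY 0%N; rewrite /Y comb0.
    by rewrite (_ : (fun x => X x - 0) = X)//; apply/funext => x; rewrite subr0.
  have [q [dl [q0 dl0 Hq]]] := assoc tX.
  exists (fun e => L e X), q; split => //; last first.
    by exists dl => // e e01 ed; exact: Hq.
  move=> e e01.
  exists (norm1 (fun x => chi x * g e x) * 3 + D * (3 / 2 * un l chi + 1)) => n.
  have -> : \sum_(j < n) (s j)%:C%C * a e (i j) = L e (comb chi c i n).
    rewrite (linear_comb hw c i n (linL e01) tchi); apply: eq_bigr => j _.
    by rewrite /a mulrA -rmorphM.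
  have tc := test_comb hw c i n tchi.
  have -> : L e X - L e (comb chi c i n) = L e (Y n).
    have -> : Y n = fun x => (-1) * comb chi c i n x + X x.
      by apply/funext => x; rewrite /Y mulN1r addrC.
    by rewrite (linL e01 (-1) tc tX) mulN1r addrC.
  have [cY sY fY uY] := HY n.
  rewrite /L (le_trans (normcB _ _))// mulrDl lerD//.
    rewrite -mulrA; apply: (pair_le e (Y n) _ e01 (tY n)); last exact: YB.
    by rewrite mulr_ge0.
  rewrite -[leRHS]mulrA; apply: (HD _ (tY n) sY fY); apply: (le_lt_trans uY).
  have p3 : 0 < 3^-1 ^+ n :> R by rewrite exprn_gt0// invr_gt0.
  exact: affine_lt.
- exists K => // e e01 eK xi.
  have := HK e e01 eK xi; rewrite /a ComplexField.Normc.normcM normc_real.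
  rewrite gtr0_norm ?expR_gt0// expRN mulrC ler_pdivrMr ?expR_gt0//.
  by rewrite mulrAC.
Qed.

End UniformAssociation.

(** * Decay of the limiting transform *)

Section Interpolation.
Context {R : realType}.

Lemma exp_interpolate (M A B th z : R) : 0 <= M -> 0 <= th <= 1 ->
  z <= M * expR A -> z <= M * expR B -> z <= M * expR ((1 - th) * A + th * B).
Proof.
move=> M0 /andP[t0 t1] zA zB; have [AB|BA] := leP A B.
- apply: (le_trans zA); rewrite ler_wpM2l// ler_expR.
  have : 0 <= th * (B - A) by rewrite mulr_ge0// subr_ge0.
  by rewrite mulrBr; lra.
- apply: (le_trans zB); rewrite ler_wpM2l// ler_expR.
  have : 0 <= (1 - th) * (A - B) by rewrite mulr_ge0// subr_ge0// ltW.
  by rewrite mulrBr !mulrBl !mul1r; lra.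
Qed.

(** The exponents of the two estimates, [k y - c s] and [l s - y / K], combine
    to decay in both [s] and [y]. *)
Lemma interpolation_exponent (l K c th k s y : R) : 0 < l -> 0 < K -> 0 < c ->
  th = c / (2 * (l + c)) -> k = th / (2 * K) -> 0 <= s -> 0 <= y ->
  0 < th <= 1 /\
  (1 - th) * (k * y - c * s) + th * (l * s - y / K) <=
    - (c / 2 * s) + - (th / (2 * K) * y).
Proof.
move=> l0 K0 c0 thE kE s0 y0.
have lc : 0 < 2 * (l + c) by rewrite mulr_gt0// addr_gt0.
have t0 : 0 < th by rewrite thE divr_gt0.
have t1 : th <= 1 by rewrite thE ler_pdivrMr// mul1r; lra.
split; first by rewrite t0.
have k0' : 0 < k by rewrite kE divr_gt0// mulr_gt0.
have k0 : 0 <= k * (th * y) := mulr_ge0 (ltW k0') (mulr_ge0 (ltW t0) y0).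
have E1 : th * (l + c) = c / 2.
  by rewrite thE; have h : l + c != 0 by [rewrite gt_eqF// addr_gt0]; field.
have E2 : th * (y / K) = 2 * (k * y) by rewrite kE; have h : K != 0 by [rewrite gt_eqF]; field.
have E3 : th / (2 * K) * y = k * y by rewrite kE.
have E4 : (th * (l + c)) * s = c / 2 * s by rewrite E1.
rewrite E3 (_ : (1 - th) * (k * y - c * s) + th * (l * s - y / K) =
  k * y - c * s - k * (th * y) + th * (l + c) * s - th * (y / K)); last by ring.
rewrite E4 E2 (_ : c * s = 2 * (c / 2 * s)); last by field.
move: (k * y) (k * (th * y)) k0 (c / 2 * s) => p1 p2 p2_ p3; lra.
Qed.

(** Exponents at a parameter [e] with [w e^-1 = lam s + M]: a growth rate
    [b / (2 lam)] uses up only half of the decay [b s], and the rate of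
    association overcomes [exp (l s)]. *)
Lemma choice_exponent (l K b s M : R) : 0 < l -> 0 < K -> 0 < b -> 0 <= s -> 0 <= M ->
  let lam := K * (l + 1) in
  b / (2 * lam) * (lam * s + M) - b * s = b / (2 * lam) * M - b / 2 * s /\
  l * s - (lam * s + M) / K <= - s.
Proof.
move=> l0 K0 b0 s0 M0 lam.
have K' : K != 0 by rewrite gt_eqF.
have l' : l + 1 != 0 by rewrite gt_eqF// addr_gt0.
have lam' : lam != 0 by rewrite mulf_neq0.
split; first by field.
rewrite (_ : _ - _ = - s - M / K); last by rewrite /lam; field.
by rewrite lerBlDr lerDl divr_ge0// ltW.
Qed.

End Interpolation.

Section LocalLimits.
Context {R : realType} {d : nat}.
Local Notation V := 'rV[R]_d.
Local Notation cd := (@cd R d).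
Variables (w : R -> R) (Om : set V).
Hypothesis hw : weight w.
Local Notation om := (@om R d w).
Local Notation un := (@un R d w).
Local Notation ufin := (@ufin R d w).
Local Notation test := (test_functions w Om).
Variable T : (V -> R[i]) -> R[i].
Hypothesis hT : ultradistribution w Om T.
Variable g : @net R d.
Hypothesis ug : ultradiff_net w Om g.
Hypothesis reg : forall K, compact K -> K `<=` Om -> exists2 h : R, 0 < h &
  forall k : R, 0 < k -> little_o_exp w (fun e => unormK w Om K h (g e)) k.
Hypothesis assoc : forall phi, test phi -> exists m dl, [/\ 0 < m, 0 < dl &
    forall e, 0 < e < 1 -> e < dl ->
    normc (pairing (g e) phi - T phi) <= expR (- (m * w e^-1))].

Let w_ge0 e : 0 < e -> 0 <= w e^-1.
Proof. by move=> e0; apply: (weight_ge0 hw); rewrite invr_ge0 ltW. Qed.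

Lemma regular_cutoff K : compact K -> K `<=` Om -> exists2 h : R, 0 < h &
  forall k : R, 0 < k -> exists2 dl, 0 < dl & forall e, 0 < e < 1 -> e < dl ->
    exists2 psi, test psi & [/\ forall x, K x -> psi x = 1,
      ufin h (fun x => psi x * g e x) &
      un h (fun x => psi x * g e x) < 2 * expR (k * w e^-1)].
Proof.
move=> cK KO; have [h h0 H] := reg cK KO; exists h => // k k0.
have [dl dl0 Hd] := little_oP ltr01 (H k k0).
exists dl => // e e01 ed; have /andP[e0 _] := e01.
apply: (unormK_lt hw (ug e01)).
rewrite (le_lt_trans (lee_abs _))// (le_lt_trans (Hd e e0 ed))// mul1r lte_fin.
by rewrite ltr_pMl ?expR_gt0// ltr1n.
Qed.

(** Cutoffs exist because the seminorms of a regular net are finite. *)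
Lemma cutoff K : compact K -> K `<=` Om ->
  exists2 rho, test rho & forall x, K x -> rho x = 1.
Proof.
move=> cK KO; have [h h0 H] := regular_cutoff cK KO.
have [dl dl0 Hd] := H 1 ltr01.
pose e := Num.min 1 dl / 2.
have m0 : 0 < Num.min 1 dl by rewrite lt_min ltr01.
have e0 : 0 < e by rewrite divr_gt0.
have em : e < Num.min 1 dl by rewrite ltr_pdivrMr// ltr_pMr// ltr1n.
have e01 : 0 < e < 1 by rewrite e0 (lt_le_trans em)// ge_min lexx.
have ed : e < dl by rewrite (lt_le_trans em)// ge_min lexx orbT.
by have [psi tpsi [p1 _ _]] := Hd e e01 ed; exists psi.
Qed.

(** The decay rate [b] of the transforms does not depend on the growth rate [k]
    allowed in the parameter: this is where regularity is used. *)
Lemma regular_fourier_bound chi : test chi -> exists2 b : R, 0 < b &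
  forall k : R, 0 < k -> exists C dl, [/\ 0 <= C, 0 < dl &
    forall e, 0 < e < 1 -> e < dl -> forall xi,
    normc (fourier (fun x => chi x * g e x) xi) <=
      C * expR (k * w e^-1 - b * om xi)].
Proof.
move=> tchi; have cch := test_cc tchi; have [_ cK] := cch.
have [rho trho rho1] := cutoff cK (test_sub tchi); have crho := test_cc trho.
have [l1 l10 f1] := test_ufin hw tchi; have [l2 l20 f2] := test_ufin hw trho.
pose a := Num.min l1 l2.
have a0 : 0 < a by rewrite lt_min l10.
have fa : ufin a rho by apply: (ufin_le hw crho _ f2); rewrite ge_min lexx orbT.
have ga : ufin a chi by apply: (ufin_le hw cch _ f1); rewrite ge_min lexx.
have [S HS] := fourierM_sup hw crho cch a0 fa ga.
have chirho : (fun x => chi x * rho x) = chi.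
  apply/funext => x; have [xs|/tsupport_eq0 ->] := pselect (tsupport chi x).
    by rewrite rho1// mulr1.
  by rewrite mul0r.
rewrite chirho in HS.
have [h h0 Hreg] := regular_cutoff cK (test_sub tchi).
pose b := Num.min (a / 2) h.
have b0 : 0 < b by rewrite lt_min h0 divr_gt0.
have ba : b <= a / 2 by rewrite ge_min lexx.
have bh : b <= h by rewrite ge_min lexx orbT.
have HSb s : normc (fourier chi s) * expR (b * om s) <= S.
  apply: le_trans (HS s); rewrite ler_wpM2l ?normc_ge0// ler_expR.
  by rewrite ler_wpM2r// (om_ge0 hw).
have S0 : 0 <= S by apply: le_trans (HSb 0); rewrite mulr_ge0 ?normc_ge0 ?expR_ge0.
exists b => // k k0; have [dl dl0 Hd] := Hreg k k0.
exists (cd * S * 2), dl; split => //.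
  by rewrite mulr_ge0// mulr_ge0// ltW// cd_gt0.
move=> e e01 ed xi; have [psi tpsi [psi1 fin lt]] := Hd e e01 ed.
have cpg := test_cc (ultradiff_test (ug e01) tpsi).
have finb := ufin_le hw cpg bh fin.
have := fourierM_sup_un hw cpg cch finb (ltW b0) HSb xi.
have -> : (fun x => chi x * (psi x * g e x)) = (fun x => chi x * g e x).
  apply/funext => x; have [xs|/tsupport_eq0 ->] := pselect (tsupport chi x).
    by rewrite psi1// mul1r.
  by rewrite !mul0r.
have unb : un b (fun x => psi x * g e x) <= 2 * expR (k * w e^-1).
  exact: (le_trans (un_le hw cpg bh fin) (ltW lt)).
have cS : 0 <= cd * S by rewrite mulr_ge0// ltW// cd_gt0.
move=> /le_trans /(_ (ler_wpM2l cS unb)).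
rewrite expRD -ler_pdivlMr ?expR_gt0// => /le_trans; apply.
by rewrite expRN !mulrA.
Qed.

Lemma fourier_pairing (f chi : V -> R[i]) xi :
  fourier (fun x => chi x * f x) xi = pairing f (modulate chi (- xi)).
Proof.
rewrite fourierE; apply: eq_cint => t; rewrite /modulate; ring.
Qed.

(** The transform of [chi T] differs from that of [chi g_e] by at most
    [K exp (l om xi - w e^-1 / K)]. With [w e^-1] a multiple of [om xi], up to a
    constant, this error and the transform of [chi g_e] are both exponentially
    small in [om xi], hence so is the transform of [chi T]. For fixed [e] the
    difference is therefore also at most [C exp (k w e^-1 - c om xi)] with [k] as
    small as desired, and interpolating the two bounds gives decay in both
    variables. *)
Lemma transform_limit chi : test chi -> exists C c q dl, [/\ 0 <= C, 0 < c, 0 < q, 0 < dl &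
  (forall xi, normc (T (modulate chi (- xi))) <= C * expR (- (c * om xi))) /\
  forall e, 0 < e < 1 -> e < dl -> forall xi,
  normc (fourier (fun x => chi x * g e x) xi - T (modulate chi (- xi))) <=
    C * expR (- (c * om xi)) * expR (- (q * w e^-1))].
Proof.
move=> tchi; have [l l0 fl] := test_ufin hw tchi.
have [K K0 HB] := uniform_association hw hT ug tchi l0 fl assoc.
pose tau xi := T (modulate chi (- xi)).
pose u e := fourier (fun x => chi x * g e x).
have {}HB e xi : 0 < e < 1 -> e < K^-1 ->
    normc (u e xi - tau xi) <= K * expR (l * om xi - w e^-1 / K).
  move=> e01 eK; rewrite /u fourier_pairing (le_trans (HB e e01 eK (- xi)))//.
  by rewrite (omN w) -mulrA -expRD.
have [b b0 HA] := regular_fourier_bound tchi.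
pose lam := K * (l + 1).
have lam0 : 0 < lam by rewrite mulr_gt0// addr_gt0.
have k10 : 0 < b / (2 * lam) by rewrite divr_gt0// mulr_gt0.
have [C1 [d1 [C10 d10 HA1]]] := HA _ k10.
pose e0 := Num.min 1 (Num.min d1 K^-1).
have e00 : 0 < e0 by rewrite !lt_min ltr01 d10 invr_gt0.
pose M := w e0^-1 + 1.
have M0 : 0 <= M by rewrite addr_ge0// w_ge0.
pose c1 := Num.min (b / 2) 1.
have c10 : 0 < c1 by rewrite lt_min ltr01 divr_gt0.
have c1b : c1 <= b / 2 by rewrite ge_min lexx.
have c11 : c1 <= 1 by rewrite ge_min lexx orbT.
pose C2 := C1 * expR (b / (2 * lam) * M) + K.
have C20 : 0 <= C2 by rewrite addr_ge0 ?mulr_ge0 ?expR_ge0// ltW.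
have s0 xi : 0 <= om xi := om_ge0 hw xi.
have Htau xi : normc (tau xi) <= C2 * expR (- (c1 * om xi)).
  have lt : w e0^-1 < lam * om xi + M.
    by rewrite (@lt_le_trans _ _ M)// ?ltrDl// lerDr mulr_ge0// ltW.
  have [e /andP[ep ee0] we] := weight_inv hw e00 lt.
  move: ee0; rewrite !lt_min => /andP[e1 /andP[ed eK]].
  have e01 : 0 < e < 1 by rewrite ep.
  have h1 := HA1 e e01 ed xi; have h2 := HB e xi e01 eK.
  rewrite we in h1 h2.
  have [E1 E2] := choice_exponent l0 K0 b0 (s0 xi) M0.
  rewrite -/lam in E1 E2.
  rewrite E1 in h1.
  rewrite (_ : tau xi = u e xi - (u e xi - tau xi)); last by ring.
  apply: (le_trans (normcB _ _)); rewrite mulrDl; apply: lerD.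
    apply: (le_trans h1); rewrite expRD mulrA ler_wpM2l ?mulr_ge0 ?expR_ge0//.
    by rewrite ler_expR lerN2 ler_wpM2r.
  apply: (le_trans h2); rewrite ler_wpM2l ?(ltW K0)// ler_expR (le_trans E2)//.
  by rewrite lerN2 ler_piMl.
pose th := c1 / (2 * (l + c1)); pose k2 := th / (2 * K).
have [/andP[th0 th1] _] := interpolation_exponent l0 K0 c10 (erefl th) (erefl k2) (lexx 0) (lexx 0).
have k20 : 0 < k2 by rewrite divr_gt0// mulr_gt0.
have [C3 [d3 [C30 d30 HA3]]] := HA _ k20.
pose C := C3 + C2 + K.
have C0 : 0 <= C := addr_ge0 (addr_ge0 C30 C20) (ltW K0).
exists C, (c1 / 2), k2, (Num.min d3 K^-1); split.
- exact: C0.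
- by rewrite divr_gt0.
- exact: k20.
- by rewrite lt_min d30 invr_gt0.
split=> [xi|e e01].
  apply: (le_trans (Htau xi)); apply: (@le_trans _ _ (C * expR (- (c1 * om xi)))).
    by rewrite ler_wpM2r ?expR_ge0// /C; move: C30 K0; lra.
  rewrite ler_wpM2l// ler_expR lerN2 ler_wpM2r//; move: c10; lra.
rewrite lt_min => /andP[ed eK] xi; have /andP[ep _] := e01.
have y0 := w_ge0 ep.
have zB : normc (u e xi - tau xi) <= C * expR (l * om xi - w e^-1 / K).
  apply: (le_trans (HB e xi e01 eK)); rewrite ler_wpM2r ?expR_ge0// /C.
  by move: C30 C20; lra.
have zA : normc (u e xi - tau xi) <= C * expR (k2 * w e^-1 - c1 * om xi).
  apply: (le_trans (normcB _ _)).
  apply: (@le_trans _ _ (C3 * expR (k2 * w e^-1 - c1 * om xi) +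
    C2 * expR (k2 * w e^-1 - c1 * om xi))).
    apply: lerD.
      apply: (le_trans (HA3 e e01 ed xi)); rewrite ler_wpM2l// ler_expR lerD2l lerN2.
      rewrite ler_wpM2r// (le_trans c1b)//; move: b0; lra.
    apply: (le_trans (Htau xi)); rewrite ler_wpM2l// ler_expR lerDr.
    by rewrite mulr_ge0// ltW.
  by rewrite -mulrDl ler_wpM2r ?expR_ge0// /C lerDl ltW.
have th01 : 0 <= th <= 1 by rewrite (ltW th0).
have := exp_interpolate C0 th01 zA zB => /le_trans; apply.
rewrite -mulrA -expRD ler_wpM2l// ler_expR.
by have [_] := interpolation_exponent l0 K0 c10 (erefl th) (erefl k2) (s0 xi) y0.
Qed.

End LocalLimits.

(** * The smooth limit *)

Section SmoothLimit.
Context {R : realType} {d : nat}.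
Local Notation V := 'rV[R]_d.
Local Notation ld := (@lebesgue_nd R d).
Local Notation row := (@row_of_tuple R d).
Local Notation cd := (@cd R d).

Lemma ccvg_near (u : nat -> R[i]) a (b : nat -> R) :
  (\forall k \near \oo, normc (u k - a) <= b k) -> b k @[k --> \oo] --> (0 : R) ->
  ccvg u a.
Proof.
move=> ub b0; apply: (squeeze_cvgr _ (cvg_cst 0) b0).
by apply: filterS ub => k; rewrite normc_ge0.
Qed.

Variables (w : R -> R) (Om : set V).
Hypothesis oOm : open Om.
Hypothesis hw : weight w.
Local Notation om := (@om R d w).
Local Notation test := (test_functions w Om).

(** A sequence of parameters along which every [exp (- q w e^-1)] is
    geometric. *)
Lemma parameter_sequence : exists en : nat -> R, [/\ forall n, 0 < en n < 1,
  forall dl, 0 < dl -> \forall n \near \oo, en n < dl &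
  forall q, 0 < q -> expR (- (q * w (en n)^-1)) @[n --> \oo] --> (0 : R)].
Proof.
pose M := w 1^-1 + 1.
have M0 : 0 <= M by rewrite addr_ge0// (weight_ge0 hw)// invr1.
have /choice [en Hen] : forall n : nat, exists e, 0 < e < 1 /\ w e^-1 = M + n%:R.
  move=> n; have lt : w 1^-1 < M + n%:R by rewrite /M -addrA ltrDl ltr_pwDl.
  by have [e e01 we] := weight_inv hw ltr01 lt; exists e.
exists en; split => [n|dl dl0|q q0].
- by case: (Hen n).
- exists (Num.truncn (w dl^-1)).+1 => // n /= nN.
  rewrite ltNge; apply/negP => dle; have [/andP[e0 _] we] := Hen n.
  have : w (en n)^-1 <= w dl^-1.
    apply: (weight_homo hw); first by rewrite invr_ge0 ltW.
    by rewrite lef_pV2 ?posrE.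
  rewrite we leNgt => /negP; apply.
  have h : w dl^-1 < (Num.truncn (w dl^-1)).+1%:R by exact: truncnS_gt.
  rewrite (lt_le_trans h)// (@le_trans _ _ n%:R) ?ler_nat// lerDr//.
- have -> : (fun n => expR (- (q * w (en n)^-1))) =
      fun n => expR (- (q * M)) * expR (- q) ^+ n.
    apply/funext => n; have [_ ->] := Hen n.
    by rewrite -expRM_natl -expRD; congr expR; ring.
  rewrite -(mulr0 (expR (- (q * M)))); apply: (cvgM (cvg_cst _)).
  apply: cvg_expr; rewrite gtr0_norm ?expR_gt0//.
  by rewrite -expR0 ltr_expR oppr_lt0.
Qed.

Lemma rapidZ c A : rapid A -> rapid (fun x : V => c * A x).
Proof.
move=> [mA dA]; split; first by apply: cmeasM => //; exact: cmeas_cst.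
move=> N; have [C HC] := dA N; exists (normc c * C) => x.
by rewrite ComplexField.Normc.normcM -!mulrA ler_wpM2l ?normc_ge0.
Qed.

Lemma nbhs_compact x : Om x -> exists K, [/\ compact K, K `<=` Om & nbhs x K].
Proof.
move=> Ox; have : nbhs x Om by exact: open_nbhs_nbhs.
move=> /nbhs_ballP [r /= r0 rO].
have r2 : 0 < r / 2 by rewrite divr_gt0.
exists (closed_ball x (r / 2)); split.
- apply: bounded_closed_compact; last exact: closed_ball_closed.
  exists (`|x| + r / 2); split; first exact: num_real.
  move=> M HM y; rewrite closed_ballE// /closed_ball_ /= => xy.
  rewrite (le_trans _ (ltW HM))// -(subrK x y) addrC (le_trans (ler_normD _ _))//.
  by rewrite lerD2l distrC.
- move=> y; rewrite closed_ballE// /closed_ball_ /= => xy; apply: rO.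
  rewrite -ball_normE /ball_ /=; apply: (le_lt_trans xy).
  by rewrite ltr_pdivrMr// ltr_pMr// ltr1n.
- by apply/nbhs_closedballP; exists (PosNum r2).
Qed.

Variable T : (V -> R[i]) -> R[i].
Hypothesis hT : ultradistribution w Om T.
Variable g : @net R d.
Hypothesis ug : ultradiff_net w Om g.
Hypothesis reg : forall K, compact K -> K `<=` Om -> exists2 h : R, 0 < h &
  forall k : R, 0 < k -> little_o_exp w (fun e => unormK w Om K h (g e)) k.
Hypothesis assoc : forall phi, test phi -> exists m dl, [/\ 0 < m, 0 < dl &
    forall e, 0 < e < 1 -> e < dl ->
    normc (pairing (g e) phi - T phi) <= expR (- (m * w e^-1))].

Variable en : nat -> R.
Hypothesis en01 : forall n, 0 < en n < 1.
Hypothesis en_small : forall dl, 0 < dl -> \forall n \near \oo, en n < dl.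
Hypothesis en_exp : forall q, 0 < q ->
  expR (- (q * w (en n)^-1)) @[n --> \oo] --> (0 : R).

Let tau chi xi := T (modulate chi (- xi)).
Let sigma chi xi := cd%:C%C * tau chi xi.

Let exp_cvg0 C q : 0 < q ->
  C * expR (- (q * w (en n)^-1)) @[n --> \oo] --> (0 : R).
Proof. by move=> q0; rewrite -(mulr0 C); exact: (cvgM (cvg_cst C) (en_exp q0)). Qed.

Lemma tau_ccvg chi xi : test chi ->
  ccvg (fun n => fourier (fun x => chi x * g (en n) x) xi) (tau chi xi).
Proof.
move=> tchi; have [C [c [q [dl [C0 c0 q0 dl0 [_ H]]]]]] :=
  transform_limit hw hT ug reg assoc tchi.
apply: (ccvg_near _ (exp_cvg0 (C * expR (- (c * om xi))) q0)).
by apply: filterS (en_small dl0) => n nd; exact: H.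
Qed.

Lemma tau_vmeas chi : test chi -> vmeas (tau chi).
Proof.
move=> tchi; apply: (@ccvg_cmeas _ _ _
  (fun n t => fourier (fun x => chi x * g (en n) x) (row t))) => [n|t].
  exact: fourier_vmeas (test_cc (ultradiff_test (ug (en01 n)) tchi)).
exact: tau_ccvg.
Qed.

Lemma tau_rapid chi : test chi -> rapid (tau chi).
Proof.
move=> tchi; have [C [c [q [dl [C0 c0 q0 dl0 [H _]]]]]] :=
  transform_limit hw hT ug reg assoc tchi.
exact: (rapid_exp_om hw (tau_vmeas tchi) c0 H).
Qed.

(** The inversion formula turns the rate of convergence of the transforms,
    integrable in [xi], into a uniform rate for the localised net. *)
Lemma local_uniform_limit chi : test chi -> exists C q dl, [/\ 0 < q, 0 < dl &
  forall e, 0 < e < 1 -> e < dl -> forall x,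
  normc (chi x * g e x - invF (sigma chi) x) <= C * expR (- (q * w e^-1))].
Proof.
move=> tchi; have [C [c [q [dl [C0 c0 q0 dl0 [_ H]]]]]] :=
  transform_limit hw hT ug reg assoc tchi.
have [D D0 HD] := @exp_om_Wt R d w hw c c0.
pose I := \int[ld]_t Wt (row t) : R.
exists (cd * (C * D * I)), q, dl; split => // e e01 ed x.
have tg := ultradiff_test (ug e01) tchi; have cg := test_cc tg.
have [l l0 fl] := test_ufin hw tg.
have iff := ufin_vinteg hw cg (ltW l0) fl.
have itau := rapid_vinteg (tau_rapid tchi).
rewrite (cc_inversionV x cg iff).
have -> : invF (sigma chi) x = cd%:C%C * invF (tau chi) x.
  rewrite /invF -cintZ; last exact: cinteg_invF.
  by apply: eq_cint => t; rewrite /sigma mulrA.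
rewrite -mulrBr ComplexField.Normc.normcM normc_real gtr0_norm ?cd_gt0// -mulrA.
rewrite ler_wpM2l ?(ltW (@cd_gt0 R d))//.
set E := expR (- (q * w e^-1)).
have -> : C * D * I * E = \int[ld]_t (C * D * E * Wt (row t)).
  by rewrite (RintegralZl _ measurableT (@rinteg_Wt R d)) -/I; ring.
have i1 := cinteg_invF x iff; have i2 := cinteg_invF x itau.
rewrite /invF -cintB//; apply: normc_cint_le_bound.
- exact: (cinteg_meas (cintegB i1 i2)).
- exact: (rintegZ _ (@rinteg_Wt R d)).
move=> t; rewrite -mulrBl normc_mul_expi (le_trans (H e e01 ed (row t)))// -/E.
rewrite (mulrAC (C * D)) ler_wpM2r ?expR_ge0// -mulrA.
by rewrite ler_wpM2l.
Qed.

Lemma pointwise_limit chi x : test chi ->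
  ccvg (fun n => chi x * g (en n) x) (invF (sigma chi) x).
Proof.
move=> tchi; have [C [q [dl [q0 dl0 H]]]] := local_uniform_limit tchi.
apply: (ccvg_near _ (exp_cvg0 C q0)).
by apply: filterS (en_small dl0) => n nd; exact: H.
Qed.

(** The pointwise limit [f] of the net represents [T], because [chi f] is the
    inverse transform of the limit of the transforms of [chi g_e], and this limit
    is at once the transform of [chi T] and rapidly decreasing. *)
Theorem limit_is_ultradiff : is_ultradiff w Om T.
Proof.
have /choice [f Hf] : forall x, exists y, Om x -> ccvg (fun n => g (en n) x) y.
  move=> x; have [Ox|nOx] := pselect (Om x); last by exists 0.
  have [K [cK KO nK]] := nbhs_compact Ox.
  have [chi tchi chi1] := cutoff hw ug reg cK KO.
  exists (invF (sigma chi) x) => _; have := pointwise_limit x tchi.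
  rewrite (chi1 x (nbhs_singleton nK)).
  by under eq_fun do rewrite mul1r.
have fE chi x : test chi -> chi x * f x = invF (sigma chi) x.
  move=> tchi; apply: (ccvg_unique _ (pointwise_limit x tchi)).
  have [Ox|nOx] := pselect (Om x).
    exact: (ccvgM (ccvg_cst (chi x)) (Hf x Ox)).
  have -> : chi x = 0.
    by apply: tsupport_eq0 => /(test_sub tchi).
  by under eq_fun do rewrite mul0r; rewrite mul0r; exact: ccvg_cst.
have fFE chi : test chi -> (fun x => chi x * f x) = invF (sigma chi).
  by move=> tchi; apply/funext => x; exact: fE.
have ccf chi : test chi -> cc (fun x => chi x * f x).
  move=> tchi; split.
    by rewrite fFE//; apply: invF_ccontinuous; exact: rapidZ (tau_rapid tchi).
  have [_ s] := test_cc tchi; apply: tsupport_compact s => x ->.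
  by rewrite mul0r.
(* both sides are limits of the transforms of the localised net *)
have tauE chi xi : test chi -> fourier (fun x => chi x * f x) xi = tau chi xi.
  move=> tchi; apply: (ccvg_unique _ (tau_ccvg xi tchi)).
  have [cchi schi] := test_cc tchi.
  have [rho trho rho1] := cutoff hw ug reg schi (test_sub tchi).
  have [C [q [dl [q0 dl0 H]]]] := local_uniform_limit tchi.
  have irho := rinteg_normc (cc_vinteg (test_cc trho)).
  apply: (ccvg_near _ (exp_cvg0 (norm1 rho * C) q0)).
  apply: filterS (en_small dl0) => n nd.
  have i1 := vinteg_expi (- xi) (cc_vinteg (test_cc (ultradiff_test (ug (en01 n)) tchi))).
  have i2 := vinteg_expi (- xi) (cc_vinteg (ccf chi tchi)).
  rewrite !fourierE -cintB//.
  have -> : norm1 rho * C * expR (- (q * w (en n)^-1)) =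
      \int[ld]_t (C * expR (- (q * w (en n)^-1)) * normc (rho (row t))).
    by rewrite (RintegralZl _ measurableT irho) /norm1; ring.
  apply: normc_cint_le_bound.
  - exact: (cinteg_meas (cintegB i1 i2)).
  - exact: (rintegZ _ irho).
  move=> t; rewrite -mulrBl normc_mul_expi.
  have [xs|xs] := pselect (tsupport chi (row t)).
    rewrite rho1// ComplexField.Normc.normc1 mulr1 fE//; exact: H.
  rewrite (tsupport_eq0 xs) !mul0r subrr ComplexField.Normc.normc0.
  rewrite mulr_ge0 ?normc_ge0//.
  by apply: le_trans (H _ (en01 n) nd 0); exact: normc_ge0.
have tf chi : test chi -> test (fun x => chi x * f x).
  move=> tchi; have [C [c [q [dl [C0 c0 q0 dl0 [H _]]]]]] :=
    transform_limit hw hT ug reg assoc tchi.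
  have c2 : c / 2 < c by rewrite ltr_pdivrMr// ltr_pMr// ltr1n.
  apply: (testP hw (ccf chi tchi) _ (divr_gt0 c0 (ltr0n R 2))).
    apply: subset_trans (test_sub tchi); apply: tsupport_subset => x ->.
    by rewrite mul0r.
  apply: (ufin_decay hw (ccf chi tchi) c2 (C := C)) => xi.
  by rewrite tauE//; exact: H.
have smooth : csmooth_on Om f.
  have loc x : Om x -> exists2 chi, test chi & \forall y \near x, f y = invF (sigma chi) y.
    move=> Ox; have [K [cK KO nK]] := nbhs_compact Ox.
    have [chi tchi chi1] := cutoff hw ug reg cK KO.
    exists chi => //; apply: (@filterS _ (nbhs x) _ _ _ _ nK) => y Ky.
    by rewrite -fE// chi1// mul1r.
  split; apply: smooth_on_near => x Ox; have [chi tchi nf] := loc x Ox;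
    have [sR sI] := invF_smooth (rapidZ cd%:C%C (tau_rapid tchi)).
  - exists (fun x => complex.Re (invF (sigma chi) x)); last exact: sR.
    by apply: (@filterS _ (nbhs x) _ _ _ _ nf) => y ->.
  - exists (fun x => complex.Im (invF (sigma chi) x)); last exact: sI.
    by apply: (@filterS _ (nbhs x) _ _ _ _ nf) => y ->.
exists f; first by split.
move=> phi tphi; rewrite pairingE tauE// /tau; congr T.
by apply/funext => x; rewrite /modulate oppr0 dotv0r expi0 mulr1.
Qed.

End SmoothLimit.

Theorem theorem7p3 (R : realType) (d : nat) (Omega : set 'rV[R]_d)
    (w : R -> R) (T : ('rV[R]_d -> R[i]) -> R[i]) (G : set (@net R d)) :
  open Omega -> weight w ->
  ultradistribution w Omega T ->
  regular_gen_functions w Omega G ->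
  strictly_associated w Omega T G ->
  is_ultradiff w Omega T.
Proof.
move=> oO hw hT [gG [g Gg reg]] as_.
have assoc := associated_representative hw gG Gg as_.
have [g0 _ gE] := gG; have ug : ultradiff_net w Omega g.
  by move: Gg; rewrite -gE => -[[]].
have [en [en01 en_small en_exp]] := parameter_sequence hw.
exact: (limit_is_ultradiff oO hw hT ug reg assoc en01 en_small en_exp).
Qed.
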